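(* Let $\Phi=\{\phi_i\}_{i\in\mathcal I}$ be a complex contracting iterated function system on the unit interval $[0,1]$, $\mathbf p=(p_1,\ldots,p_N)$ a probability vector, and $\mu$ the stationary probability measure associated to $\Phi$ and $\mathbf p$. Let $\gamma_n:=\int_{-\infty}^{\infty} x^n\,d\mu(x)$ for $n=0,1,2,\ldots$ be the moments of $\mu$. Then, for each fixed $m\in\mathbb N$, the algorithm $g\mapsto\mu_k(g)$ described in the context gives approximations $$w_k:=\bigl(\mu_k(x^0),\mu_k(x^1),\ldots,\mu_k(x^m)\bigr)\in\mathbb R^{m+1},\qquad k=1,2,\ldots,$$ to $\gamma_{[0,m]}:=(\gamma_0,\gamma_1,\ldots,\gamma_m)$ with a super-exponential rate of convergence: there exist constants $C,\lambda>0$ independent of $k$ such that $$\|w_k-\gamma_{[0,m]}\|<C\exp(-\lambda k^2)\qquad\text{for } k=1,2,\ldots.$$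
   Context: Let $\mathcal I=\{1,\ldots,N\}$ with $N\ge 2$. An iterated function system on $[0,1]$ is a family $\Phi=\{\phi_i\}_{i\in\mathcal I}$ of Lipschitz contractions $\phi_i:[0,1]\to[0,1]$. A probability vector is $\mathbf p=(p_1,\ldots,p_N)$ with $0<p_i<1$ and $\sum_i p_i=1$. The stationary probability measure $\mu$ associated to $\Phi$ and $\mathbf p$ is the unique probability measure with $\int\varphi\,d\mu=\sum_{i\in\mathcal I}p_i\int\varphi\circ\phi_i\,d\mu$ for every continuous $\varphi:[0,1]\to\mathbb R$. $\Phi$ is complex contracting if there is a non-empty, bounded, connected, open set $\mathcal D\subset\mathbb C$ with $[0,1]\subset\mathcal D$ such that each $\phi_i$ extends holomorphically to $\mathcal D$, each $\phi_i'$ is continuous on the boundary of $\mathcal D$, and $\sup_{i\in\mathcal I}\sup_{z\in\mathcal D}|\phi_i'(z)|<1$. For $\mathbf i=i_1\cdots i_n\in\mathcal I^n$: $\phi_{\mathbf i}:=\phi_{i_1}\circ\cdots\circ\phi_{i_n}$; $p_{\mathbf i}:=\prod_{j=1}^n p_{i_j}$; $\sigma^k\mathbf i:=i_{k+1}\cdots i_n i_1\cdots i_k$ for $1\le k\le n-1$; and $z_{\mathbf i}\in[0,1]$ is the fixed point of $\phi_{\mathbf i}$. For $g:[0,1]\to\mathbb R$ and $r\ge1$ set $t_r:=\sum_{\mathbf i\in\mathcal I^r}\frac{p_{\mathbf i}}{1-\phi_{\mathbf i}'(z_{\mathbf i})}$ and $\tau_r:=\sum_{\mathbf i\in\mathcal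 I^r}p_{\mathbf i}\frac{g(z_{\mathbf i})+g(z_{\sigma\mathbf i})+\cdots+g(z_{\sigma^{r-1}\mathbf i})}{1-\phi_{\mathbf i}'(z_{\mathbf i})}$. For $n\ge1$ set $$\alpha_n:=\sum_{l=1}^n\frac{(-1)^l}{l!}\sum_{n_1+\cdots+n_l=n}\sum_{j=1}^l\frac{\tau_{n_j}}{n_j}\prod_{1\le q\le l,\,q\ne j}\frac{t_{n_q}}{n_q},\qquad a_n:=\sum_{l=1}^n\frac{(-1)^l}{l!}\sum_{n_1+\cdots+n_l=n}\prod_{i=1}^l\frac{t_{n_i}}{n_i}$$ (sums over positive integers $n_1,\ldots,n_l$), $\alpha_0:=0$, $a_0:=1$, and $\mu_k(g):=\frac{\sum_{n=0}^k\alpha_n}{\sum_{n=0}^k na_n}$ for $k=1,2,\ldots$. In the claim $\mu_k(x^j)$ means $\mu_k(g)$ with $g(x)=x^j$, and $\|\cdot\|$ is the Euclidean norm. *)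

(* Defs.v *)
From HB Require Import structures.
From mathcomp Require Import all_boot all_order all_algebra.
From mathcomp Require Import all_classical all_reals all_analysis.
From mathcomp Require Import complex.

Set Implicit Arguments.
Unset Strict Implicit.
Unset Printing Implicit Defensive.

Import Order.TTheory GRing.Theory Num.Theory.
Import numFieldNormedType.Exports.

Local Open Scope classical_set_scope.
Local Open Scope ring_scope.

Definition I01 (R : realType) : set R := `[0, 1].
Arguments I01 {R}.

(* Maps of [0, 1] to itself are functions R -> R mapping [0, 1] into [0, 1];
   only their values on [0, 1] are ever used. *)
Definition ifs_maps (R : realType) (N : nat) : Type :=
  'I_N -> {fun @I01 R >-> @I01 R}.

Definition is_ifs (R : realType) (N : nat) (phi : ifs_maps R N) : Prop :=
  forall i, is_contraction (phi i).

Definition probability_vector (R : realType) (N : nat) (p : 'I_N -> R) : Prop :=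
  (forall i, 0 < p i < 1) /\ \sum_i p i = 1.

(* A probability measure on [0, 1] is a probability on R giving mass 1 to
   [0, 1]. *)
Definition stationary (R : realType) (N : nat) (phi : ifs_maps R N)
    (p : 'I_N -> R) (mu : probability (measurableTypeR R) R) : Prop :=
  mu I01 = 1%E /\
  forall h : R -> R, {within I01, continuous h} ->
    \int[mu]_(x in I01) h x = \sum_i p i * \int[mu]_(x in I01) h (phi i x).

(* R[i]^o is the complex field as a normed space over itself, so that
   derivability in the direction 1 is complex differentiability.
   Continuity of the derivative on the boundary of D (where the extension need
   not be defined) means that it extends continuously to the closure of D. *)
Definition complex_contracting (R : realType) (N : nat)
    (phi : ifs_maps R N) : Prop :=
  exists D : set R[i]^o,
    [/\ D !=set0, bounded_set D, connected D & open D] /\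
    (forall x : R, I01 x -> D x%:C%C) /\
    exists f : 'I_N -> R[i]^o -> R[i]^o,
      [/\ forall i (x : R), I01 x -> f i x%:C%C = (phi i x)%:C%C,
          forall i z, D z -> derivable (f i) z 1,
          forall i, exists df : R[i]^o -> R[i]^o,
            {within closure D, continuous df} /\
            (forall z, D z -> df z = 'D_1 (f i) z)
        & (ereal_sup [set r | exists i, exists2 z, D z &
              r = (complex.Re `|'D_1 (f i) z|)%:E] < 1)%E].

(* The derivative of a function on [0, 1]: one-sided at the endpoints. *)
Definition derive01 (R : realType) (f : R -> R) (x : R) : R :=
  lim ((f y - f x) / (y - x) @[y --> within I01 x^']).

Section Algorithm.
Context (R : realType) (N : nat) (phi : ifs_maps R N) (p : 'I_N -> R).

Definition word_map (w : seq 'I_N) : R -> R :=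
  foldr (fun i f => phi i \o f) id w.

Definition word_weight (w : seq 'I_N) : R := \prod_(i <- w) p i.

Definition word_fixpoint (w : seq 'I_N) : R :=
  xget 0 [set z | I01 z /\ word_map w z = z].

Definition word_den (w : seq 'I_N) : R :=
  1 - derive01 (word_map w) (word_fixpoint w).

Definition t_ (r : nat) : R :=
  \sum_(w : r.-tuple 'I_N) word_weight w / word_den w.

Definition tau_ (g : R -> R) (r : nat) : R :=
  \sum_(w : r.-tuple 'I_N)
    word_weight w * ((\sum_(k < r) g (word_fixpoint (rot k w))) / word_den w).

(* c = (n_1, ..., n_l) with positive entries of sum n; the entries of such a
   tuple are at most n. *)
Definition composition (n l : nat) (c : {ffun 'I_l -> 'I_n.+1}) : bool :=
  [forall j, (0 < c j)%N] && (\sum_j c j == n)%N.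

Definition alpha_ (g : R -> R) (n : nat) : R :=
  \sum_(1 <= l < n.+1) (-1) ^+ l / (l`!)%:R *
    \sum_(c : {ffun 'I_l -> 'I_n.+1} | composition c)
      \sum_j tau_ g (c j) / (c j)%:R *
        \prod_(q | q != j) (t_ (c q) / (c q)%:R).

Definition a_ (n : nat) : R :=
  if n == 0%N then 1 else
  \sum_(1 <= l < n.+1) (-1) ^+ l / (l`!)%:R *
    \sum_(c : {ffun 'I_l -> 'I_n.+1} | composition c)
      \prod_j (t_ (c j) / (c j)%:R).

(* alpha_ g 0 is an empty sum, hence 0. *)
Definition mu_approx (g : R -> R) (k : nat) : R :=
  (\sum_(0 <= n < k.+1) alpha_ g n) / (\sum_(0 <= n < k.+1) n%:R * a_ n).

Definition moment_approx (m k : nat) : 'rV[R]_m.+1 :=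
  \row_(j < m.+1) mu_approx (fun x => x ^+ j) k.

End Algorithm.

Definition moments (R : realType) (mu : probability (measurableTypeR R) R)
    (m : nat) : 'rV[R]_m.+1 :=
  \row_(j < m.+1) \int[mu]_x (x ^+ j).

(* The library norm on row vectors is the sup norm. *)
Definition euclidean_norm (R : realType) (n : nat) (v : 'rV[R]_n) : R :=
  Num.sqrt (\sum_j v ord0 j ^+ 2).

(* Main.v *)
(** With [L h = \sum_i p_i (h o phi_i)] on functions holomorphic near [0, 1],
    [t_r] is the trace of [L ^ r], so that the [a_n] are the Taylor
    coefficients of the Fredholm determinant
    [d z = exp (- \sum_r t_r z ^ r / r)] and the [alpha_n] those of its
    derivative in the direction [L o M_g], [M_g] being multiplication by [g].
    In coefficients, [n a_n = - \sum_r t_r a_(n-r)] and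
    [alpha_n = - \sum_r (tau_r / r) a_(n-r)].

    Superexponential decay.  Cauchy's formula on a polygon with [m] nodes on
    each side of a stadium around [0, 1] replaces [L] by a matrix whose
    Fredholm coefficients are sums of minors with entries
    [\sum_k p_k / (zeta_b - phi_k zeta_a)].  As each [phi_k zeta_a] is close to
    a point of a fixed grid of [0, 1], relative to the distance from that point
    to the contour, Taylor expansion at the grid points followed by Schmidt
    orthonormalisation bounds the minors of order [n] by [exp (- lam n ^ 2)],
    uniformly in [m].  As [m] grows the traces of the matrices tend to those of
    [L], and the recurrences carry this limit, hence the bound, to [a_n] and
    [alpha_n].

    Convergence.  Contraction gives [t_r = 1 + O(c ^ r)] and
    [tau_r / r = mu(g) + O(c ^ r)], so [b z = d z / (1 - z)] is the exponential
    of a series with radius of convergence greater than 1: its coefficients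
    decay geometrically and [b 1 <> 0].  Therefore [\sum_n n a_n = - b 1] and
    [\sum_n alpha_n = - mu(g) b 1], and the truncation errors are Gaussian
    because [a_n] and [alpha_n] are. *)

Require Import Defs.
From HB Require Import structures.
From mathcomp Require Import all_boot all_order all_algebra.
From mathcomp Require Import all_classical all_reals all_analysis.
From mathcomp Require Import measurable_realfun.
From mathcomp Require Import complex perm spectral ring lra.

Set Implicit Arguments.
Unset Strict Implicit.
Unset Printing Implicit Defensive.

Import Order.TTheory GRing.Theory Num.Theory.
Import numFieldNormedType.Exports.

Local Open Scope ring_scope.

(** * Complex modulus *)

(** The whole argument is finite: only Riemann sums, finite determinants and limits of single
    coefficients occur. A polygon yields 2 pi i only approximately, so every Cauchy sum is divided
    by its own winding sum at 0. Holomorphy is used as a uniform first-order remainder; Cauchy sums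
    upgrade it to a quadratic remainder on a smaller neighbourhood and extend difference quotients
    over their base point. One Taylor centre would not do for the minors: the images of the contour
    may spread along the whole of [0, 1], and a disc containing them need not stay inside the
    contour. With M + 1 centres the size of column b is only q ^ (b / (M + 1)), but the product over
    the columns is still Gaussian. The bound is independent of the number of nodes because the
    quadrature weights factor out of the columns and their moduli have a bounded sum. *)

Section Modulus.
Context (R : realType).
Implicit Types (z w : R[i]) (x : R).

Definition cabs z : R := complex.Re `|z|.

Lemma cabsE z : `|z| = (cabs z)%:C%C.
Proof. by rewrite /cabs normc_def. Qed.

Lemma cabs_ge0 z : 0 <= cabs z.
Proof. by rewrite /cabs normc_def sqrtr_ge0. Qed.

Lemma cabsM z w : cabs (z * w) = cabs z * cabs w.
Proof. by apply: complexI; rewrite rmorphM /= -!cabsE normrM. Qed.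

Lemma cabsV z : cabs z^-1 = (cabs z)^-1.
Proof. by apply: complexI; rewrite fmorphV /= -!cabsE normfV. Qed.

Lemma cabsN z : cabs (- z) = cabs z.
Proof. by rewrite /cabs normrN. Qed.

Lemma cabsB z w : cabs (z - w) = cabs (w - z).
Proof. by rewrite /cabs distrC. Qed.

Lemma cabs0 : cabs 0 = 0.
Proof. by rewrite /cabs normr0. Qed.

Lemma cabs1 : cabs 1 = 1.
Proof. by rewrite /cabs normr1. Qed.

Lemma cabs_eq0 z : (cabs z == 0) = (z == 0).
Proof. by rewrite -(inj_eq (@complexI R)) -cabsE rmorph0 normr_eq0. Qed.

Lemma cabs_gt0 z : (0 < cabs z) = (z != 0).
Proof. by rewrite lt_def cabs_eq0 cabs_ge0 andbT. Qed.

Lemma cabsD z w : cabs (z + w) <= cabs z + cabs w.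
Proof. by rewrite -lecR rmorphD /= -!cabsE ler_normD. Qed.

Lemma cabs_subD z w v : cabs (z - w) <= cabs (z - v) + cabs (v - w).
Proof. by rewrite (_ : z - w = (z - v) + (v - w)) ?cabsD // addrA subrK. Qed.

Lemma cabs_dist z w : cabs z - cabs w <= cabs (z - w).
Proof. by rewrite lerBlDr -{1}(subrK w z) cabsD. Qed.

Lemma cabs_real x : cabs x%:C%C = `|x|.
Proof. by rewrite /cabs normc_def /= expr0n /= addr0 sqrtr_sqr. Qed.

Lemma cabs_natr n : cabs n%:R = n%:R.
Proof. by rewrite /cabs normr_nat -(rmorph_nat (real_complex R)). Qed.

Lemma cabsX z n : cabs (z ^+ n) = cabs z ^+ n.
Proof. by apply: complexI; rewrite rmorphXn /= -!cabsE normrX. Qed.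

Lemma cabs_sum (I : Type) (s : seq I) (P : pred I) (F : I -> R[i]) :
  cabs (\sum_(i <- s | P i) F i) <= \sum_(i <- s | P i) cabs (F i).
Proof.
apply: (big_ind2 (fun z x => cabs z <= x)) => //; first by rewrite cabs0.
by move=> z1 x1 z2 x2 h1 h2; rewrite (le_trans (cabsD _ _)) // lerD.
Qed.

Lemma cabs_prod (I : Type) (s : seq I) (P : pred I) (F : I -> R[i]) :
  cabs (\prod_(i <- s | P i) F i) = \prod_(i <- s | P i) cabs (F i).
Proof. exact: (big_morph cabs cabsM cabs1). Qed.

Lemma cabs_sign n : cabs ((-1) ^+ n) = 1.
Proof. by rewrite cabsX cabsN cabs1 expr1n. Qed.

Lemma Re_le_cabs z : `|complex.Re z| <= cabs z.
Proof. by rewrite /cabs normc_def -sqrtr_sqr ler_wsqrtr // lerDl sqr_ge0. Qed.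

Lemma Im_le_cabs z : `|complex.Im z| <= cabs z.
Proof. by rewrite /cabs normc_def -sqrtr_sqr ler_wsqrtr // lerDr sqr_ge0. Qed.

Lemma cabs_le_ReIm z : cabs z <= `|complex.Re z| + `|complex.Im z|.
Proof.
case: z => a b; have -> : (a +i* b = a%:C + 0 +i* b)%C by simpc.
rewrite (le_trans (cabsD _ _)) //= !add0r addr0 cabs_real lerD2l.
by rewrite /cabs normc_def /= expr0n /= add0r sqrtr_sqr.
Qed.
End Modulus.

(** * Fredholm coefficients of a finite kernel *)

Section Newton.
Context (F : comNzRingType) (T : finType).
Implicit Types L B : T -> T -> F.

Definition kmul L B : T -> T -> F := fun x y => \sum_z L x z * B z y.
Definition ktr B : F := \sum_x B x x.

Lemma ktr_kmulC L B : ktr (kmul L B) = ktr (kmul B L).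
Proof.
rewrite /ktr /kmul exchange_big /=; apply: eq_bigr => x _.
by apply: eq_bigr => y _; rewrite mulrC.
Qed.

Definition kminor n L (k : {ffun 'I_n -> T}) : 'M[F]_n :=
  \matrix_(a, b) L (k a) (k b).

(** Replacing one row of [L] by that of [B] gives one term of the derivative of the minor in the
    direction [B]. *)
Definition kminor_row n L B (r : 'I_n) (k : {ffun 'I_n -> T}) : 'M[F]_n :=
  \matrix_(a, b) (if a == r then B (k a) (k b) else L (k a) (k b)).

(* The sum runs over all n-tuples: n! times the sum of the principal minors. *)
Definition minor_sum n L : F := \sum_k \det (kminor (n := n) L k).

Definition row_minor_sum n L B : F :=
  \sum_k \det (kminor_row (n := n.+1) L B ord0 k).

Lemma row_minor_sum_self n L : row_minor_sum n L L = minor_sum n.+1 L.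
Proof.
apply: eq_bigr => k _; congr (\det _); apply/matrixP => a b; rewrite !mxE.
by case: ifP.
Qed.

Lemma minor_sum0 L : minor_sum 0 L = 1.
Proof.
rewrite /minor_sum (eq_bigr (fun=> 1)); last by move=> k _; rewrite det_mx00.
by rewrite sumr_const card_ffun card_ord expn0.
Qed.

(** Swapping [ord0] and [r] in the tuple permutes rows and columns by the same transposition, so the
    two signs cancel. *)
Lemma sum_row_minor n L B (r : 'I_n.+1) :
  \sum_k \det (kminor_row L B r k) = row_minor_sum n L B.
Proof.
pose s := tperm ord0 r.
pose h (k : {ffun 'I_n.+1 -> T}) : {ffun 'I_n.+1 -> T} := [ffun i => k (s i)].
have hK : involutive h by move=> k; apply/ffunP => i; rewrite !ffunE tpermK.
rewrite /row_minor_sum (reindex h) /=; last by exists h => k _; rewrite hK.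
apply: eq_bigr => k _.
have -> : kminor_row L B ord0 k = row_perm s (col_perm s (kminor_row L B r (h k))).
  apply/matrixP => a b; rewrite !mxE !ffunE /s !tpermK.
  by rewrite -{2}(tpermL ord0 r) (inj_eq perm_inj).
rewrite row_permE col_permE !det_mulmx det_perm det_perm odd_permV.
by rewrite mulrCA -signr_addb addbb mulr1.
Qed.

(** Expand along row 0, then each minor but the first along column 0; the double minors that remain
    are cofactors of the inner block. *)
Lemma det_border n (M : 'M[F]_n.+1) :
  \det M = M ord0 ord0 * \det (row' ord0 (col' ord0 M))
    - \sum_b \sum_a M ord0 (lift ord0 b) * M (lift ord0 a) ord0 *
        cofactor (row' ord0 (col' ord0 M)) a b.
Proof.
rewrite (expand_det_row M ord0) big_ord_recl /=; congr (_ + _).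
  by rewrite /cofactor add0n expr0 mul1r.
rewrite -sumrN; apply: eq_bigr => b _.
rewrite {1}/cofactor /=.
case: n => [|n] in M b *; first by case: b.
rewrite (expand_det_col _ ord0) !mulr_sumr -sumrN; apply: eq_bigr => a _.
rewrite /cofactor !mxE.
have -> : lift (lift ord0 b) ord0 = ord0 :> 'I_n.+2 by apply: val_inj.
have -> : row' a (col' ord0 (row' ord0 (col' (lift ord0 b) M))) =
          row' a (col' b (row' ord0 (col' ord0 M))).
  apply/matrixP => i j; rewrite !mxE; congr (M _ _).
  by apply: val_inj; rewrite /= /bump /= !add1n ltnS addnS.
rewrite /= /bump /= !add1n addn0 exprS !mulN1r exprD.
by ring.
Qed.

Definition fcons n (p : T * {ffun 'I_n -> T}) : {ffun 'I_n.+1 -> T} :=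
  [ffun i => if unlift ord0 i is Some j then p.2 j else p.1].

Lemma sum_fcons n (G : {ffun 'I_n.+1 -> T} -> F) :
  \sum_k G k = \sum_x \sum_k G (fcons (x, k)).
Proof.
rewrite pair_bigA /= (reindex (@fcons n)) /=.
  by apply: eq_bigr => -[x k] _.
exists (fun k => (k ord0, [ffun i => k (lift ord0 i)])) => [[x k]|k] _ /=.
  congr pair; first by rewrite ffunE unlift_none.
  by apply/ffunP => i; rewrite !ffunE liftK.
apply/ffunP => i; rewrite !ffunE; case: unliftP => [j ->|->] //.
by rewrite ffunE.
Qed.

(** In the bordered expansion the sum over the first point [x] contracts [L (k a) x * B x (k b)] to
    [kmul L B], so the cofactor terms form a minor whose row [a] comes from [kmul L B]. All [n]
    choices of [a] give the same sum. *)
Lemma row_minor_sumE n L B : row_minor_sum n L B =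
  ktr B * minor_sum n L - (if n is n'.+1 then n%:R * row_minor_sum n' L (kmul L B) else 0).
Proof.
rewrite {1}/row_minor_sum sum_fcons.
have E x (k : {ffun 'I_n -> T}) :
   row' ord0 (col' ord0 (kminor_row L B ord0 (fcons (x, k)))) = kminor L k.
  by apply/matrixP => a b; rewrite !mxE !ffunE !liftK.
under eq_bigr => x _.
  under eq_bigr => k _.
    rewrite det_border E {1}/kminor_row !mxE eqxx.
    rewrite {1 2}/fcons !ffunE unlift_none /=.
    under eq_bigr => b _ do under eq_bigr => a _ do
      rewrite {1 2}/kminor_row !mxE eqxx /= !ffunE !liftK unlift_none /=.
    over.
  rewrite big_split /= -mulr_sumr sumrN; over.
rewrite big_split /= -mulr_suml sumrN; congr (_ - _).
rewrite exchange_big /=.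
transitivity (\sum_(k : {ffun 'I_n -> T}) \sum_(a < n) \det (kminor_row L (kmul L B) a k)).
  apply: eq_bigr => k _; rewrite exchange_big /= [RHS](eq_bigr (fun a =>
     \sum_b kmul L B (k a) (k b) * cofactor (kminor L k) a b)); last first.
    move=> a _; rewrite (expand_det_row _ a); apply: eq_bigr => b _.
    rewrite mxE eqxx; congr (_ * _); rewrite /cofactor; congr (_ * \det _).
    by apply/matrixP => i j; rewrite !mxE [lift _ _ == _]eq_sym (negbTE (neq_lift _ _)).
  rewrite [RHS]exchange_big /=; apply: eq_bigr => b _.
  rewrite exchange_big /=; apply: eq_bigr => a _; rewrite -mulr_suml; congr (_ * _).
  by apply: eq_bigr => x _; rewrite mulrC.
case: n E => [|n] E; first by rewrite big1 // => k _; rewrite big_ord0.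
rewrite exchange_big /= (eq_bigr (fun=> row_minor_sum n L (kmul L B))).
  by rewrite sumr_const card_ord mulr_natl.
by move=> a _; exact: sum_row_minor.
Qed.
End Newton.

(** * Newton's identities and the derivative of the Fredholm coefficients *)

Section NewtonField.
Context (F : numFieldType) (T : finType).
Implicit Types L B : T -> T -> F.

Lemma row_minor_sum_newton n L B :
  row_minor_sum n L B / n`!%:R = \sum_(i < n.+1)
    (-1) ^+ i * ktr (iter i (kmul L) B) * (minor_sum (n - i)%N L / (n - i)`!%:R).
Proof.
elim: n B => [|n IH] B.
  by rewrite row_minor_sumE big_ord1 /= subr0 expr0 mul1r mulrA.
rewrite row_minor_sumE big_ord_recl /= subn0 expr0 mul1r mulrBl -mulrA.
congr (_ + _); rewrite factS natrM invfM mulrACA divff ?pnatr_eq0 // mul1r IH.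
rewrite -sumrN; apply: eq_bigr => i _.
by rewrite /bump /= add1n subSS -iterSr exprS mulN1r !mulNr.
Qed.

Definition fredholm_coef L n : F := (-1) ^+ n * (minor_sum n L / n`!%:R).
(** Derivative of [fredholm_coef L n.+1] in the direction [B], hence the shifted sign: [n.+1] equal
    row contributions turn the factorial of [n.+1] into that of [n]. *)
Definition fredholm_deriv L B n : F := (-1) ^+ n.+1 * (row_minor_sum n L B / n`!%:R).

Lemma fredholm_derivE L B n : fredholm_deriv L B n =
  - \sum_(i < n.+1) ktr (iter i (kmul L) B) * fredholm_coef L (n - i)%N.
Proof.
rewrite /fredholm_deriv row_minor_sum_newton mulr_sumr -sumrN.
apply: eq_bigr => i _; rewrite /fredholm_coef.
have -> : (-1) ^+ n.+1 = - ((-1) ^+ i * (-1) ^+ (n - i)) :> F.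
  by rewrite -exprD subnKC ?exprS ?mulN1r // -ltnS.
have : (-1) ^+ i * (-1) ^+ i = 1 :> F by rewrite -exprMn mulrNN mulr1 expr1n.
set e := (-1) ^+ i; set e' := (-1) ^+ (n - i) => e2.
rewrite mulNr; congr (- _).
by rewrite mulrACA [e * (e * _)]mulrA e2 mul1r mulrCA mulrA mulrAC -mulrA.
Qed.

(** Euler's identity for a homogeneous polynomial. With [fredholm_derivE] at [B = L] it determines
    the coefficients from the traces of powers. *)
Lemma fredholm_coefS L n :
  n.+1%:R * fredholm_coef L n.+1 = fredholm_deriv L L n.
Proof.
rewrite /fredholm_deriv row_minor_sum_self /fredholm_coef factS natrM invfM.
by rewrite mulrCA [_ * (_ * (_ / _))]mulrCA mulVKf ?pnatr_eq0.
Qed.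

Lemma fredholm_coef0 L : fredholm_coef L 0 = 1.
Proof. by rewrite /fredholm_coef minor_sum0 expr0 divr1 mulr1. Qed.
End NewtonField.

(** * Sums over compositions *)

Section Compositions.
Context (F : numFieldType).
Implicit Types (p q : {poly F}) (t tau : nat -> F).

(** Congruence modulo ['X^N.+1]: truncated polynomials stand in for power series. *)
Definition eq_upto N p q := forall i, (i <= N)%N -> p`_i = q`_i.

Lemma eq_upto_mul N p p' q q' :
  eq_upto N p p' -> eq_upto N q q' -> eq_upto N (p * q) (p' * q').
Proof.
move=> hp hq i iN; rewrite !coefM; apply: eq_bigr => j _.
rewrite hp ?hq //; last by rewrite (leq_trans _ iN) // -ltnS.
by rewrite (leq_trans (leq_subr _ _)).
Qed.

Lemma eq_upto_prod N l (P Q : 'I_l -> {poly F}) :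
  (forall j, eq_upto N (P j) (Q j)) -> eq_upto N (\prod_j P j) (\prod_j Q j).
Proof.
move=> h; apply: (big_ind2 (eq_upto N)) => // p p' q q'; exact: eq_upto_mul.
Qed.

(** Distributing the product chooses one exponent per factor; the vanishing constant terms discard
    the choices containing a zero exponent. *)
Lemma coef_prod_composition l n (P : 'I_l -> {poly F}) :
  (forall j, (P j)`_0 = 0) ->
  (\prod_j P j)`_n =
    \sum_(c : {ffun 'I_l -> 'I_n.+1} | composition c) \prod_j (P j)`_(c j).
Proof.
move=> P0; pose Q j := \poly_(i < n.+1) (P j)`_i.
rewrite (@eq_upto_prod n _ _ Q) //; last first.
  by move=> j i iN; rewrite coef_poly ltnS iN.
under eq_bigr do rewrite /Q poly_def.
rewrite bigA_distr_bigA /= coef_sum [RHS]big_mkcond /=.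
apply: eq_bigr => c _.
rewrite (eq_bigr (fun j => ((P j)`_(c j))%:P * 'X^(c j))); last first.
  by move=> j _; rewrite mul_polyC.
rewrite big_split /= -rmorph_prod /= prodrXr coefCM coefXn eq_sym /composition.
case: (boolP [forall j, _]) => [_|]; first by case: eqP; rewrite ?mulr1 ?mulr0.
rewrite negb_forall => /existsP[j]; rewrite lt0n negbK => /eqP cj /=.
by rewrite (bigD1 j) //= cj P0 !mul0r.
Qed.

Definition trunc_series N t : {poly F} := \poly_(i < N.+1) (t i / i%:R).

Lemma coef_trunc_series N t i : (i <= N)%N -> (trunc_series N t)`_i = t i / i%:R.
Proof. by move=> iN; rewrite coef_poly ltnS iN. Qed.

(** Rests on the convention that the inverse of 0 is 0, whatever [t 0] is. *)
Lemma coef0_trunc_series N t : (trunc_series N t)`_0 = 0.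
Proof. by rewrite coef_trunc_series // invr0 mulr0. Qed.

Lemma composition_size n l (c : {ffun 'I_l -> 'I_n.+1}) :
  composition c -> (l <= n)%N.
Proof.
case/andP => /forallP c0 /eqP <-; rewrite -[X in (X <= _)%N]card_ord -sum1_card.
by apply: leq_sum => j _; exact: c0.
Qed.

Lemma coef_prod_small l n (P : 'I_l -> {poly F}) :
  (forall j, (P j)`_0 = 0) -> (n < l)%N -> (\prod_j P j)`_n = 0.
Proof.
move=> P0 nl; rewrite coef_prod_composition // big1 // => c /composition_size.
by rewrite leqNgt nl.
Qed.

Lemma coef_exp_small l n p : p`_0 = 0 -> (n < l)%N -> (p ^+ l)`_n = 0.
Proof.
move=> p0 nl; rewrite -[l]card_ord -prodr_const.
by rewrite coef_prod_small.
Qed.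

(** Truncation of exp (- T). As T has no constant term, powers of T beyond [N] do not reach degree
    [N]. *)
Definition exp_trunc N t : {poly F} :=
  \sum_(l < N.+1) ((-1) ^+ l / (l`!)%:R) *: trunc_series N t ^+ l.

(* For the [t_], [tau_] of an iterated function system, [comp_exp] and
   [comp_deriv] are convertible to [a_] and [alpha_]. *)
Definition comp_exp t n : F :=
  if n == 0%N then 1 else
  \sum_(1 <= l < n.+1) (-1) ^+ l / (l`!)%:R *
    \sum_(c : {ffun 'I_l -> 'I_n.+1} | composition c)
      \prod_j (t (c j) / (c j)%:R).

Definition comp_deriv t tau n : F :=
  \sum_(1 <= l < n.+1) (-1) ^+ l / (l`!)%:R *
    \sum_(c : {ffun 'I_l -> 'I_n.+1} | composition c)
      \sum_j tau (c j) / (c j)%:R *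
        \prod_(q | q != j) (t (c q) / (c q)%:R).

Lemma coef_exp_trunc N t n : (n <= N)%N -> (exp_trunc N t)`_n = comp_exp t n.
Proof.
move=> nN; rewrite /exp_trunc coef_sum big_ord_recl /= expr0 fact0 divr1 scale1r.
rewrite expr0 coef1 /comp_exp; case: (posnP n) => [->|n0].
  rewrite big1 ?addr0 // => i _; rewrite coefZ coef_exp_small ?mulr0 //.
  exact: coef0_trunc_series.
rewrite add0r big_add1 /= big_mkord.
rewrite (big_ord_widen_cond N xpredT (fun i => (-1) ^+ i.+1 / (i.+1)`!%:R *
  \sum_(c : {ffun 'I_i.+1 -> 'I_n.+1} | composition c)
      \prod_j (t (c j) / (c j)%:R))) // [RHS]big_mkcond /=.
apply: eq_bigr => i _; rewrite coefZ /bump /= add1n.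
case: ltnP => [ln|nl]; last first.
  by rewrite coef_exp_small ?mulr0 // coef0_trunc_series.
rewrite -[X in trunc_series N t ^+ X](card_ord i.+1) -prodr_const.
rewrite coef_prod_composition; last by move=> ?; exact: coef0_trunc_series.
congr (_ * _); apply: eq_bigr => c _; apply: eq_bigr => j _.
by rewrite coef_trunc_series // (leq_trans _ nN) // -ltnS.
Qed.

Lemma comp_expS t n : n.+1%:R * comp_exp t n.+1 =
  - \sum_(i < n.+1) t i.+1 * comp_exp t (n - i)%N.
Proof.
set T := trunc_series n.+1 t.
have T0 : T`_0 = 0 by exact: coef0_trunc_series.
have dA : (exp_trunc n.+1 t)^`() = - (T^`() *
    (exp_trunc n.+1 t - ((-1) ^+ n.+1 / (n.+1)`!%:R) *: T ^+ n.+1)).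
  rewrite /exp_trunc -/T [in RHS]big_ord_recr /= addrK linear_sum big_ord_recl /=.
  rewrite expr0 fact0 divr1 scale1r derivC add0r -mulrN -sumrN mulr_sumr.
  apply: eq_bigr => l _; rewrite /bump /= add1n derivZ deriv_exp /=.
  rewrite -[_ *+ l.+1]scaler_nat scalerA -mulrA -scaleNr -[RHS]scalerAr exprS mulN1r !mulNr.
  congr (- _ *: _); rewrite factS natrM invfM mulrAC mulVf ?pnatr_eq0 ?mul1r //.
rewrite mulr_natl -(@coef_exp_trunc n.+1 t) // -coef_deriv dA coefN coefM.
congr (- _); apply: eq_bigr => i _; rewrite coefB coefZ coef_exp_small //; last first.
  by rewrite ltnS leq_subr.
rewrite mulr0 subr0 coef_exp_trunc; last by rewrite (leq_trans (leq_subr _ _)).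
rewrite coef_deriv coef_trunc_series //.
by rewrite -[_ / _ *+ _]mulr_natr mulfVK ?pnatr_eq0.
Qed.

Lemma comp_deriv0 t tau : comp_deriv t tau 0 = 0.
Proof. by rewrite /comp_deriv big_geq. Qed.

(** One factor T of each power is replaced by V. The [l] positions give equal terms, and [l] over
    its factorial shifts the exponential series, so the generating series is - V exp (- T). *)
Lemma comp_derivS t tau n : comp_deriv t tau n.+1 =
  - \sum_(i < n.+1) (tau i.+1 / i.+1%:R) * comp_exp t (n - i)%N.
Proof.
set T := trunc_series n.+1 t; set V := trunc_series n.+1 tau.
have T0 : T`_0 = 0 by exact: coef0_trunc_series.
have V0 : V`_0 = 0 by exact: coef0_trunc_series.
have -> : comp_deriv t tau n.+1 = (- (V *
    (exp_trunc n.+1 t - ((-1) ^+ n.+1 / (n.+1)`!%:R) *: T ^+ n.+1)))`_n.+1.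
  rewrite /exp_trunc -/T [in RHS]big_ord_recr /= addrK -mulrN -sumrN mulr_sumr.
  rewrite coef_sum /comp_deriv big_add1 /= big_mkord; apply: eq_bigr => l _.
  rewrite -scaleNr -scalerAr coefZ.
  have -> : \sum_(c : {ffun 'I_l.+1 -> 'I_n.+2} | composition c)
      \sum_j tau (c j) / (c j)%:R * \prod_(q | q != j) (t (c q) / (c q)%:R) =
      l.+1%:R * (V * T ^+ l)`_n.+1.
    rewrite exchange_big /=.
    rewrite (eq_bigr (fun=> (V * T ^+ l)`_n.+1)) ?sumr_const ?card_ord ?mulr_natl //.
    move=> j _; pose P (q : 'I_l.+1) := if q == j then V else T.
    have -> : V * T ^+ l = \prod_q P q.
      rewrite (bigD1 j) //= {1}/P eqxx (eq_bigr (fun=> T)); last first.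
        by move=> q /negbTE qj; rewrite /P qj.
      by rewrite prodr_const cardC1 card_ord.
    rewrite coef_prod_composition; last by move=> q; rewrite /P; case: eqP.
    apply: eq_bigr => c _; rewrite [RHS](bigD1 j) //= {1}/P eqxx.
    rewrite coef_trunc_series -1?ltnS //; congr (_ * _); apply: eq_bigr => q /negbTE qj.
    by rewrite /P qj coef_trunc_series -1?ltnS.
  rewrite mulrA exprS mulN1r !mulNr; congr (- (_ * _)).
  by rewrite -mulrA; congr (_ * _); rewrite factS natrM invfM mulrAC mulVf ?mul1r ?pnatr_eq0.
rewrite coefN coefM big_ord_recl V0 mul0r add0r; congr (- _).
apply: eq_bigr => i _; rewrite /bump /= ?add1n ?subSS coefB coefZ coef_exp_small //; last first.
  by rewrite ltnS leq_subr.
rewrite mulr0 subr0 coef_exp_trunc; last by rewrite (leq_trans (leq_subr _ _)).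
by rewrite coef_trunc_series.
Qed.
End Compositions.

(** * Exponential series *)

Section Convolution.
Context (F : numFieldType).
Implicit Types u v w s : nat -> F.

Definition conv u v n : F := \sum_(i < n.+1) u i * v (n - i)%N.

Definition trunc N u : {poly F} := \poly_(i < N.+1) u i.

Lemma coef_trunc N u i : (i <= N)%N -> (trunc N u)`_i = u i.
Proof. by move=> iN; rewrite coef_poly ltnS iN. Qed.

Lemma convE N u v n : (n <= N)%N -> conv u v n = (trunc N u * trunc N v)`_n.
Proof.
move=> nN; rewrite coefM; apply: eq_bigr => i _.
rewrite !coef_trunc //; first by rewrite (leq_trans (leq_subr _ _)).
by rewrite (leq_trans _ nN) // -ltnS.
Qed.

Lemma trunc_conv N u v : eq_upto N (trunc N (conv u v)) (trunc N u * trunc N v).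
Proof. by move=> i iN; rewrite coef_trunc // (convE _ _ iN). Qed.

Lemma convC u v n : conv u v n = conv v u n.
Proof. by rewrite !(convE _ _ (leqnn n)) mulrC. Qed.

Lemma convA u v w n : conv u (conv v w) n = conv (conv u v) w n.
Proof.
rewrite !(convE _ _ (leqnn n)).
rewrite (@eq_upto_mul _ n _ _ _ _ (fun _ _ => erefl) (@trunc_conv n v w)) //.
rewrite (@eq_upto_mul _ n _ _ _ _ (@trunc_conv n u v) (fun _ _ => erefl)) //.
by rewrite mulrA.
Qed.

Lemma conv_sum u n : conv (fun=> 1) u n = \sum_(i < n.+1) u i.
Proof. by rewrite convC; apply: eq_bigr => i _; rewrite mulr1. Qed.

(* [b] lists the coefficients of exp (- \sum_(r >= 1) s r / r * X ^ r). *)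
Definition is_exp_series s (b : nat -> F) :=
  b 0%N = 1 /\ forall n, n.+1%:R * b n.+1 = - \sum_(i < n.+1) s i.+1 * b (n - i)%N.

(** The recurrence is the differential equation b' = - s b in coefficients; products obey it by the
    Leibniz rule, used modulo a power of ['X]. *)
Lemma is_exp_series_conv s s' b b' :
  is_exp_series s b -> is_exp_series s' b' ->
  is_exp_series (fun i => s i + s' i) (conv b b').
Proof.
move=> [b0 bS] [b0' bS']; split; first by rewrite /conv big_ord1 b0 b0' mulr1.
move=> n; rewrite mulr_natl (convE _ _ (leqnn n.+1)) -coef_deriv derivM coefD.
have der v r : (forall n, n.+1%:R * v n.+1 = - \sum_(i < n.+1) r i.+1 * v (n - i)%N) ->
    eq_upto n (trunc n.+1 v)^`() (- (trunc n (r \o S) * trunc n.+1 v)).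
  move=> vS i ile; rewrite coef_deriv coef_trunc // -mulr_natl vS coefN coefM.
  congr (- _); apply: eq_bigr => j _.
  rewrite !coef_trunc //; first by rewrite (leq_trans (leq_subr _ _)) // (leq_trans ile).
  by rewrite (leq_trans _ ile) // -ltnS.
rewrite (@eq_upto_mul _ n _ _ _ _ (der _ _ bS) (fun _ _ => erefl)) //.
rewrite (@eq_upto_mul _ n _ _ _ _ (fun _ _ => erefl) (der _ _ bS')) //.
rewrite -coefD mulNr mulrN -opprD coefN; congr (- _).
have -> : trunc n (s \o S) * trunc n.+1 b * trunc n.+1 b' +
   trunc n.+1 b * (trunc n (s' \o S) * trunc n.+1 b') =
   trunc n (fun i => s i.+1 + s' i.+1) * (trunc n.+1 b * trunc n.+1 b').
  have -> : trunc n (fun i => s i.+1 + s' i.+1) = trunc n (s \o S) + trunc n (s' \o S).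
    by apply/polyP => i; rewrite coefD !coef_poly; case: ifP; rewrite ?addr0.
  by ring.
rewrite coefM; apply: eq_bigr => i _; rewrite coef_trunc // -1?ltnS // -convE //.
by rewrite (leq_trans (leq_subr _ _)).
Qed.

(** The identity exp (\sum_r X ^ r / r) = 1 / (1 - X). *)
Lemma is_exp_series_one : is_exp_series (fun=> -1) (fun=> 1).
Proof.
split=> // n; rewrite (eq_bigr (fun=> -1)); last by move=> i _; rewrite mulr1.
by rewrite sumr_const card_ord mulr1 mulNrn opprK.
Qed.

Lemma is_exp_series_zero s b : (forall i, s i.+1 = 0) -> is_exp_series s b ->
  forall n, b n = (n == 0%N)%:R.
Proof.
move=> s0 [b0 bS] [|n] //; apply/eqP; move: (bS n); rewrite big1; last first.
  by move=> i _; rewrite s0 mul0r.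
by move=> /eqP; rewrite oppr0 mulf_eq0 pnatr_eq0.
Qed.
End Convolution.

(** * Geometric decay of exponential series *)

Section Estimates.
Context (R : realType).
Implicit Types (u v s b t y a al : nat -> R) (c gam mu : R).

Lemma sum_geo_le q n : 0 <= q < 1 -> \sum_(i < n) q ^+ i <= (1 - q)^-1 :> R.
Proof.
case/andP=> q0 q1; have q1' : 0 < 1 - q by rewrite subr_gt0.
rewrite -(ler_pM2l q1') mulfV ?gt_eqF //.
rewrite -(big_mkord xpredT (fun i => q ^+ i)).
have -> : (1 - q) * \sum_(0 <= i < n) q ^+ i = 1 - q ^+ n.
  rewrite big_mkord -opprB -[in RHS]opprB subrX1; ring.
by rewrite lerBlDr lerDl exprn_ge0.
Qed.

(** With [L = - ln gam], the inequality [(x / 2) ^+ 2 <= expR x] at [x = k.+1%:R * L] bounds the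
    left side by [A / k.+1%:R]. *)
Lemma natmul_geo_small gam e : 0 < gam < 1 -> 0 < e ->
  exists K, forall k, (K <= k)%N -> k.+1%:R * gam ^+ k <= e.
Proof.
case/andP=> g0 g1 e0; pose L : R := - ln gam.
have L0 : 0 < L by rewrite oppr_gt0 ln_lt0 // g0.
pose A := expR L * 4 / (L ^+ 2).
have A0 : 0 < A by rewrite divr_gt0 ?exprn_gt0 // mulr_gt0 // expR_gt0.
exists (Num.bound (A / e)) => k kK.
have hk : A / e < k.+1%:R.
  apply: (lt_le_trans (archi_boundP (ltW (divr_gt0 A0 e0)))).
  by rewrite ler_nat ltnW // ltnS.
have -> : gam ^+ k = expR (- (k.+1%:R * L)) * expR L.
  rewrite -expRD -{1}(lnK g0) -expRM_natl; congr expR.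
  by rewrite /L -addn1 natrD; ring.
have x0 : 0 < k.+1%:R * L / 2 by rewrite divr_gt0 // mulr_gt0.
have h : k.+1%:R * L / 2 <= expR (k.+1%:R * L / 2).
  by apply: le_trans (expR_ge1Dx _); rewrite lerDr.
have h2 : (k.+1%:R * L / 2) ^+ 2 <= expR (k.+1%:R * L).
  have -> : expR (k.+1%:R * L) = expR (k.+1%:R * L / 2) ^+ 2.
    by rewrite -expRM_natl; congr expR; field.
  by apply: lerXn2r; rewrite ?nnegrE ?(ltW x0) ?expR_ge0.
have h3 : expR (- (k.+1%:R * L)) <= ((k.+1%:R * L / 2) ^+ 2)^-1.
  by rewrite expRN lef_pV2 // posrE ?expR_gt0 // exprn_gt0.
apply: (@le_trans _ _ (k.+1%:R * (((k.+1%:R * L / 2) ^+ 2)^-1 * expR L))).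
  by rewrite ler_pM2l ?ltr0n // ler_pM2r ?expR_gt0.
have -> : k.+1%:R * (((k.+1%:R * L / 2) ^+ 2)^-1 * expR L) = A / k.+1%:R.
  have aux (n l x : R) : n != 0 -> l != 0 ->
      n * (((n * l / 2) ^+ 2)^-1 * x) = x * 4 / l ^+ 2 / n.
    by move=> n0 l0; field; rewrite n0 l0.
  by rewrite aux // ?pnatr_eq0 // gt_eqF.
by rewrite ler_pdivrMr ?ltr0n // mulrC -ler_pdivrMr // ltW.
Qed.

(** Inserting the bound [U * gam ^+ n] into the recurrence returns it multiplied by at most
    [K / n.+1%:R], with [K] independent of [U]. Beyond [K] the bound reproduces itself, so [U] only
    has to absorb the first coefficients. *)
Lemma exp_series_decay s b C c gam : 0 < c -> c < gam -> gam < 1 -> 0 <= C ->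
  (forall r, `|s r.+1| <= C * c ^+ r.+1) -> is_exp_series s b ->
  exists2 U, 0 < U & forall n, `|b n| <= U * gam ^+ n.
Proof.
move=> c0 cg g1 C0 sC [b0 bS]; have g0 : 0 < gam by lra.
pose q := c / gam.
have q01 : 0 <= q < 1 by rewrite divr_ge0 ?ltW //= ltr_pdivrMr // mul1r.
pose K := C * (1 - q)^-1.
have K0 : 0 <= K by rewrite mulr_ge0 // invr_ge0 subr_ge0; case/andP: q01 => _ /ltW.
pose n0 := Num.bound K.
have Kn0 : K <= n0%:R by apply/ltW/archi_boundP.
pose U := 1 + \sum_(i < n0.+1) `|b i| / gam ^+ i.
have sum0 n : 0 <= \sum_(i < n) `|b i| / gam ^+ i.
  by apply: sumr_ge0 => i _; rewrite divr_ge0 // exprn_ge0 // ltW.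
have U0 : 0 < U by rewrite ltr_pwDl.
exists U => // n; elim/ltn_ind: n => n IH.
have [nn0|n0n] := leqP n n0.
  rewrite -ler_pdivrMr ?exprn_gt0 // /U (bigD1 (Ordinal (nn0 : (n < n0.+1)%N))) //=.
  rewrite addrCA lerDl addr_ge0 // sumr_ge0 // => i _.
  by rewrite divr_ge0 // exprn_ge0 // ltW.
case: n => // n in IH n0n *.
rewrite -(ler_pM2l (ltr0Sn R n)) -[n.+1%:R in X in X <= _](ger0_norm (ler0n R n.+1)).
rewrite -normrM bS normrN (le_trans (ler_norm_sum _ _ _)) //.
apply: (@le_trans _ _ (\sum_(i < n.+1) C * U * gam ^+ n.+1 * q ^+ i)).
  apply: ler_sum => i _; rewrite normrM.
  apply: (@le_trans _ _ (C * c ^+ i.+1 * (U * gam ^+ (n - i)))).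
    by rewrite ler_pM // IH // ltnS leq_subr.
  have -> : gam ^+ n.+1 = gam ^+ (n - i) * gam ^+ i.+1.
    by rewrite -exprD addnS subnK // -ltnS.
  rewrite [q ^+ i]expr_div_n exprS [gam ^+ i.+1]exprS.
  have gi : gam ^+ i != 0 by rewrite expf_neq0 // gt_eqF.
  have -> : C * U * (gam ^+ (n - i) * (gam * gam ^+ i)) * (c ^+ i / gam ^+ i) =
    C * (gam * c ^+ i) * (U * gam ^+ (n - i)) by field.
  rewrite ler_pM2r ?mulr_gt0 ?exprn_gt0 // ler_wpM2l // ler_pM2r ?exprn_gt0 //.
  exact: ltW.
rewrite -mulr_sumr.
have -> (G S : R) : C * U * G * S = U * G * (C * S) by ring.
rewrite [n.+1%:R * _]mulrC.
rewrite ler_pM2l ?mulr_gt0 ?exprn_gt0 //.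
apply: (@le_trans _ _ K); first by rewrite ler_wpM2l // sum_geo_le.
by rewrite (le_trans Kn0) // ler_nat ltnW.
Qed.
End Estimates.

(** * Partial sums and the error of the quotient *)

Section Quotient.
Context (R : realType).
Implicit Types (u v s b t y a al : nat -> R) (c gam mu : R).

Lemma conv_sumA u v n : \sum_(i < n.+1) conv u v i =
  \sum_(i < n.+1) u i * \sum_(j < (n - i).+1) v j.
Proof.
rewrite -conv_sum convA.
have -> : conv (fun=> 1) u = conv u (fun=> 1) by apply/funext => i; exact: convC.
by rewrite -convA; apply: eq_bigr => i _; rewrite conv_sum.
Qed.

Lemma conv_geo_le u v U V gam n : 0 < gam -> (forall i, `|u i| <= U * gam ^+ i) ->
  (forall i, `|v i| <= V * gam ^+ i) -> `|conv u v n| <= U * V * (n.+1%:R * gam ^+ n).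
Proof.
move=> g0 hu hv; apply: (le_trans (ler_norm_sum _ _ _)).
apply: (@le_trans _ _ (\sum_(i < n.+1) U * V * gam ^+ n)); last first.
  by rewrite sumr_const card_ord mulr_natl mulrnAr.
apply: ler_sum => i _; rewrite normrM.
have -> : U * V * gam ^+ n = (U * gam ^+ i) * (V * gam ^+ (n - i)).
  by rewrite mulrACA -exprD subnKC // -ltnS.
by rewrite ler_pM.
Qed.

Lemma geo_tail b U gam m k : 0 < gam < 1 -> (forall n, `|b n| <= U * gam ^+ n) ->
  (m <= k)%N ->
  `|\sum_(i < k.+1) b i - \sum_(i < m.+1) b i| <= U / (1 - gam) * gam ^+ m.
Proof.
move=> /andP[g0 g1] hb mk.
have U0 : 0 <= U by have := hb 0%N; rewrite expr0 mulr1; apply: le_trans.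
rewrite -!(big_mkord xpredT b) (big_cat_nat (n := m.+1)) //= addrAC subrr add0r.
rewrite -{1}[m.+1]add0n big_addn subSS big_mkord (le_trans (ler_norm_sum _ _ _)) //.
apply: (@le_trans _ _ (\sum_(i < k - m) U * gam ^+ m * gam ^+ i)).
  apply: ler_sum => i _; apply: (le_trans (hb _)).
  rewrite -mulrA ler_wpM2l // -exprD ler_wiXn2l ?ltW //.
  by rewrite addnS [(i + m)%N]addnC leqnSn.
rewrite -mulr_sumr [leRHS]mulrAC ler_wpM2l ?mulr_ge0 ?exprn_ge0 ?sum_geo_le ?g1 ?(ltW g0) //.
Qed.

(* If the sum of [b] were 0, so would be the sum of the convolution unit. *)
Lemma sum_inverse_series b bs U gam : 0 < gam < 1 -> (forall n, conv bs b n = (n == 0%N)%:R) ->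
  (forall n, `|b n| <= U * gam ^+ n) -> (forall n, `|bs n| <= U * gam ^+ n) ->
  exists2 d, 0 < d & exists K, forall k, (K <= k)%N -> d <= `|\sum_(i < k.+1) b i|.
Proof.
move=> g01 inv hb hbs; have /andP[g0 g1] := g01.
have U0 : 0 <= U by have := hb 0%N; rewrite expr0 mulr1; apply: le_trans.
have one n : 1 = \sum_(i < n.+1) bs i * \sum_(j < (n - i).+1) b j.
  rewrite -conv_sumA (eq_bigr (fun i : 'I_n.+1 => ((i : nat) == 0%N)%:R)) => [|i _].
    by rewrite big_ord_recl big1 ?addr0.
  by rewrite inv.
pose D := U / (1 - gam).
have D0 : 0 <= D by rewrite divr_ge0 // subr_ge0 ltW.
have e0 : 0 < (2 * (U * D + 1))^-1.
  by rewrite invr_gt0 mulr_gt0 // ltr_wpDl // mulr_ge0.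
have [K hK] := natmul_geo_small g01 e0.
exists ((2 * (D + 1))^-1); first by rewrite invr_gt0 mulr_gt0 // ltr_wpDl.
exists K => k kK; set B := \sum_(i < k.+1) b i.
have bsD : `|\sum_(i < k.+1) bs i| <= D.
  apply: (le_trans (ler_norm_sum _ _ _)).
  apply: (@le_trans _ _ (\sum_(i < k.+1) U * gam ^+ i)); first exact: ler_sum.
  by rewrite -mulr_sumr ler_wpM2l // sum_geo_le // ltW.
(* The partial sums of [b] occurring in [one] are replaced by the single value [B]. This costs at
   most 1/2 for large [k], and since the partial sums of [bs] are bounded by [D], [B] stays away
   from 0. *)
have dec : 1 = (\sum_(i < k.+1) bs i) * B +
    \sum_(i < k.+1) bs i * (\sum_(j < (k - i).+1) b j - B).
  rewrite [LHS](one k) mulr_suml -big_split /=; apply: eq_bigr => i _.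
  by rewrite -mulrDr addrC subrK.
have rest : `|\sum_(i < k.+1) bs i * (\sum_(j < (k - i).+1) b j - B)| <= 2^-1.
  apply: (@le_trans _ _ (U * D * (k.+1%:R * gam ^+ k))).
    apply: (le_trans (ler_norm_sum _ _ _)).
    apply: (@le_trans _ _ (\sum_(i < k.+1) U * D * gam ^+ k)); last first.
      by rewrite sumr_const card_ord mulr_natl mulrnAr.
    apply: ler_sum => i _; rewrite normrM.
    have -> : U * D * gam ^+ k = (U * gam ^+ i) * (D * gam ^+ (k - i)).
      by rewrite mulrACA -exprD subnKC // -ltnS.
    by rewrite ler_pM // distrC geo_tail // leq_subr.
  apply: (@le_trans _ _ ((U * D + 1) * (2 * (U * D + 1))^-1)).
    apply: ler_pM; last exact: hK.
    - exact: mulr_ge0.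
    - by rewrite mulr_ge0 // exprn_ge0 // ltW.
    - by rewrite lerDl.
  have : U * D + 1 != 0 by rewrite gt_eqF // ltr_wpDl // mulr_ge0.
  by move: (U * D + 1) => z z0; rewrite invfM mulrCA mulfV // mulr1.
have h1 : 2^-1 <= `|\sum_(i < k.+1) bs i| * `|B|.
  have := ler_normD ((\sum_(i < k.+1) bs i) * B)
    (\sum_(i < k.+1) bs i * (\sum_(j < (k - i).+1) b j - B)).
  rewrite -dec normr1 normrM; lra.
rewrite invfM mulrC ler_pdivrMl ?ltr_wpDl //.
apply: (le_trans h1); rewrite ler_wpM2r // (le_trans bsD) // lerDl //.
Qed.

(** Abel summation. With [b] the partial sums of [a], the denominator becomes [k.+1%:R * b k] minus
    a partial sum of [b], which is why its limit is controlled by the sum of [b]. *)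
Lemma sum_natmul_coef a n : \sum_(i < n.+1) i%:R * a i =
  n.+1%:R * \sum_(i < n.+1) a i - \sum_(i < n.+1) \sum_(j < i.+1) a j.
Proof.
elim: n => [|n IH]; first by rewrite !big_ord1 mul0r mul1r subrr.
rewrite big_ord_recr IH /= [X in _ = X - _]mulrC (big_ord_recr n.+1) /=.
rewrite [X in _ = _ - X](big_ord_recr n.+1) /= (big_ord_recr n.+1) /=.
by rewrite -[n.+2]addn1 natrD; ring.
Qed.

Lemma gauss_absorb (lam : R) : 0 < lam ->
  exists2 D, 0 < D & forall n, n%:R * expR (- lam * n%:R ^+ 2) <= D * expR (- (lam / 2) * n%:R ^+ 2) :> R.
Proof.
move=> l0; exists (2 / lam); first by rewrite divr_gt0.
move=> n.
have h : n%:R <= 2 / lam * expR (lam / 2 * n%:R ^+ 2).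
  rewrite -ler_pdivrMl ?divr_gt0 // invf_div.
  apply: (@le_trans _ _ (1 + lam / 2 * n%:R ^+ 2)); last exact: expR_ge1Dx.
  have [->|n1] := posnP n; first by rewrite mulr0n expr0n /= !mulr0 addr0 ler01.
  have : 1 <= n%:R :> R by rewrite ler1n.
  move: (n%:R) => x x1.
  have h1 : 0 <= lam / 2 by lra.
  have h2 : 0 <= x * (x - 1) by nra.
  have := mulr_ge0 h1 h2; nra.
have -> : expR (- lam * n%:R ^+ 2) = expR (- (lam / 2) * n%:R ^+ 2) * expR (- (lam / 2 * n%:R ^+ 2)).
  by rewrite -expRD; congr expR; field.
rewrite mulrCA mulrC ler_wpM2r ?expR_ge0 // expRN ler_pdivrMr ?expR_gt0 //.
Qed.

Lemma gauss_tail (x : nat -> R) (A lam : R) k m : 0 < lam -> 0 <= A ->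
  (forall n, `|x n| <= A * expR (- lam * n%:R ^+ 2)) -> (k <= m)%N ->
  `|\sum_(i < m.+1) x i - \sum_(i < k.+1) x i| <=
     A / (1 - expR (- lam)) * expR (- lam * k%:R ^+ 2).
Proof.
move=> l0 A0 hx km.
have q01 : 0 <= expR (- lam) < 1 by rewrite expR_ge0 expR_lt1 oppr_lt0.
rewrite -!(big_mkord xpredT x) (big_cat_nat (n := k.+1)) //= addrAC subrr add0r.
rewrite -{1}[k.+1]add0n big_addn subSS big_mkord (le_trans (ler_norm_sum _ _ _)) //.
apply: (@le_trans _ _ (\sum_(i < m - k) A * expR (- lam * k%:R ^+ 2) * expR (- lam) ^+ i)).
  (* The index is [i + k.+1], and its square is at least [k ^ 2 + i], which leaves a geometric
     series of ratio [expR (- lam)]. *)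
  apply: ler_sum => i _; apply: (le_trans (hx _)).
  rewrite -mulrA ler_wpM2l // -expRM_natl -expRD ler_expR.
  rewrite !mulNr mulrN -opprD lerN2 [_ * lam]mulrC -mulrDr ler_pM2l //.
  have hi : (0 : R) <= i%:R by rewrite ler0n.
  have hk : (0 : R) <= k%:R by rewrite ler0n.
  have hi2 : (i%:R : R) <= i%:R ^+ 2.
    by rewrite -natrX ler_nat; case: (nat_of_ord i) => // j; rewrite expnS leq_pmulr.
  have -> : (i + k.+1)%:R = i%:R + k%:R + 1 :> R by rewrite addnS -natr1 natrD.
  nra.
rewrite -mulr_sumr [leRHS]mulrAC ler_wpM2l ?mulr_ge0 ?expR_ge0 ?sum_geo_le //.
Qed.

(** The error is the partial sum of [al n - mu * (n%:R * a n)] divided by the denominator. Geometric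
    decay shows that this numerator tends to 0 and that the denominator does not; the Gaussian
    bounds then estimate the numerator as a tail. *)
Lemma quotient_superexp t y a al C c mu A lam :
  0 < c < 1 -> 0 <= C -> 0 < lam ->
  (forall r, `|t r.+1 - 1| <= C * c ^+ r.+1) ->
  (forall r, `|y r.+1 - mu| <= C * c ^+ r.+1) ->
  is_exp_series t a -> al 0%N = 0 ->
  (forall n, al n.+1 = - \sum_(i < n.+1) y i.+1 * a (n - i)%N) ->
  (forall n, `|a n| <= A * expR (- lam * n%:R ^+ 2)) ->
  (forall n, `|al n| <= A * expR (- lam * n%:R ^+ 2)) ->
  exists C' lam', [/\ 0 < C', 0 < lam' & forall k,
    `|(\sum_(0 <= n < k.+1) al n) / (\sum_(0 <= n < k.+1) n%:R * a n) - mu|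
      <= C' * expR (- lam' * k%:R ^+ 2)].
Proof.
move=> /andP[c0 c1] C0 l0 ht hy expa al0 alS ha hal.
pose gam := (1 + c) / 2.
have cg : c < gam by rewrite /gam; lra.
have g1 : gam < 1 by rewrite /gam; lra.
have g0 : 0 < gam by lra.
have g01 : 0 < gam < 1 by rewrite g0.
pose b := conv (fun=> 1) a.
have expb := is_exp_series_conv (@is_exp_series_one R) expa; rewrite -/b in expb.
(* The reciprocal series of [b], obtained by negating the exponent. *)
pose bs := comp_exp (fun i => - (-1 + t i)).
have expbs : is_exp_series (fun i => - (-1 + t i)) bs.
  by split=> // n; rewrite comp_expS.
have [U1 U10 hb1] : exists2 U, 0 < U & forall n, `|b n| <= U * gam ^+ n.
  by apply: exp_series_decay cg g1 C0 _ expb => // r; rewrite addrC.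
have [U2 U20 hbs2] : exists2 U, 0 < U & forall n, `|bs n| <= U * gam ^+ n.
  by apply: exp_series_decay cg g1 C0 _ expbs => // r; rewrite normrN addrC.
pose U := U1 + U2.
have hb n : `|b n| <= U * gam ^+ n.
  by apply: (le_trans (hb1 n)); rewrite ler_pM2r ?exprn_gt0 // lerDl ltW.
have hbs n : `|bs n| <= U * gam ^+ n.
  by apply: (le_trans (hbs2 n)); rewrite ler_pM2r ?exprn_gt0 // lerDr ltW.
have U0 : 0 < U by rewrite addr_gt0.
have inv n : conv bs b n = (n == 0%N)%:R.
  apply: (is_exp_series_zero _ (is_exp_series_conv expbs expb)) => i.
  by rewrite addNr.
have [d d0 [K1 hd]] := sum_inverse_series g01 inv hb hbs.
have bE n : \sum_(j < n.+1) a j = b n by rewrite /b conv_sum.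
pose NN k := \sum_(n < k.+1) n%:R * a n.
pose SS k := \sum_(n < k.+1) al n.
have [K2 hK2] : exists K, forall k, (K <= k)%N -> U * (k.+1%:R * gam ^+ k) <= d / 2.
  have e0 : 0 < d / 2 / U by rewrite divr_gt0 // divr_gt0.
  have [K hK] := natmul_geo_small g01 e0.
  by exists K => k /hK; rewrite ler_pdivlMr // mulrC.
have NNd k : (K1 <= k)%N -> (K2 <= k)%N -> d / 2 <= `|NN k|.
  move=> k1 k2; rewrite /NN sum_natmul_coef bE (eq_bigr (fun i : 'I_k.+1 => b i)); last first.
    by move=> i _; rewrite bE.
  have := hd k k1; have := hK2 k k2.
  have : `|k.+1%:R * b k| <= U * (k.+1%:R * gam ^+ k).
    by rewrite normrM normr_nat mulrCA ler_pM2l ?ltr0n.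
  set B := \sum_(i < _) b i; set e := _ * b k => h1 h2 h3.
  have := lerB_dist B e; rewrite distrC; lra.
pose x n := al n - mu * (n%:R * a n).
have XE k : \sum_(n < k.+1) x n = SS k - mu * NN k.
  by rewrite /SS /NN sumrB mulr_sumr.
(* The limits cancel: [y] tends to [mu] and [t] to 1. The value 0 at index 0 makes the convolution
   with [a] start at the first trace. *)
pose z n := if n is m.+1 then y m.+1 - mu * t m.+1 else 0.
have xz n : x n = - conv z a n.
  rewrite /x /conv; case: n => [|n]; first by rewrite big_ord1 !mul0r al0 mulr0 subr0 oppr0.
  rewrite alS expa.2 [in RHS]big_ord_recl /= mul0r add0r /= mulrN opprK addrC -opprB; congr (- _).
  rewrite mulr_sumr -sumrB; apply: eq_bigr => i _; rewrite /bump /= add1n subSS.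
  by ring.
have hz n : `|z n| <= (C + `|mu| * C) * gam ^+ n.
  case: n => [|n]; first by rewrite normr0 expr0 mulr1 addr_ge0 // mulr_ge0.
  have -> : z n.+1 = (y n.+1 - mu) - mu * (t n.+1 - 1) by rewrite /z; ring.
  apply: (le_trans (ler_normB _ _)).
  apply: (@le_trans _ _ ((C + `|mu| * C) * c ^+ n.+1)).
    by rewrite normrM mulrDl lerD // -mulrA ler_wpM2l.
  rewrite ler_wpM2l // ?addr_ge0 ?mulr_ge0 // lerXn2r ?nnegrE ?ltW //.
(* Summing the convolution replaces [a] by its partial sums [b], so two geometrically decaying
   sequences are convolved and the sums of [x] tend to 0. *)
have hX k : `|\sum_(n < k.+1) x n| <= (C + `|mu| * C) * U * (k.+1%:R * gam ^+ k).
  rewrite (eq_bigr (fun n : 'I_k.+1 => - conv z a n)) => [|i _]; last exact: xz.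
  rewrite sumrN normrN conv_sumA (eq_bigr (fun i : 'I_k.+1 => z i * b (k - i)%N)).
    exact: conv_geo_le.
  by move=> i _; rewrite bE.
have A0 : 0 <= A.
  by have := ha 0%N; rewrite expr0n mulr0 expR0 mulr1; apply: le_trans.
have [D D0 hD] := gauss_absorb l0.
pose A' := A + `|mu| * (A * D).
have A'0 : 0 <= A' by rewrite addr_ge0 // !mulr_ge0 // ltW.
have hx n : `|x n| <= A' * expR (- (lam / 2) * n%:R ^+ 2).
  apply: (le_trans (ler_normB _ _)); rewrite mulrDl lerD //.
    apply: (le_trans (hal n)); rewrite ler_wpM2l // ler_expR.
    by rewrite ler_wpM2r ?exprn_ge0 // lerN2; lra.
  rewrite !normrM -!mulrA ler_wpM2l // normr_nat.
  apply: (@le_trans _ _ (n%:R * (A * expR (- lam * n%:R ^+ 2)))).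
    by rewrite ler_wpM2l.
  by rewrite mulrCA ler_wpM2l.
have l20 : 0 < lam / 2 by rewrite divr_gt0.
pose A2 := A' / (1 - expR (- (lam / 2))).
have A20 : 0 <= A2.
  by rewrite divr_ge0 // subr_ge0 ltW // expR_lt1 oppr_lt0.
(* As the full sum is 0, a partial sum is minus its tail. The index [m] is taken so far out that the
   partial sum there is below [e]. *)
have XX k : `|\sum_(n < k.+1) x n| <= A2 * expR (- (lam / 2) * k%:R ^+ 2).
  apply/ler_addgt0Pr => e e0.
  pose V := (C + `|mu| * C) * U + 1.
  have V0 : 0 < V by rewrite ltr_wpDl // mulr_ge0 ?(ltW U0) // addr_ge0 // mulr_ge0.
  have [K hK] := natmul_geo_small g01 (divr_gt0 e0 V0).
  pose m := maxn K k.
  have h1 := gauss_tail l20 A'0 hx (leq_maxr K k).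
  have h2 := hX m.
  have h3 := hK m (leq_maxl K k).
  have h4 : `|\sum_(n < m.+1) x n| <= e.
    apply: (le_trans h2); move: h3; rewrite ler_pdivlMr // mulrC; apply: le_trans.
    rewrite ler_wpM2r ?mulr_ge0 ?exprn_ge0 ?(ltW g0) // /V lerDl //.
  rewrite -/m in h1; rewrite -/A2 in h1.
  have := ler_distD (\sum_(i < m.+1) x i) (\sum_(n < k.+1) x n) 0.
  rewrite !subr0 distrC; lra.
pose err k := `|SS k / NN k - mu|.
pose KK := maxn K1 K2.
have big k : (KK <= k)%N -> err k <= (A2 / (d / 2)) * expR (- (lam / 2) * k%:R ^+ 2).
  rewrite geq_max => /andP[k1 k2]; have hN := NNd k k1 k2.
  have d20 : 0 < d / 2 by rewrite divr_gt0.
  have N0 : NN k != 0 by rewrite -normr_gt0 (lt_le_trans d20).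
  have -> : err k = `|\sum_(n < k.+1) x n| / `|NN k|.
    by rewrite XE -normfV -normrM mulrBl mulfK.
  rewrite mulrAC ler_pM ?invr_ge0 // lef_pV2 // posrE // (lt_le_trans d20) //.
(* Below [KK] the denominator may be small or 0, in which case the quotient is 0 by convention;
   these finitely many errors are put into the constant. *)
pose C' := A2 / (d / 2) + \sum_(k < KK) err k * expR ((lam / 2) * k%:R ^+ 2) + 1.
have E0 : 0 <= A2 / (d / 2) by rewrite divr_ge0 // divr_ge0 // ltW.
have S0 n (P : pred 'I_n) : 0 <= \sum_(k < n | P k) err k * expR ((lam / 2) * k%:R ^+ 2).
  by apply: sumr_ge0 => i _; rewrite /err mulr_ge0 ?expR_ge0.
exists C', (lam / 2); split=> //.
  by rewrite /C' ltr_wpDl // addr_ge0.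
move=> k; rewrite !big_mkord -/(SS k) -/(NN k) -/(err k).
have [kK|kK] := leqP KK k.
  apply: (le_trans (big k kK)); rewrite ler_wpM2r ?expR_ge0 // /C' -addrA lerDl.
  by rewrite addr_ge0.
rewrite mulNr expRN ler_pdivlMr ?expR_gt0 //.
rewrite /C' (bigD1 (Ordinal kK)) //=.
by have := S0 KK (fun i => i != Ordinal kK); move: E0; lra.
Qed.
End Quotient.

(** * Determinants of resolvent kernels *)

Section DetBound.
Context (R : realType).

(** Row [k] of [A] lies in the span of the rows of [schmidt A] of index at most [k], which are
    orthogonal to row [j]. *)
Lemma schmidt_lower n (A : 'M[R[i]]_n) (k j : 'I_n) : (k < j)%N ->
  (A *m (map_mx Num.conj (schmidt A)^T)) k j = 0.
Proof.
move=> kj; set U := schmidt A; have uU : U \is unitarymx by rewrite schmidt_unitarymx.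
have U1 : U *m map_mx Num.conj U^T = 1%:M by apply/unitarymxP.
suff : row k A *m col j (map_mx Num.conj U^T) = 0.
  by move=> /matrixP/(_ ord0 ord0); rewrite !mxE => h; rewrite -[RHS]h; apply: eq_bigr => i _; rewrite !mxE.
apply/sub_kermxP; apply: submx_trans (row_schmidt_sub A k) _.
apply/sumsmx_subP => i ik; rewrite genmxE; apply/sub_kermxP.
have : (U *m map_mx Num.conj U^T) i j = 0.
  by rewrite U1 mxE (_ : i == j = false) // -val_eqE ltn_eqF // (leq_ltn_trans ik).
rewrite mxE => h; apply/matrixP => a b; rewrite !mxE -[RHS]h.
by apply: eq_bigr => l _; rewrite !mxE.
Qed.

Lemma unitary_entry n (U : 'M[R[i]]_n) i j : U \is unitarymx -> cabs (U i j) <= 1.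
Proof.
move=> /unitarymxP /matrixP/(_ i i); rewrite !mxE eqxx => h.
have : \sum_j cabs (U i j) ^+ 2 = 1.
  apply: complexI; rewrite rmorph_sum rmorph1 -[RHS]h; apply: eq_bigr => k _.
  by rewrite !mxE rmorphXn /= -cabsE normCK.
rewrite (bigD1 j) //= => h1.
have : cabs (U i j) ^+ 2 <= 1 by rewrite -h1 lerDl sumr_ge0 // => k _; rewrite exprn_ge0 // cabs_ge0.
by rewrite expr_le1 // cabs_ge0.
Qed.

Lemma cabs_conj (z : R[i]) : cabs (Num.conj z) = cabs z.
Proof. by rewrite /cabs norm_conjC. Qed.

Lemma cabs_det_unitary n (U : 'M[R[i]]_n) : U \is unitarymx ->
  cabs (\det (map_mx Num.conj U^T)) = 1.
Proof.
move=> /unitarymxP h; have := congr1 determinant h.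
rewrite det_mulmx det1 det_map_mx det_tr => h1; have := congr1 (@cabs R) h1.
rewrite cabsM cabs1 cabs_conj -expr2 => /eqP.
by rewrite sqrp_eq1 ?cabs_ge0 // => /eqP.
Qed.

Lemma cabs_det_le n (A : 'M[R[i]]_n) (B : 'I_n -> R) :
  (forall i j, cabs (A i j) <= B j) -> cabs (\det A) <= n`!%:R * \prod_j B j.
Proof.
move=> hA; rewrite /determinant (le_trans (cabs_sum _ _ _)) //.
apply: (@le_trans _ _ (\sum_(s : 'S_n) \prod_j B j)); last first.
  by rewrite sumr_const card_Sn mulr_natl.
apply: ler_sum => s _; rewrite cabsM cabs_sign mul1r cabs_prod.
rewrite [leRHS](reindex_inj (@perm_inj _ s)) /=.
by apply: ler_prod => i _; rewrite cabs_ge0 hA.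
Qed.

Lemma resolvent_remainder (zeta z y : R[i]) m : zeta != y -> zeta != z ->
  (zeta - z)^-1 = \sum_(i < m) (z - y) ^+ i * (zeta - y) ^- i.+1
    + ((z - y) / (zeta - y)) ^+ m / (zeta - z).
Proof.
rewrite -subr_eq0 -(subr_eq0 zeta z) => h1 h2; set r := (z - y) / (zeta - y).
have -> : \sum_(i < m) (z - y) ^+ i * (zeta - y) ^- i.+1 = (zeta - y)^-1 * \sum_(i < m) r ^+ i.
  by rewrite mulr_sumr; apply: eq_bigr => i _; rewrite /r expr_div_n exprS invfM mulrCA.
have : r ^+ m - 1 = (r - 1) * \sum_(i < m) r ^+ i by rewrite subrX1.
have -> : r - 1 = - (zeta - z) / (zeta - y) by rewrite /r; field.
move=> /eqP; rewrite subr_eq => /eqP ->.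
by move: (\sum_(i < m) _) => S; field; rewrite h1 h2.
Qed.

(* Taylor functionals at the grid points [x l], ordered by degree and then by
   [l], are made lower triangular by a unitary change of columns, so that
   column [b] contains only Taylor remainders, of size [q ^ (b %/ M.+1)]. *)
Lemma det_resolvent_bound n (K : finType) (c v : 'I_n -> K -> R[i]) (zeta : 'I_n -> R[i])
    M (x : nat -> R[i]) (q d Cc : R) : 0 <= q -> 0 < d ->
  (forall a, \sum_k cabs (c a k) <= Cc) ->
  (forall a k, exists2 l, (l <= M)%N & forall b, cabs (v a k - x l) <= q * cabs (zeta b - x l)) ->
  (forall a k b, d <= cabs (zeta b - v a k)) ->
  (forall b l, (l <= M)%N -> zeta b != x l) ->
  cabs (\det (\matrix_(a, b) \sum_k c a k / (zeta b - v a k))) <=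
    n`!%:R * \prod_(b < n) (Cc * n%:R / d * q ^+ (b %/ M.+1)).
Proof.
move=> q0 d0 hc hgrid hd hx; set A := \matrix_(a, b) _.
(* Row [j * M.+1 + l] is the Taylor functional of degree [j] at [x l], as a function of the
   nodes. *)
pose Lam : 'M[R[i]]_n := \matrix_(k, b) (zeta b - x (k %% M.+1)%N) ^- (k %/ M.+1).+1.
pose U := schmidt Lam; pose Q := map_mx Num.conj U^T.
have uU : U \is unitarymx by rewrite schmidt_unitarymx.
have -> : cabs (\det A) = cabs (\det (A *m Q)).
  by rewrite det_mulmx cabsM cabs_det_unitary // mulr1.
apply: cabs_det_le => a b.
have Qle i : cabs (Q i b) <= 1 by rewrite !mxE cabs_conj unitary_entry.
set m := (b %/ M.+1)%N.
have inner k : cabs (\sum_i Q i b / (zeta i - v a k)) <= n%:R / d * q ^+ m.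
  have [l lM hl] := hgrid a k.
  have zv i : zeta i != v a k by rewrite -subr_eq0 -cabs_gt0 (lt_le_trans d0).
  have -> : \sum_i Q i b / (zeta i - v a k) =
     \sum_i Q i b * (((v a k - x l) / (zeta i - x l)) ^+ m / (zeta i - v a k)).
    under eq_bigr => i _ do rewrite (resolvent_remainder m (hx i l lM) (zv i)) mulrDr.
    rewrite big_split /= -[RHS]add0r; congr (_ + _).
    under eq_bigr do rewrite mulr_sumr.
    rewrite exchange_big big1 //= => j _.
    (* Degree [j < m] and [l <= M] put the index of this functional strictly before [b], where
       [Lam *m Q] vanishes. *)
    have jb : (j * M.+1 + l < b)%N.
      have : (j.+1 * M.+1 <= b)%N by rewrite (leq_trans _ (leq_divM b M.+1)) // leq_mul2r ltn_ord orbT.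
      by apply: leq_trans; rewrite mulSn addnC -addSn leq_add2r ltnS.
    have jn : (j * M.+1 + l < n)%N by apply: ltn_trans jb _.
    have := @schmidt_lower n Lam (Ordinal jn) b jb; rewrite mxE -/U -/Q => h.
    rewrite (eq_bigr (fun i => (v a k - x l) ^+ j * (Lam (Ordinal jn) i * Q i b))).
      by rewrite -mulr_sumr h mulr0.
    move=> i _; rewrite [Lam _ _]mxE /= divnMDl // modnMDl.
    by rewrite divn_small ?ltnS // modn_small ?ltnS // addn0 mulrCA [Q i b * _]mulrC.
  apply: (le_trans (cabs_sum _ _ _)).
  apply: (@le_trans _ _ (\sum_(i < n) q ^+ m / d)); last first.
    by rewrite sumr_const card_ord -mulrA [d^-1 * _]mulrC mulr_natl.
  apply: ler_sum => i _; rewrite !cabsM cabsX cabsM !cabsV -[leRHS]mul1r.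
  rewrite ler_pM ?cabs_ge0 ?mulr_ge0 ?invr_ge0 ?exprn_ge0 ?mulr_ge0 ?invr_ge0 ?cabs_ge0 //.
  rewrite ler_pM ?exprn_ge0 ?mulr_ge0 ?invr_ge0 ?cabs_ge0 //.
    rewrite lerXn2r ?nnegrE ?mulr_ge0 ?invr_ge0 ?cabs_ge0 //.
    by rewrite ler_pdivrMr ?hl // cabs_gt0 subr_eq0 hx.
  by rewrite lef_pV2 ?posrE // (lt_le_trans d0).
have -> : (A *m Q) a b = \sum_k c a k * \sum_i Q i b / (zeta i - v a k).
  rewrite mxE; under eq_bigr do rewrite mxE mulr_suml.
  rewrite exchange_big; apply: eq_bigr => k _; rewrite mulr_sumr.
  by apply: eq_bigr => i _; rewrite mulrAC -mulrA.
apply: (le_trans (cabs_sum _ _ _)).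
have -> : Cc * n%:R / d * q ^+ m = Cc * (n%:R / d * q ^+ m) by rewrite !mulrA.
apply: (@le_trans _ _ (\sum_k cabs (c a k) * (n%:R / d * q ^+ m))).
  by apply: ler_sum => k _; rewrite cabsM ler_wpM2l ?cabs_ge0.
by rewrite -mulr_suml ler_wpM2r // mulr_ge0 ?exprn_ge0 // divr_ge0 // ltW.
Qed.
End DetBound.

(** * A contour around the unit interval *)

Section Contour.
Context (R : realType).
Implicit Types (z w : R[i]) (x t r : R).

Definition unit_nbhd r z := exists2 x, 0 <= x <= 1 & cabs (z - x%:C%C) <= r.

Lemma sqr_cabs z : cabs z ^+ 2 = complex.Re z ^+ 2 + complex.Im z ^+ 2.
Proof. by rewrite /cabs normc_def /= sqr_sqrtr // addr_ge0 // sqr_ge0. Qed.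

Lemma cabs_le z r : 0 <= r -> complex.Re z ^+ 2 + complex.Im z ^+ 2 <= r ^+ 2 -> cabs z <= r.
Proof.
by move=> r0 h; rewrite -(@ler_pXn2r _ 2) ?nnegrE ?cabs_ge0 // sqr_cabs.
Qed.

Lemma cabs_ge z r : 0 <= r -> r ^+ 2 <= complex.Re z ^+ 2 + complex.Im z ^+ 2 -> r <= cabs z.
Proof.
by move=> r0 h; rewrite -(@ler_pXn2r _ 2) ?nnegrE ?cabs_ge0 // sqr_cabs.
Qed.

Lemma Im_div z w : complex.Im (z / w) =
  (complex.Im z * complex.Re w - complex.Re z * complex.Im w) / cabs w ^+ 2.
Proof.
rewrite sqr_cabs; case: z => a b; case: w => c d /=; simpc => /=.
by rewrite mulrBl !mulrA addrC -mulrN.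
Qed.

(* Rational parametrisation of the half circle from -i to i. *)
Definition half_circle t : R[i] :=
  (((1 - t ^+ 2) / (1 + t ^+ 2)) +i* (2 * t / (1 + t ^+ 2)))%C.

(* Boundary of the [r]-neighbourhood of [0, 1], oriented counterclockwise: the
   right half circle and the upper segment, and their images by z |-> 1 - z. *)
Definition stadium r (k : bool * bool) t : R[i] :=
  let z := if k.2 then ((1 - t) +i* r)%C
           else 1 + r%:C%C * half_circle (2 * t - 1) in
  if k.1 then 1 - z else z.

Definition edge m : finType := ((bool * bool) * 'I_m.+1)%type.
Definition node r m (e : edge m) : R[i] := stadium r e.1 (e.2%:R / m.+1%:R).
Definition next_node r m (e : edge m) : R[i] := stadium r e.1 (e.2.+1%:R / m.+1%:R).
Definition step r m (e : edge m) : R[i] := next_node r e - node r e.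

Lemma half_circle_norm t : complex.Re (half_circle t) ^+ 2 + complex.Im (half_circle t) ^+ 2 = 1.
Proof.
have h : 1 + t ^+ 2 != 0 by rewrite gt_eqF // ltr_wpDr // sqr_ge0.
by rewrite /=; field.
Qed.

Lemma cabs_half_circle t : cabs (half_circle t) = 1.
Proof.
have := sqr_cabs (half_circle t); rewrite half_circle_norm => /eqP.
by rewrite sqrp_eq1 ?cabs_ge0 // => /eqP.
Qed.

Lemma half_circle_Re t : -1 <= t <= 1 -> 0 <= complex.Re (half_circle t).
Proof.
move=> h /=; rewrite divr_ge0 // ?subr_ge0; last by rewrite addr_ge0 // sqr_ge0.
by rewrite expr2; nra.
Qed.

Lemma half_circle_lip t t' : cabs (half_circle t' - half_circle t) <= 2 * `|t' - t|.
Proof.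
apply: cabs_le; first by rewrite mulr_ge0.
rewrite exprMn real_normK ?num_real //.
have h : 0 < 1 + t ^+ 2 by rewrite ltr_wpDr // sqr_ge0.
have h' : 0 < 1 + t' ^+ 2 by rewrite ltr_wpDr // sqr_ge0.
have -> : complex.Re (half_circle t' - half_circle t) ^+ 2 +
  complex.Im (half_circle t' - half_circle t) ^+ 2 =
  2 ^+ 2 * (t' - t) ^+ 2 / ((1 + t ^+ 2) * (1 + t' ^+ 2)).
  by rewrite /=; field; rewrite !gt_eqF.
rewrite ler_pdivrMr ?mulr_gt0 //; apply: ler_peMr; first by rewrite -exprMn sqr_ge0.
by have := mulr_ge0 (sqr_ge0 t) (sqr_ge0 t'); have := sqr_ge0 t; have := sqr_ge0 t'; lra.
Qed.

(** The argument does not decrease along the half circle, which keeps the contribution of its chords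
    to the winding sum nonnegative. *)
Lemma half_circle_cross t t' : -1 <= t -> t <= t' -> t' <= 1 ->
  0 <= complex.Re (half_circle t) * complex.Im (half_circle t') -
       complex.Im (half_circle t) * complex.Re (half_circle t').
Proof.
move=> h1 h2 h3.
have h : 0 < 1 + t ^+ 2 by rewrite ltr_wpDr // sqr_ge0.
have h' : 0 < 1 + t' ^+ 2 by rewrite ltr_wpDr // sqr_ge0.
have -> : complex.Re (half_circle t) * complex.Im (half_circle t') -
       complex.Im (half_circle t) * complex.Re (half_circle t') =
  2 * (t' - t) * (1 + t * t') / ((1 + t ^+ 2) * (1 + t' ^+ 2)).
  by rewrite /=; field; rewrite !gt_eqF.
apply: divr_ge0; last by rewrite mulr_ge0 ?ltW.
rewrite !mulr_ge0 ?subr_ge0 //.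
have u1 : 0 <= (1 + t) * (1 + t') by rewrite mulr_ge0 //; lra.
have u2 : 0 <= (1 - t) * (1 - t') by rewrite mulr_ge0 //; lra.
by lra.
Qed.

Lemma half_circle_Im t t' : -1 <= t -> t <= t' -> t' <= 1 ->
  complex.Im (half_circle t) <= complex.Im (half_circle t').
Proof.
move=> h1 h2 h3; rewrite -subr_ge0.
have h : 0 < 1 + t ^+ 2 by rewrite ltr_wpDr // sqr_ge0.
have h' : 0 < 1 + t' ^+ 2 by rewrite ltr_wpDr // sqr_ge0.
have -> : complex.Im (half_circle t') - complex.Im (half_circle t) =
  2 * (t' - t) * (1 - t * t') / ((1 + t ^+ 2) * (1 + t' ^+ 2)).
  by rewrite /=; field; rewrite !gt_eqF.
apply: divr_ge0; last by rewrite mulr_ge0 ?ltW.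
rewrite !mulr_ge0 ?subr_ge0 //.
have u1 : 0 <= (1 + t) * (1 - t') by rewrite mulr_ge0 //; lra.
have u2 : 0 <= (1 - t) * (1 + t') by rewrite mulr_ge0 //; lra.
by lra.
Qed.

Lemma stadium_nbhd r k t : 0 <= r -> 0 <= t <= 1 -> unit_nbhd r (stadium r k t).
Proof.
move=> r0 /andP[t0 t1]; case: k => b1 b2.
pose x : R := if b2 then 1 - t else 1.
have x01 : 0 <= x <= 1 by rewrite /x; case: (b2); rewrite ?ler01 ?lexx //; lra.
have h : cabs (stadium r (false, b2) t - x%:C%C) <= r.
  rewrite /x /stadium; case: (b2) => /=; first by apply: cabs_le => //=; nra.
  rewrite addrAC rmorph1 subrr add0r cabsM cabs_half_circle mulr1.
  by rewrite cabs_real ger0_norm.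
case: b1; last by exists x.
exists (1 - x); first by lra.
have -> : stadium r (true, b2) t = 1 - stadium r (false, b2) t by [].
have E (a b : R[i]) : 1 - a - (1 - b) = b - a by ring.
by rewrite rmorphB rmorph1 E cabsB.
Qed.

Lemma stadium_far r k t x : 0 <= r -> 0 <= t <= 1 -> 0 <= x <= 1 ->
  r <= cabs (stadium r k t - x%:C%C).
Proof.
move=> r0 t01 x01; case: k => b1 b2.
have h y : 0 <= y <= 1 -> r <= cabs (stadium r (false, b2) t - y%:C%C).
  move=> /andP[y0 y1]; apply: cabs_ge => //; rewrite /stadium; case: (b2).
    by rewrite /= subr0 lerDr sqr_ge0.
  have hn := half_circle_norm (2 * t - 1).
  have hr : 0 <= complex.Re (half_circle (2 * t - 1)).
    by apply: half_circle_Re; move/andP: t01 => [? ?]; apply/andP; split; lra.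
  case: (half_circle _) hn hr => a b /= hn a0; rewrite !mul0r subr0 !addr0 add0r oppr0 addr0.
  have : r ^+ 2 * (a ^+ 2 + b ^+ 2) = r ^+ 2 by rewrite hn mulr1.
  have : 0 <= r * a * (1 - y) by rewrite !mulr_ge0 // subr_ge0.
  have := sqr_ge0 (1 - y); nra.
case: b1; last exact: h.
have -> : stadium r (true, b2) t = 1 - stadium r (false, b2) t by [].
have E (a b : R[i]) : a - (1 - b) = - (1 - a - b) by ring.
by rewrite -cabsN -E -[1 - _](rmorphB (real_complex R) 1 x); apply: h; lra.
Qed.

Lemma stadium_lip r k t t' : 0 <= r ->
  cabs (stadium r k t' - stadium r k t) <= (1 + 4 * r) * `|t' - t|.
Proof.
move=> r0; case: k => b1 b2.
have h : cabs (stadium r (false, b2) t' - stadium r (false, b2) t) <= (1 + 4 * r) * `|t' - t|.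
  rewrite /stadium; case: (b2) => /=.
    have -> : (((1 - t') +i* r) - ((1 - t) +i* r) = (t - t')%:C)%C.
      by apply/eqP; rewrite eq_complex /=; apply/andP; split; apply/eqP; ring.
    by rewrite cabs_real distrC ler_peMl // lerDl mulr_ge0.
  have -> : 1 + r%:C%C * half_circle (2 * t' - 1) - (1 + r%:C%C * half_circle (2 * t - 1)) =
    r%:C%C * (half_circle (2 * t' - 1) - half_circle (2 * t - 1)) by ring.
  rewrite cabsM cabs_real ger0_norm //.
  have := half_circle_lip (2 * t - 1) (2 * t' - 1).
  have -> : 2 * t' - 1 - (2 * t - 1) = 2 * (t' - t) by ring.
  rewrite normrM ger0_norm // => h.
  have := ler_wpM2l r0 h; have := normr_ge0 (t' - t); nra.
case: b1 => //.
have E (a b : R[i]) : 1 - a - (1 - b) = b - a by ring.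
have -> u : stadium r (true, b2) u = 1 - stadium r (false, b2) u by [].
by rewrite E cabsB.
Qed.

(** Twice the signed area of the triangle with vertices 0 and two successive points. On the straight
    pieces it is computed with height [r]; on the half circles only the sign is kept. *)
Lemma stadium_cross r k t t' : 0 < r -> 0 <= t -> t <= t' -> t' <= 1 ->
  (if k.2 then r * (t' - t) else 0) <=
  complex.Re (stadium r k t) * complex.Im (stadium r k t') -
  complex.Im (stadium r k t) * complex.Re (stadium r k t').
Proof.
move=> r0 t0 tt t1; case: k => b1 [] /=.
  by rewrite /stadium /=; case: b1 => /=; nra.
have h1 : -1 <= 2 * t - 1 by lra.
have h2 : 2 * t - 1 <= 2 * t' - 1 by lra.
have h3 : 2 * t' - 1 <= 1 by lra.
have := half_circle_cross h1 h2 h3; have := half_circle_Im h1 h2 h3.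
rewrite /stadium; move: (half_circle (2 * t - 1)) (half_circle (2 * t' - 1)).
move=> [a b] [a' b'] /= hb hc.
have hc' : 0 <= r ^+ 2 * (a * b' - b * a') by exact: (mulr_ge0 (sqr_ge0 r) hc).
have hb' : 0 <= r * (b' - b) by rewrite mulr_ge0 ?subr_ge0 // ltW.
by case: b1 => /=; nra.
Qed.

Section Nodes.
Context (r : R) (r0 : 0 < r) (m : nat).

Lemma edge_itv (e : edge m) : 0 <= e.2%:R / m.+1%:R :> R /\ e.2.+1%:R / m.+1%:R <= 1 :> R.
Proof.
by rewrite divr_ge0 // ler_pdivrMr ?ltr0n // mul1r ler_nat ltn_ord.
Qed.

Lemma edge_lt (e : edge m) : e.2%:R / m.+1%:R <= e.2.+1%:R / m.+1%:R :> R.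
Proof. by rewrite ler_pM2r ?invr_gt0 ?ltr0n // ler_nat. Qed.

Lemma edge_diff (e : edge m) : e.2.+1%:R / m.+1%:R - e.2%:R / m.+1%:R = m.+1%:R^-1 :> R.
Proof. by rewrite -mulrBl -natr1 addrAC subrr add0r mul1r. Qed.

Lemma node_nbhd (e : edge m) : unit_nbhd r (node r e).
Proof.
have [h1 h2] := edge_itv e; have h3 := edge_lt e.
apply: stadium_nbhd; first exact: ltW.
by rewrite h1 (le_trans h3 h2).
Qed.

Lemma next_node_nbhd (e : edge m) : unit_nbhd r (next_node r e).
Proof.
have [h1 h2] := edge_itv e; have h3 := edge_lt e.
apply: stadium_nbhd; first exact: ltW.
by rewrite h2 (le_trans h1 h3).
Qed.

Lemma node_far (e : edge m) x : 0 <= x <= 1 -> r <= cabs (node r e - x%:C%C).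
Proof.
have [h1 h2] := edge_itv e; have h3 := edge_lt e.
move=> x01; apply: stadium_far => //; first exact: ltW.
by rewrite h1 (le_trans h3 h2).
Qed.

Lemma step_le (e : edge m) : cabs (step r e) <= (1 + 4 * r) / m.+1%:R.
Proof.
rewrite (le_trans (stadium_lip _ _ _ (ltW r0))) //.
by rewrite edge_diff ger0_norm // invr_ge0.
Qed.

Lemma sum_step_le : \sum_(e : edge m) cabs (step r e) <= 4 * (1 + 4 * r).
Proof.
apply: (@le_trans _ _ (\sum_(e : edge m) (1 + 4 * r) / m.+1%:R)).
  by apply: ler_sum => e _; exact: step_le.
have -> : \sum_(e : edge m) (1 + 4 * r) / m.+1%:R = (1 + 4 * r) / m.+1%:R *+ (4 * m.+1)%N.
  by rewrite sumr_const !card_prod card_ord card_bool.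
rewrite -mulr_natr natrM mulrA mulrAC mulfVK ?pnatr_eq0 //.
by rewrite mulrC.
Qed.

(** Every piece telescopes to its two end points, and [c1] to [c4] match the ends of the four
    pieces. This is the discrete form of the vanishing integral of an exact form. *)
Lemma closed_contour (F : R[i] -> R[i]) :
  \sum_(e : edge m) F (next_node r e) = \sum_(e : edge m) F (node r e).
Proof.
have piece k : \sum_(i < m.+1) F (stadium r k (i.+1%:R / m.+1%:R)) -
    \sum_(i < m.+1) F (stadium r k (i%:R / m.+1%:R)) = F (stadium r k 1) - F (stadium r k 0).
  rewrite -sumrB -(big_mkord xpredT (fun i => F (stadium r k (i.+1%:R / m.+1%:R)) -
    F (stadium r k (i%:R / m.+1%:R)))).
  rewrite (telescope_sumr (fun i => F (stadium r k (i%:R / m.+1%:R)))) //.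
  by rewrite divff ?pnatr_eq0 // mul0r.
rewrite /edge /node /next_node.
rewrite -(pair_bigA _ (fun k (i : 'I_m.+1) => F (stadium r k (i.+1%:R / m.+1%:R)))) /=.
rewrite -(pair_bigA _ (fun k (i : 'I_m.+1) => F (stadium r k (i%:R / m.+1%:R)))) /=.
apply/eqP; rewrite -subr_eq0 -sumrB; under eq_bigr do rewrite piece.
rewrite -(pair_bigA _ (fun b1 b2 => F (stadium r (b1, b2) 1) - F (stadium r (b1, b2) 0))) /=.
rewrite !big_bool /=.
have E1 : half_circle (2 * 1 - 1) = (0 +i* 1)%C.
  by rewrite /half_circle; congr (_ +i* _)%C; field; rewrite ?pnatr_eq0.
have E0 : half_circle (2 * 0 - 1) = (0 +i* - 1)%C.
  by rewrite /half_circle; congr (_ +i* _)%C; field; rewrite ?pnatr_eq0.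
rewrite /stadium /= E1 E0.
have c1 : 1 - ((1 - 1) +i* r)%C = 1 + r%:C%C * (0 +i* - 1)%C by apply/eqP; rewrite eq_complex /=; apply/andP; split; apply/eqP; ring.
have c2 : 1 - ((1 - 0) +i* r)%C = 1 - (1 + r%:C%C * (0 +i* 1)%C) by apply/eqP; rewrite eq_complex /=; apply/andP; split; apply/eqP; ring.
have c3 : ((1 - 1) +i* r)%C = 1 - (1 + r%:C%C * (0 +i* - 1)%C) by apply/eqP; rewrite eq_complex /=; apply/andP; split; apply/eqP; ring.
have c4 : ((1 - 0) +i* r)%C = 1 + r%:C%C * (0 +i* 1)%C by apply/eqP; rewrite eq_complex /=; apply/andP; split; apply/eqP; ring.
rewrite c1 c2 c3 c4; apply/eqP; ring.
Qed.

(* A Riemann sum for 2 pi i; only a lower bound at 0 and near constancy in [z]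
   are needed. *)
Definition winding z : R[i] := \sum_(e : edge m) step r e / (node r e - z).

Lemma node_neq0 (e : edge m) : node r e != 0.
Proof.
rewrite -cabs_gt0 (lt_le_trans r0) //; have := @node_far e 0.
by rewrite subr0; apply; rewrite lexx ler01.
Qed.

(** The imaginary part of [step / node] is the cross product of successive nodes over the squared
    modulus, at most [(1 + r) ^+ 2]. Each straight piece contributes the stated bound, the half
    circles at least 0. *)
Lemma winding_ge : r / (1 + r) ^+ 2 <= cabs (winding 0).
Proof.
apply: le_trans (Im_le_cabs _); apply: le_trans (ler_norm _).
have -> : complex.Im (winding 0) = \sum_(e : edge m) complex.Im (step r e / (node r e - 0)).
  by rewrite /winding; apply: (big_morph (@complex.Im R)) => // -[? ?] [].
have Im_ge (e : edge m) : (if e.1.2 then r / m.+1%:R / (1 + r) ^+ 2 else 0) <=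
    complex.Im (step r e / (node r e - 0)).
  rewrite subr0 Im_div.
  have -> : complex.Im (step r e) * complex.Re (node r e) - complex.Re (step r e) * complex.Im (node r e)
    = complex.Re (node r e) * complex.Im (next_node r e) - complex.Im (node r e) * complex.Re (next_node r e).
    by rewrite /step; case: (next_node r e) => a b; case: (node r e) => a' b' /=; ring.
  have [h1 h2] := edge_itv e; have h3 := edge_lt e.
  have := stadium_cross e.1 r0 h1 h3 h2; rewrite edge_diff -/(node r e) -/(next_node r e).
  have n0 : 0 < cabs (node r e) ^+ 2 by rewrite exprn_gt0 // cabs_gt0 node_neq0.
  have n1 : cabs (node r e) ^+ 2 <= (1 + r) ^+ 2.
    rewrite lerXn2r ?nnegrE ?cabs_ge0 ?addr_ge0 ?(ltW r0) //.
    have [x /andP[x0 x1] hx] := node_nbhd e.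
    have := cabsD (node r e - x%:C%C) x%:C%C; rewrite subrK cabs_real ger0_norm //; lra.
  case: (e.1.2) => hc; last by rewrite divr_ge0 // ltW.
  by rewrite ler_pM // ?lef_pV2 ?posrE ?(lt_le_trans n0) // ?invr_ge0 ?sqr_ge0 // divr_ge0 ?ltW.
apply: le_trans (ler_sum _ (fun e _ => Im_ge e)).
rewrite -(pair_bigA _ (fun k (i : 'I_m.+1) => if k.2 then r / m.+1%:R / (1 + r) ^+ 2 else 0)) /=.
rewrite -(pair_bigA _ (fun b1 b2 => \sum_(i < m.+1) if b2 then r / m.+1%:R / (1 + r) ^+ 2 else 0)) /=.
rewrite !big_bool /= !sumr_const card_ord.
have -> : (r / m.+1%:R / (1 + r) ^+ 2) *+ m.+1 = r / (1 + r) ^+ 2.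
  by rewrite -mulr_natr mulrAC mulfVK ?pnatr_eq0.
rewrite mul0rn !addr0 lerDl divr_ge0 ?sqr_ge0 // ltW //.
Qed.
End Nodes.
End Contour.

(** * Cauchy's formula for polygons *)

Section CauchySum.
Context (R : realType).
Implicit Types (z w : R[i]) (x s r e del : R) (h : R[i] -> R[i]).

Lemma unit_nbhd_convex r z w s : unit_nbhd r z -> unit_nbhd r w -> 0 <= s <= 1 ->
  unit_nbhd r (z + s%:C%C * (w - z)).
Proof.
move=> [x /andP[x0 x1] hx] [y /andP[y0 y1] hy] /andP[s0 s1].
exists (x + s * (y - x)); first by apply/andP; split; nra.
have -> : z + s%:C%C * (w - z) - (x + s * (y - x))%:C%C =
    (1 - s)%:C%C * (z - x%:C%C) + s%:C%C * (w - y%:C%C).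
  by rewrite !(rmorphD, rmorphM, rmorphN, rmorph1) /=; ring.
rewrite (le_trans (cabsD _ _)) // !cabsM !cabs_real !ger0_norm ?subr_ge0 //.
have := ler_wpM2l s0 hy; have s2 : 0 <= 1 - s by lra.
by have := ler_wpM2l s2 hx; lra.
Qed.

(** The only form in which holomorphy enters Cauchy's formula: one [del] serves all base points. *)
Definition unif_diff r e del h (h' : R[i] -> R[i]) := forall z w, unit_nbhd r z -> unit_nbhd r w ->
  cabs (w - z) < del -> cabs (h w - h z - h' z * (w - z)) <= e * cabs (w - z).

(** An upper bound for the length of every polygon: four pieces, each with Lipschitz constant
    [1 + 4 * r]. *)
Definition contour_length r : R := 4 * (1 + 4 * r).

Lemma contour_length_gt0 r : 0 < r -> 0 < contour_length r.
Proof. by move=> r0; rewrite /contour_length mulr_gt0 // ltr_wpDr ?mulr_ge0 // ltW. Qed.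

(* Cauchy's formula for Riemann sums: contract the contour to z and telescope
   the derivative along the contour. *)
Lemma cauchy_sum r m e del h h' z : 0 < r -> 0 <= e -> 0 < del ->
  (1 + 4 * r) / m.+1%:R < del -> unif_diff r e del h h' ->
  unit_nbhd r z -> (forall k : edge m, node r k != z) ->
  cabs (\sum_(k : edge m) h (node r k) * (step r k / (node r k - z)) - h z * winding r m z)
   <= 2 * e * contour_length r.
Proof.
move=> r0 e0 d0 mesh hh zr nz; pose L := contour_length r.
have L0 : 0 < L by exact: contour_length_gt0.
pose D := \sum_(k : edge m) cabs (node r k - z).
have D0 : 0 <= D by apply: sumr_ge0 => k _; exact: cabs_ge0.
have leD (k : edge m) : cabs (node r k - z) <= D.
  by rewrite /D (bigD1 k) //= lerDl sumr_ge0 // => *; exact: cabs_ge0.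
(* So many contraction steps that each moves every node by less than [del]. *)
pose n := (Num.bound (D / del)).+1.
have hn : D / n%:R < del.
  rewrite ltr_pdivrMr ?ltr0n // mulrC -ltr_pdivrMr //.
  by rewrite (lt_trans (archi_boundP _)) ?divr_ge0 ?(ltW d0) // ltr_nat.
have n0 : (0 : R) < n%:R by rewrite ltr0n.
pose s (j : nat) : R := j%:R / n%:R.
pose y j (k : edge m) := z + (s j)%:C%C * (node r k - z).
pose y' j (k : edge m) := z + (s j)%:C%C * (next_node r k - z).
pose I j := \sum_(k : edge m) h (y j k) * (step r k / (node r k - z)).
have s01 j : (j <= n)%N -> 0 <= s j <= 1.
  by move=> jn; rewrite /s divr_ge0 //= ler_pdivrMr // mul1r ler_nat.
have yr j k : (j <= n)%N -> unit_nbhd r (y j k).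
  by move=> jn; apply: unit_nbhd_convex (s01 _ jn) => //; exact: node_nbhd.
have y'r j k : (j <= n)%N -> unit_nbhd r (y' j k).
  by move=> jn; apply: unit_nbhd_convex (s01 _ jn) => //; exact: next_node_nbhd.
have sumstep : \sum_(k : edge m) step r k = 0.
  by rewrite sumrB (closed_contour r m id) subrr.
(* Differences of [h] telescope around the contracted polygon [y j], so its derivative sums to
   nearly 0. For [j = 0] the polygon is the point [z], and the steps themselves sum to 0. *)
have der j : (j <= n)%N -> cabs (\sum_(k : edge m) h' (y j k) * step r k) <= e * L.
  case: j => [|j] jn.
    rewrite (eq_bigr (fun k => h' z * step r k)) => [|k _].
      by rewrite -mulr_sumr sumstep mulr0 cabs0 mulr_ge0 // ltW.
    by rewrite /y /s mul0r mul0r addr0.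
  have sj : 0 < s j.+1 by rewrite divr_gt0 // ltr0n.
  have /andP[_ sj1] := s01 _ jn.
  have dy k : y' j.+1 k - y j.+1 k = (s j.+1)%:C%C * step r k.
    by rewrite /y /y' /step; ring.
  rewrite -(ler_pM2l sj) -[X in X * cabs _](ger0_norm (ltW sj)) -cabs_real -cabsM.
  have -> : (s j.+1)%:C%C * \sum_(k : edge m) h' (y j.+1 k) * step r k =
    - \sum_(k : edge m) (h (y' j.+1 k) - h (y j.+1 k) - h' (y j.+1 k) * (y' j.+1 k - y j.+1 k)).
    have E := closed_contour r m (fun v => h (z + (s j.+1)%:C%C * (v - z))).
    rewrite !sumrB /y' /y E subrr sub0r opprK mulr_sumr; apply: eq_bigr => k _.
    by rewrite /step; ring.
  rewrite cabsN (le_trans (cabs_sum _ _ _)) //.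
  apply: (@le_trans _ _ (\sum_(k : edge m) s j.+1 * e * cabs (step r k))); last first.
    rewrite -mulr_sumr -mulrA ler_pM2l // ler_wpM2l //; exact: sum_step_le.
  apply: ler_sum => k _; apply: (le_trans (hh _ _ (yr _ _ jn) (y'r _ _ jn) _)).
    rewrite dy cabsM cabs_real ger0_norm ?(ltW sj) //.
    apply: le_lt_trans mesh; apply: le_trans (step_le r0 k).
    by rewrite ler_piMl // cabs_ge0.
  by rewrite dy cabsM cabs_real ger0_norm ?(ltW sj) // mulrCA mulrA.
(* Differentiating in the contraction parameter produces a factor [node r k - z] that cancels the
   denominator. Hence [I] changes by the sum in [der] over [n], up to the remainder of [h]. *)
have stepI j : (j < n)%N -> cabs (I j.+1 - I j) <= 2 * e * L / n%:R.
  move=> jn; have jn' := ltnW jn.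
  have dy k : y j.+1 k - y j k = n%:R^-1 * (node r k - z).
    rewrite /y /s -natr1 mulrDl mul1r rmorphD /= fmorphV rmorph_nat.
    by ring.
  have -> : I j.+1 - I j =
    \sum_(k : edge m) (h (y j.+1 k) - h (y j k) - h' (y j k) * (y j.+1 k - y j k)) * (step r k / (node r k - z))
    + n%:R^-1 * \sum_(k : edge m) h' (y j k) * step r k.
    rewrite -sumrB mulr_sumr -big_split /=; apply: eq_bigr => k _; rewrite dy.
    have nk : node r k - z != 0 by rewrite subr_eq0.
    by move: (h' _) (h _) (h _) => a b c; field; rewrite nk pnatr_eq0.
  rewrite (le_trans (cabsD _ _)) //.
  have -> : 2 * e * L / n%:R = e * L / n%:R + n%:R^-1 * (e * L) by ring.
  apply: lerD; last first.
    by rewrite cabsM cabsV cabs_natr ler_pM2l ?invr_gt0 // der.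
  apply: (le_trans (cabs_sum _ _ _)).
  apply: (@le_trans _ _ (\sum_(k : edge m) e / n%:R * cabs (step r k))); last first.
    rewrite -mulr_sumr mulrAC ler_pM2r ?invr_gt0 // ler_wpM2l //; exact: sum_step_le.
  apply: ler_sum => k _; rewrite cabsM.
  have nk : 0 < cabs (node r k - z) by rewrite cabs_gt0 subr_eq0.
  have cdy : cabs (y j.+1 k - y j k) = cabs (node r k - z) / n%:R.
    by rewrite dy cabsM cabsV cabs_natr mulrC.
  have hk : cabs (h (y j.+1 k) - h (y j k) - h' (y j k) * (y j.+1 k - y j k)) <=
      e * cabs (y j.+1 k - y j k).
    apply: hh (yr _ _ jn') (yr _ _ jn) _.
    by rewrite cdy (le_lt_trans _ hn) // ler_pM2r ?invr_gt0.
  rewrite cabsM cabsV; apply: (le_trans (ler_wpM2r _ hk)).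
    by rewrite mulr_ge0 ?cabs_ge0 // invr_ge0 cabs_ge0.
  rewrite cdy le_eqVlt; apply/orP; left; apply/eqP; field.
  by rewrite !gt_eqF.
have total j : (j <= n)%N -> cabs (I j - I 0%N) <= j%:R * (2 * e * L / n%:R).
  elim: j => [|j IH] jn; first by rewrite subrr cabs0 mul0r.
  rewrite (le_trans (cabs_subD _ _ (I j))) // -natr1 mulrDl mul1r addrC.
  by rewrite lerD ?stepI // IH // ltnW.
have := total n (leqnn n); rewrite mulrC mulfVK ?gt_eqF //.
have -> : I n = \sum_(k : edge m) h (node r k) * (step r k / (node r k - z)).
  apply: eq_bigr => k _; congr (h _ * _).
  by rewrite /y /s divff ?gt_eqF // rmorph1 mul1r addrC subrK.
have -> // : I 0%N = h z * winding r m z.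
rewrite /winding mulr_sumr; apply: eq_bigr => k _.
by rewrite /y /s mul0r mul0r addr0.
Qed.

(* Subdividing a segment removes the quadratic error term. *)
Lemma subdivision r (h : R[i] -> R[i]) K K2 z w : 0 <= K2 ->
  (forall z w, unit_nbhd r z -> unit_nbhd r w ->
     cabs (h w - h z) <= K * cabs (w - z) + K2 * cabs (w - z) ^+ 2) ->
  unit_nbhd r z -> unit_nbhd r w -> cabs (h w - h z) <= K * cabs (w - z).
Proof.
move=> K20 hh zr wr; apply/ler_addgt0Pr => e e0.
set D := cabs (w - z); have D0 : 0 <= D by exact: cabs_ge0.
pose n := (Num.bound (K2 * D ^+ 2 / e)).+1.
have n0 : (0 : R) < n%:R by rewrite ltr0n.
have hn : K2 * D ^+ 2 / n%:R <= e.
  rewrite ler_pdivrMr ?ltr0n // -ler_pdivrMl // [e^-1 * _]mulrC ltW //.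
  rewrite (lt_trans (archi_boundP _)) ?ltr_nat //.
  by rewrite divr_ge0 ?(ltW e0) // mulr_ge0 // sqr_ge0.
pose y (j : nat) := z + (j%:R / n%:R : R)%:C%C * (w - z).
have yr j : (j <= n)%N -> unit_nbhd r (y j).
  move=> jn; apply: unit_nbhd_convex => //.
  by rewrite divr_ge0 //= ler_pdivrMr // mul1r ler_nat.
have total j : (j <= n)%N -> cabs (h (y j) - h (y 0%N)) <=
    j%:R * (K * D / n%:R + K2 * D ^+ 2 / n%:R ^+ 2).
  elim: j => [|j IH] jn; first by rewrite subrr cabs0 mul0r.
  rewrite (le_trans (cabs_subD _ _ (h (y j)))) // -natr1 mulrDl mul1r addrC.
  apply: lerD; first exact: IH (ltnW jn).
  have dy : cabs (y j.+1 - y j) = D / n%:R.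
    have -> : y j.+1 - y j = (n%:R^-1 : R)%:C%C * (w - z).
      by rewrite /y -natr1 mulrDl mul1r rmorphD /=; ring.
    by rewrite cabsM cabs_real ger0_norm ?invr_ge0 // mulrC.
  have := hh _ _ (yr _ (ltnW jn)) (yr _ jn); rewrite dy => /le_trans; apply.
  by rewrite expr_div_n !mulrA.
have y0 : y 0%N = z by rewrite /y mul0r mul0r addr0.
have yn : y n = w by rewrite /y divff ?gt_eqF // rmorph1 mul1r addrC subrK.
have := total n (leqnn n); rewrite y0 yn => /le_trans; apply.
have -> : n%:R * (K * D / n%:R + K2 * D ^+ 2 / n%:R ^+ 2) = K * D + K2 * D ^+ 2 / n%:R.
  by field; rewrite gt_eqF.
by rewrite lerD2l.
Qed.

(** The derivative in [z] is the sum [W2], a Riemann sum for the exact form with primitive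
    [- (u - z)^-1]; it differs from a telescoping sum by the order of the mesh. [subdivision] then
    removes the quadratic term. *)
Lemma winding_const r r' m z w : 0 < r' -> r' < r -> unit_nbhd r' z -> unit_nbhd r' w ->
  cabs (winding r m w - winding r m z) <=
    (1 + 4 * r) * contour_length r / (r - r') ^+ 3 / m.+1%:R * cabs (w - z).
Proof.
move=> r'0 r'r; have r0 := lt_trans r'0 r'r; set d := r - r'.
have d0 : 0 < d by rewrite subr_gt0.
have far v (k : edge m) : unit_nbhd r' v -> d <= cabs (node r k - v).
  move=> [x x01 hx]; have := node_far r0 k x01.
  by have := cabs_subD (node r k) x%:C%C v; rewrite /d; lra.
have far' v (k : edge m) : unit_nbhd r' v -> d <= cabs (next_node r k - v).
  move=> [x x01 hx].
  have : r <= cabs (next_node r k - x%:C%C).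
    have [h1 h2] := edge_itv R k; have h3 := edge_lt R k.
    by apply: stadium_far => //; [exact: ltW | rewrite (le_trans h1 h3) h2].
  by have := cabs_subD (next_node r k) x%:C%C v; rewrite /d; lra.
have inv_le u : d <= cabs u -> cabs u^-1 <= d^-1.
  by move=> du; rewrite cabsV lef_pV2 ?posrE // (lt_le_trans d0).
have nz u : d <= cabs u -> u != 0 by move=> du; rewrite -cabs_gt0 (lt_le_trans d0).
pose L := contour_length r.
have L0 : 0 < L by exact: contour_length_gt0.
pose mesh := (1 + 4 * r) / m.+1%:R.
have mesh0 : 0 <= mesh by rewrite divr_ge0 // addr_ge0 // mulr_ge0 // ltW.
pose W2 z := \sum_(k : edge m) step r k / (node r k - z) ^+ 2.
have W2le v : unit_nbhd r' v -> cabs (W2 v) <= mesh * L / d ^+ 3.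
  move=> vr.
  have E : \sum_(k : edge m) ((node r k - v)^-1 - (next_node r k - v)^-1) = 0.
    by rewrite sumrB (closed_contour r m (fun u => (u - v)^-1)) subrr.
  rewrite -[W2 v]subr0 -E /W2 -sumrB (le_trans (cabs_sum _ _ _)) //.
  apply: (@le_trans _ _ (\sum_(k : edge m) mesh / d ^+ 3 * cabs (step r k))); last first.
    rewrite -mulr_sumr mulrAC ler_wpM2r ?invr_ge0 ?exprn_ge0 ?(ltW d0) //.
    by rewrite ler_wpM2l //; exact: sum_step_le.
  apply: ler_sum => k _.
  have nk := nz _ (far _ k vr); have nk' := nz _ (far' _ k vr).
  have -> : step r k / (node r k - v) ^+ 2 - ((node r k - v)^-1 - (next_node r k - v)^-1) =
    step r k * step r k * ((node r k - v)^-1 ^+ 2 * (next_node r k - v)^-1).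
    by rewrite /step; field; rewrite nk nk'.
  have -> (a b c : R[i]) : cabs (a * a * (b ^+ 2 * c)) = cabs a * (cabs a * (cabs b ^+ 2 * cabs c)).
    by rewrite !cabsM; ring.
  rewrite [leRHS]mulrC ler_wpM2l ?cabs_ge0 //.
  have a1 := inv_le _ (far _ k vr); have a2 := inv_le _ (far' _ k vr).
  have a3 : cabs (node r k - v)^-1 ^+ 2 * cabs (next_node r k - v)^-1 <= d ^- 3.
    have -> : d ^- 3 = d^-1 ^+ 2 * d^-1 by rewrite -exprVn -exprSr.
    rewrite ler_pM ?exprn_ge0 ?cabs_ge0 // lerXn2r ?nnegrE ?cabs_ge0 ?invr_ge0 ?(ltW d0) //.
  have a4 := step_le r0 k; rewrite -/mesh in a4.
  by rewrite ler_pM ?cabs_ge0 // mulr_ge0 ?exprn_ge0 ?cabs_ge0.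
move=> zr wr.
have -> : (1 + 4 * r) * contour_length r / d ^+ 3 / m.+1%:R = mesh * L / d ^+ 3.
  by rewrite /mesh -/L; ring.
apply: (@subdivision r' _ _ (L / d ^+ 3)) => //.
  by rewrite divr_ge0 ?exprn_ge0 ?(ltW L0) ?(ltW d0).
move=> {zr wr} {}z {}w zr wr.
have -> : winding r m w - winding r m z = W2 z * (w - z) +
    \sum_(k : edge m) step r k * ((w - z) ^+ 2 * ((node r k - w)^-1 * (node r k - z)^-1 ^+ 2)).
  rewrite /W2 mulr_suml -big_split -sumrB /=; apply: eq_bigr => k _.
  have nk := nz _ (far _ k zr); have nk' := nz _ (far _ k wr).
  by field; rewrite nk nk'.
rewrite (le_trans (cabsD _ _)) // cabsM lerD // ?ler_wpM2r ?cabs_ge0 ?W2le //.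
apply: (le_trans (cabs_sum _ _ _)).
apply: (@le_trans _ _ (\sum_(k : edge m) d ^- 3 * cabs (w - z) ^+ 2 * cabs (step r k))); last first.
  have -> : L / d ^+ 3 * cabs (w - z) ^+ 2 = d ^- 3 * cabs (w - z) ^+ 2 * L by ring.
  rewrite -mulr_sumr ler_wpM2l ?mulr_ge0 ?invr_ge0 ?exprn_ge0 ?cabs_ge0 ?(ltW d0) //.
  exact: sum_step_le.
apply: ler_sum => k _.
have -> (a b c u : R[i]) : cabs (a * (b ^+ 2 * (c * u ^+ 2))) =
    cabs c * cabs u ^+ 2 * cabs b ^+ 2 * cabs a by rewrite !cabsM; ring.
do 2 (rewrite ler_wpM2r ?exprn_ge0 ?cabs_ge0 //).
have a1 := inv_le _ (far _ k zr); have a2 := inv_le _ (far _ k wr).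
have -> : d ^- 3 = d^-1 * d^-1 ^+ 2 by rewrite -exprVn -exprS.
by rewrite ler_pM ?exprn_ge0 ?cabs_ge0 // lerXn2r ?nnegrE ?cabs_ge0 ?invr_ge0 ?(ltW d0).
Qed.
End CauchySum.

(** * Complex limits and functions with a quadratic remainder *)

Section ComplexLimits.
Context (R : realType).
Implicit Types (u v : nat -> R[i]) (l k : R[i]).

Definition ccvg u l := forall e : R, 0 < e -> exists N, forall n, (N <= n)%N -> cabs (u n - l) <= e.

Lemma ccvg_cst l : ccvg (fun=> l) l.
Proof. by move=> e e0; exists 0%N => n _; rewrite subrr cabs0 ltW. Qed.

Lemma eq_ccvg u v l : u =1 v -> ccvg u l -> ccvg v l.
Proof. by move=> uv hu e /hu[N h]; exists N => n /h; rewrite uv. Qed.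

Lemma ccvgD u v l k : ccvg u l -> ccvg v k -> ccvg (fun n => u n + v n) (l + k).
Proof.
move=> hu hv e e0; have e2 : 0 < e / 2 by rewrite divr_gt0.
have [N1 h1] := hu _ e2; have [N2 h2] := hv _ e2.
exists (maxn N1 N2) => n; rewrite geq_max => /andP[/h1 n1 /h2 n2].
by rewrite opprD addrACA (le_trans (cabsD _ _)) //; lra.
Qed.

Lemma ccvgM u v l k : ccvg u l -> ccvg v k -> ccvg (fun n => u n * v n) (l * k).
Proof.
move=> hu hv e e0; pose b := 1 + cabs l + cabs k + e.
have l0 := cabs_ge0 l; have k0 := cabs_ge0 k.
have b0 : 0 < b by rewrite /b; lra.
have eb : 0 < e / b by rewrite divr_gt0.
have eb1 : e / b <= 1 by rewrite ler_pdivrMr // /b; lra.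
have [N1 h1] := hu _ eb; have [N2 h2] := hv _ eb.
exists (maxn N1 N2) => n; rewrite geq_max => /andP[/h1 n1 /h2 n2].
have -> : u n * v n - l * k = (u n - l) * (v n - k) + l * (v n - k) + (u n - l) * k by ring.
rewrite (le_trans (cabsD _ _)) //.
have h3 := cabsD ((u n - l) * (v n - k)) (l * (v n - k)).
rewrite !cabsM in h3 *.
have eE : e / b * (1 + cabs l + cabs k + e) = e by rewrite mulfVK // gt_eqF.
have p1 : cabs (u n - l) * cabs (v n - k) <= e / b * 1.
  by rewrite ler_pM ?cabs_ge0 // (le_trans n2).
have p2 : cabs l * cabs (v n - k) <= cabs l * (e / b) by rewrite ler_wpM2l.
have p3 : cabs (u n - l) * cabs k <= e / b * cabs k by rewrite ler_wpM2r.
have p4 : 0 <= e / b * e by rewrite mulr_ge0 // ltW.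
by clear -h3 p1 p2 p3 p4 eE; move: (e / b) => q in eE p1 p2 p3 p4 *; lra.
Qed.

Lemma ccvgN u l : ccvg u l -> ccvg (fun n => - u n) (- l).
Proof. by move=> hu e /hu[N h]; exists N => n /h; rewrite -opprD cabsN. Qed.

Lemma ccvgB u v l k : ccvg u l -> ccvg v k -> ccvg (fun n => u n - v n) (l - k).
Proof. by move=> hu hv; apply: ccvgD => //; exact: ccvgN. Qed.

Lemma ccvg_sum (I : Type) (s : seq I) (u : I -> nat -> R[i]) (l : I -> R[i]) :
  (forall i, ccvg (u i) (l i)) -> ccvg (fun n => \sum_(i <- s) u i n) (\sum_(i <- s) l i).
Proof.
move=> h; elim: s => [|i s IH].
  by rewrite big_nil; apply: eq_ccvg (ccvg_cst 0) => n; rewrite big_nil.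
rewrite big_cons; apply: eq_ccvg (ccvgD (h i) IH) => n.
by rewrite big_cons.
Qed.

Lemma ccvg_le u l (B : R) : ccvg u l -> (forall n, cabs (u n) <= B) -> cabs l <= B.
Proof.
move=> hu hB; apply/ler_addgt0Pr => e /hu[N h].
have := h N (leqnn N); have := hB N; have := cabs_dist l (u N); rewrite cabsB; lra.
Qed.

Lemma ccvg_complete u :
  (forall e : R, 0 < e -> exists N, forall m n, (N <= m)%N -> (N <= n)%N -> cabs (u m - u n) <= e) ->
  exists l, ccvg u l.
Proof.
move=> hu.
have real_complete (a : nat -> R) : (forall m n, `|a m - a n| <= cabs (u m - u n)) ->
    exists l : R, forall e, 0 < e -> exists N, forall n, (N <= n)%N -> `|a n - l| <= e.
  move=> ha.
  have /cvg_ex[l al] : cvgn a.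
    apply: cauchy_cvg; apply: cauchy_exP => e e0.
    have [N h] := hu _ (divr_gt0 e0 (ltr0Sn R 1)).
    exists (a N); exists N => // n /= Nn.
    rewrite /ball /= (le_lt_trans (ha _ _)) // (le_lt_trans (h _ _ (leqnn N) Nn)) //.
    by rewrite gtr_pMr // invf_lt1 // ltr1n.
  exists l => e e0; move/cvgrPdist_le : al => /(_ e e0)[N _ h].
  by exists N => n Nn; rewrite distrC; exact: h.
have [a ha] : exists l : R, forall e, 0 < e -> exists N, forall n, (N <= n)%N ->
    `|complex.Re (u n) - l| <= e.
  apply: (real_complete (fun n => complex.Re (u n))) => m n.
  by rewrite -(raddfB (@complex.Re R)); exact: Re_le_cabs.
have [b hb] : exists l : R, forall e, 0 < e -> exists N, forall n, (N <= n)%N ->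
    `|complex.Im (u n) - l| <= e.
  apply: (real_complete (fun n => complex.Im (u n))) => m n.
  by rewrite -(raddfB (@complex.Im R)); exact: Im_le_cabs.
exists (a +i* b)%C => e e0; have e2 : 0 < e / 2 by rewrite divr_gt0.
have [N1 h1] := ha _ e2; have [N2 h2] := hb _ e2.
exists (maxn N1 N2) => n; rewrite geq_max => /andP[/h1 n1 /h2 n2].
apply: (le_trans (cabs_le_ReIm _)); rewrite raddfB /= raddfB /=.
by lra.
Qed.
End ComplexLimits.

Section C11.
Context (R : realType).
Implicit Types (z w : R[i]) (r B : R) (h f g : R[i] -> R[i]).

(* [h1] plays the role of the complex derivative; the uniform quadratic
   remainder stands in for holomorphy and passes to pointwise limits. *)
Definition C11 r B h h1 := [/\
  forall z, unit_nbhd r z -> cabs (h z) <= B,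
  forall z, unit_nbhd r z -> cabs (h1 z) <= B,
  forall z w, unit_nbhd r z -> unit_nbhd r w -> cabs (h w - h z) <= B * cabs (w - z) &
  forall z w, unit_nbhd r z -> unit_nbhd r w ->
    cabs (h w - h z - h1 z * (w - z)) <= B * cabs (w - z) ^+ 2].

Lemma unit_nbhd0 r : 0 <= r -> unit_nbhd r (0 : R[i]).
Proof. by exists 0; rewrite ?lexx ?ler01 // subr0 cabs0. Qed.

Lemma unit_nbhd_real r (x : R) : 0 <= r -> 0 <= x <= 1 -> unit_nbhd r x%:C%C.
Proof. by exists x => //; rewrite subrr cabs0. Qed.

Lemma unit_nbhd_cabs r z : unit_nbhd r z -> cabs z <= 1 + r.
Proof.
move=> [x /andP[x0 x1] hx]; have := cabsD (z - x%:C%C) x%:C%C.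
by rewrite subrK cabs_real ger0_norm //; lra.
Qed.

Lemma unit_nbhdW r r' z : r' <= r -> unit_nbhd r' z -> unit_nbhd r z.
Proof. by move=> rr [x x01 h]; exists x => //; exact: le_trans rr. Qed.

Lemma C11_ge0 r B h h1 : 0 <= r -> C11 r B h h1 -> 0 <= B.
Proof. by move=> r0 [H _ _ _]; apply: le_trans (H 0 (unit_nbhd0 r0)); exact: cabs_ge0. Qed.

Lemma C11W r r' B B' h h1 : r' <= r -> B <= B' -> C11 r B h h1 -> C11 r' B' h h1.
Proof.
move=> rr BB [H1 H2 H3 H4]; have W := @unit_nbhdW _ _ _ rr; split.
- by move=> z zr; apply: le_trans BB; apply: H1 (W _ zr).
- by move=> z zr; apply: le_trans BB; apply: H2 (W _ zr).
- move=> z w zr wr; apply: le_trans (H3 _ _ (W _ zr) (W _ wr)) _.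
  by rewrite ler_wpM2r // cabs_ge0.
- move=> z w zr wr; apply: le_trans (H4 _ _ (W _ zr) (W _ wr)) _.
  by rewrite ler_wpM2r // exprn_ge0 // cabs_ge0.
Qed.

Lemma C11_unif_diff r B h h1 (e : R) : 0 <= r -> 0 < e -> C11 r B h h1 ->
  unif_diff r e (e / (B + 1)) h h1.
Proof.
move=> r0 e0 hh z w zr wr; have B0 := C11_ge0 r0 hh; case: hh => _ _ _ H4 hd.
have B1 : 0 < B + 1 by lra.
apply: le_trans (H4 _ _ zr wr) _; rewrite expr2 mulrA ler_wpM2r ?cabs_ge0 //.
move: hd; rewrite ltr_pdivlMr // => /ltW; apply: le_trans; rewrite mulrC.
by rewrite ler_wpM2l ?cabs_ge0 // lerDl.
Qed.

Lemma C11_cst r (c : R[i]) : C11 r (cabs c) (fun=> c) (fun=> 0).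
Proof.
split=> [z _|z _|z w _ _|z w _ _] //; rewrite ?subrr ?mul0r ?subrr ?cabs0 ?cabs_ge0 //.
  by rewrite mulr_ge0 ?cabs_ge0.
by rewrite mulr_ge0 ?exprn_ge0 ?cabs_ge0.
Qed.

Lemma C11_id r : 0 <= r -> C11 r (1 + r) id (fun=> 1).
Proof.
move=> r0; split=> [z zr|z _|z w _ _|z w _ _].
- exact: unit_nbhd_cabs.
- by rewrite cabs1 lerDl.
- by rewrite ler_peMl ?cabs_ge0 // lerDl.
- by rewrite mul1r subrr cabs0 mulr_ge0 ?exprn_ge0 ?cabs_ge0 // addr_ge0.
Qed.

Lemma C11D r B1 B2 h h1 g g1 : C11 r B1 h h1 -> C11 r B2 g g1 ->
  C11 r (B1 + B2) (fun z => h z + g z) (fun z => h1 z + g1 z).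
Proof.
move=> [H1 H2 H3 H4] [G1 G2 G3 G4]; split=> [z zr|z zr|z w zr wr|z w zr wr].
- by rewrite (le_trans (cabsD _ _)) // lerD ?H1 ?G1.
- by rewrite (le_trans (cabsD _ _)) // lerD ?H2 ?G2.
- by rewrite opprD addrACA (le_trans (cabsD _ _)) // mulrDl lerD ?H3 ?G3.
- have -> : h w + g w - (h z + g z) - (h1 z + g1 z) * (w - z) =
    (h w - h z - h1 z * (w - z)) + (g w - g z - g1 z * (w - z)) by ring.
  by rewrite (le_trans (cabsD _ _)) // mulrDl lerD ?H4 ?G4.
Qed.

Lemma C11M r B1 B2 h h1 g g1 : 0 <= r -> C11 r B1 h h1 -> C11 r B2 g g1 ->
  C11 r (3 * B1 * B2) (fun z => h z * g z) (fun z => h1 z * g z + h z * g1 z).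
Proof.
move=> r0 hh hg; have b1 := C11_ge0 r0 hh; have b2 := C11_ge0 r0 hg.
have b12 := mulr_ge0 b1 b2.
case: hh hg => [H1 H2 H3 H4] [G1 G2 G3 G4].
split=> [z zr|z zr|z w zr wr|z w zr wr].
- rewrite cabsM; have := ler_pM (cabs_ge0 _) (cabs_ge0 _) (H1 z zr) (G1 z zr); lra.
- rewrite (le_trans (cabsD _ _)) // !cabsM.
  have := ler_pM (cabs_ge0 _) (cabs_ge0 _) (H2 z zr) (G1 z zr).
  have := ler_pM (cabs_ge0 _) (cabs_ge0 _) (H1 z zr) (G2 z zr); lra.
- have -> : h w * g w - h z * g z = h w * (g w - g z) + (h w - h z) * g z by ring.
  rewrite (le_trans (cabsD _ _)) // !cabsM.
  have := ler_pM (cabs_ge0 _) (cabs_ge0 _) (H1 w wr) (G3 z w zr wr).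
  have := ler_pM (cabs_ge0 _) (cabs_ge0 _) (H3 z w zr wr) (G1 z zr).
  have := mulr_ge0 b12 (cabs_ge0 (w - z)); lra.
- have -> : h w * g w - h z * g z - (h1 z * g z + h z * g1 z) * (w - z) =
    h w * (g w - g z - g1 z * (w - z)) + (h w - h z - h1 z * (w - z)) * g z
    + (h w - h z) * (g1 z * (w - z)) by ring.
  rewrite (le_trans (cabsD _ _)) //.
  have := cabsD (h w * (g w - g z - g1 z * (w - z))) ((h w - h z - h1 z * (w - z)) * g z).
  have := ler_wpM2r (cabs_ge0 (w - z)) (G2 z zr).
  rewrite !cabsM => G2'.
  have := ler_pM (cabs_ge0 _) (cabs_ge0 _) (H1 w wr) (G4 z w zr wr).
  have := ler_pM (cabs_ge0 _) (cabs_ge0 _) (H4 z w zr wr) (G1 z zr).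
  have := ler_pM (cabs_ge0 _) (mulr_ge0 (cabs_ge0 _) (cabs_ge0 _)) (H3 z w zr wr) G2'.
  lra.
Qed.

Lemma C11V r B h h1 (d : R) : 0 <= r -> 0 < d -> C11 r B h h1 ->
  (forall z, unit_nbhd r z -> d <= cabs (h z)) ->
  C11 r (d^-1 + B / d ^+ 2 + B ^+ 2 / d ^+ 3) (fun z => (h z)^-1) (fun z => - h1 z / h z ^+ 2).
Proof.
move=> r0 d0 hh hd; have B0 := C11_ge0 r0 hh.
have nz z : unit_nbhd r z -> h z != 0 by move=> /hd h0; rewrite -cabs_gt0 (lt_le_trans d0).
have iv z : unit_nbhd r z -> cabs (h z)^-1 <= d^-1.
  by move=> zr; rewrite cabsV lef_pV2 ?posrE ?hd // (lt_le_trans d0) // hd.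
have i0 z : 0 <= cabs (h z)^-1 by exact: cabs_ge0.
have p1 : 0 <= d^-1 by rewrite invr_ge0 ltW.
have p2 : 0 <= B / d ^+ 2 by rewrite divr_ge0 // exprn_ge0 // ltW.
have p3 : 0 <= B ^+ 2 / d ^+ 3 by rewrite divr_ge0 ?exprn_ge0 // ltW.
have e2 : B / d ^+ 2 = B * (d^-1 * d^-1) by rewrite expr2 invfM.
have e3 : B ^+ 2 / d ^+ 3 = B ^+ 2 * (d^-1 * (d^-1 * d^-1)) by congr (_ * _); rewrite -exprVn exprS expr2.
case: hh => [H1 H2 H3 H4].
split=> [z zr|z zr|z w zr wr|z w zr wr].
- have := iv z zr; lra.
- rewrite cabsM cabsN expr2 invfM cabsM.
  have := ler_pM (cabs_ge0 _) (mulr_ge0 (i0 z) (i0 z)) (H2 z zr)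
    (ler_pM (i0 z) (i0 z) (iv z zr) (iv z zr)); lra.
- have -> : (h w)^-1 - (h z)^-1 = - ((h w - h z) * ((h w)^-1 * (h z)^-1)).
    by have := nz z zr; have := nz w wr => hw hz; field; rewrite hw hz.
  rewrite cabsN !cabsM.
  have := ler_pM (cabs_ge0 _) (mulr_ge0 (i0 w) (i0 z)) (H3 z w zr wr)
    (ler_pM (i0 w) (i0 z) (iv w wr) (iv z zr)).
  have := mulr_ge0 p1 (cabs_ge0 (w - z)); have := mulr_ge0 p3 (cabs_ge0 (w - z)); lra.
- have -> : (h w)^-1 - (h z)^-1 - - h1 z / h z ^+ 2 * (w - z) =
    - ((h w - h z - h1 z * (w - z)) * ((h z)^-1 * (h z)^-1))
    + (h w - h z) * (h w - h z) * ((h w)^-1 * ((h z)^-1 * (h z)^-1)).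
    by have := nz z zr; have := nz w wr => hw hz; field; rewrite hw hz.
  rewrite (le_trans (cabsD _ _)) // cabsN !cabsM.
  have := ler_pM (cabs_ge0 _) (mulr_ge0 (i0 z) (i0 z)) (H4 z w zr wr)
    (ler_pM (i0 z) (i0 z) (iv z zr) (iv z zr)).
  have := ler_pM (mulr_ge0 (cabs_ge0 (h w - h z)) (cabs_ge0 (h w - h z)))
    (mulr_ge0 (i0 w) (mulr_ge0 (i0 z) (i0 z)))
    (ler_pM (cabs_ge0 _) (cabs_ge0 _) (H3 z w zr wr) (H3 z w zr wr))
    (ler_pM (i0 w) (mulr_ge0 (i0 z) (i0 z)) (iv w wr) (ler_pM (i0 z) (i0 z) (iv z zr) (iv z zr))).
  have := mulr_ge0 p1 (exprn_ge0 2 (cabs_ge0 (w - z))); lra.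
Qed.

Lemma C11_comp r r' B Bf h h1 f f1 : 0 <= r -> 0 <= r' -> C11 r B h h1 -> C11 r' Bf f f1 ->
  (forall z, unit_nbhd r' z -> unit_nbhd r (f z)) ->
  C11 r' (B + B * Bf + B * Bf ^+ 2) (fun z => h (f z)) (fun z => h1 (f z) * f1 z).
Proof.
move=> r0 r'0 hh hf fr; have b := C11_ge0 r0 hh; have bf := C11_ge0 r'0 hf.
have q1 := mulr_ge0 b bf; have q2 := mulr_ge0 b (exprn_ge0 2 bf).
case: hh hf => [H1 H2 H3 H4] [F1 F2 F3 F4].
split=> [z zr|z zr|z w zr wr|z w zr wr].
- have := H1 _ (fr z zr); lra.
- rewrite cabsM; have := ler_pM (cabs_ge0 _) (cabs_ge0 _) (H2 _ (fr z zr)) (F2 _ zr); lra.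
- have := H3 _ _ (fr z zr) (fr w wr); have := ler_wpM2l b (F3 _ _ zr wr).
  have := cabs_ge0 (w - z) => D0; have := mulr_ge0 b D0; have := mulr_ge0 q2 D0; lra.
- have -> : h (f w) - h (f z) - h1 (f z) * f1 z * (w - z) =
    (h (f w) - h (f z) - h1 (f z) * (f w - f z)) + h1 (f z) * (f w - f z - f1 z * (w - z)) by ring.
  rewrite (le_trans (cabsD _ _)) // cabsM.
  have := H4 _ _ (fr z zr) (fr w wr).
  have := ler_pM (cabs_ge0 _) (cabs_ge0 _) (H2 _ (fr z zr)) (F4 _ _ zr wr).
  have D0 := exprn_ge0 2 (cabs_ge0 (w - z)); have := mulr_ge0 b D0.
  have : cabs (f w - f z) ^+ 2 <= (Bf * cabs (w - z)) ^+ 2.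
    by rewrite lerXn2r ?nnegrE ?cabs_ge0 ?mulr_ge0 ?cabs_ge0 // F3.
  move=> /(ler_wpM2l b); rewrite exprMn; lra.
Qed.

(** Pointwise convergence of the functions suffices. At a small fixed displacement the common
    quadratic remainder recovers the derivatives from values up to a small error, so [h1 m z] is
    Cauchy; all four bounds then pass to the limit. *)
Lemma C11_limit r B (h : nat -> R[i] -> R[i]) (h1 : nat -> R[i] -> R[i]) (g : R[i] -> R[i]) :
  0 <= r -> (forall m, C11 r B (h m) (h1 m)) ->
  (forall z, unit_nbhd r z -> ccvg (fun m => h m z) (g z)) ->
  exists2 g1, C11 r B g g1 & forall z, unit_nbhd r z -> ccvg (fun m => h1 m z) (g1 z).
Proof.
move=> r0 hC hg; have B0 := C11_ge0 r0 (hC 0%N).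
have lim z : unit_nbhd r z -> exists l, ccvg (fun m => h1 m z) l.
  move=> zr; apply: ccvg_complete => e e0.
  (* The radius may be 0, so the direction of displacement points to 0 or to 1, and convexity keeps
     the segment in the neighbourhood. *)
  have [y yr yz] : exists2 y, unit_nbhd r y & y != z.
    have [z0|z0] := eqVneq z 0; last by exists 0; [exact: unit_nbhd0 | rewrite eq_sym].
    by exists 1; rewrite ?z0 ?oner_eq0 //; apply: unit_nbhd_real; rewrite ?ler01 ?lexx.
  pose D := cabs (y - z); have D0 : 0 < D by rewrite cabs_gt0 subr_eq0.
  pose s := Num.min 1 (e / (4 * (B + 1) * D)).
  have B1 : 0 < B + 1 by lra.
  have bD : 0 < 4 * (B + 1) * D by rewrite !mulr_gt0.
  have s0 : 0 < s by rewrite lt_min ltr01 divr_gt0.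
  have s1 : s <= 1 by rewrite ge_min lexx.
  have se : s * (4 * (B + 1) * D) <= e by rewrite -ler_pdivlMr // ge_min lexx orbT.
  pose w := z + s%:C%C * (y - z).
  have wr : unit_nbhd r w by apply: unit_nbhd_convex; rewrite // ltW.
  have wz : w - z = s%:C%C * (y - z) by rewrite /w addrC addKr.
  have cw : cabs (w - z) = s * D by rewrite wz cabsM cabs_real gtr0_norm.
  have sD : 0 < s * D by rewrite mulr_gt0.
  have eta0 : 0 < e * (s * D) / 8 by rewrite divr_gt0 // mulr_gt0.
  have [N1 hN1] := hg z zr _ eta0; have [N2 hN2] := hg w wr _ eta0.
  exists (maxn N1 N2) => m n; rewrite !geq_max => /andP[m1 m2] /andP[n1 n2].
  have [_ _ _ Hm] := hC m; have [_ _ _ Hn] := hC n.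
  have {}Hm := Hm z w zr wr; have {}Hn := Hn z w zr wr.
  have := hN1 _ m1; have := hN1 _ n1; have := hN2 _ m2; have := hN2 _ n2 => q1 q2 q3 q4.
  rewrite -(ler_pM2r sD) -cw -cabsM.
  have -> : (h1 m z - h1 n z) * (w - z) =
    - (h m w - h m z - h1 m z * (w - z)) + (h n w - h n z - h1 n z * (w - z))
    + ((h m w - g w) + - (h n w - g w)) + (- (h m z - g z) + (h n z - g z)) by ring.
  apply: (le_trans (cabsD _ _)); apply: (le_trans (lerD (cabsD _ _) (cabsD _ _))).
  apply: (le_trans (lerD (lerD (cabsD _ _) (cabsD _ _)) (lexx _))).
  rewrite !cabsN; rewrite cw in Hm Hn *.
  have : B * (s * D) ^+ 2 <= e * (s * D) / 4.
    have : 0 <= s * D * (s * D) by rewrite mulr_ge0 // ltW.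
    have := ler_wpM2r (ltW sD) se; rewrite expr2; lra.
  lra.
pose g1 z := if pselect (unit_nbhd r z) is left zr then sval (cid (lim z zr)) else 0.
have hg1 z : unit_nbhd r z -> ccvg (fun m => h1 m z) (g1 z).
  by move=> zr; rewrite /g1; case: pselect => // zr'; case: cid.
exists g1 => //; split=> [z zr|z zr|z w zr wr|z w zr wr].
- by apply: ccvg_le (hg z zr) _ => m; have [H _ _ _] := hC m; exact: H.
- by apply: ccvg_le (hg1 z zr) _ => m; have [_ H _ _] := hC m; exact: H.
- by apply: ccvg_le (ccvgB (hg w wr) (hg z zr)) _ => m; have [_ _ H _] := hC m; exact: H.
- apply: ccvg_le (ccvgB (ccvgB (hg w wr) (hg z zr)) (ccvgM (hg1 z zr) (ccvg_cst (w - z)))) _.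
  by move=> m; have [_ _ _ H] := hC m; exact: H.
Qed.
End C11.

(** * Cauchy sums as smooth approximations *)

Section Smoothing.
Context (R : realType).
Implicit Types (z w : R[i]) (r B e : R) (h f g : R[i] -> R[i]).

Lemma inv_succ_small (A e : R) : 0 < e -> exists N, forall n, (N <= n)%N -> A / n.+1%:R <= e.
Proof.
move=> e0; exists (Num.bound (`|A| / e)) => n Nn.
rewrite ler_pdivrMr ?ltr0n // -ler_pdivrMl // mulrC.
apply: (@le_trans _ _ (`|A| / e)); first by rewrite ler_pM2r ?invr_gt0 // ler_norm.
rewrite ltW // (lt_le_trans (archi_boundP _)) ?divr_ge0 ?(ltW e0) //.
by rewrite ler_nat ltnW.
Qed.

Lemma node_dist r r' m (k : edge m) z : 0 < r -> unit_nbhd r' z -> r - r' <= cabs (node r k - z).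
Proof.
move=> r0 [x x01 hx]; have := node_far r0 k x01.
by have := cabs_subD (node r k) x%:C%C z; rewrite [cabs (_ - z)]cabsB; lra.
Qed.

Definition winding_min r : R := r / (1 + r) ^+ 2.

Lemma winding_min_gt0 r : 0 < r -> 0 < winding_min r.
Proof. by move=> r0; rewrite divr_gt0 // exprn_gt0 // addr_gt0. Qed.

(* Cauchy's formula with [winding r m 0] in place of 2 pi i. *)
Definition cauchy_type r m (kap : edge m -> R[i]) z : R[i] :=
  (winding r m 0)^-1 * \sum_(k : edge m) kap k * (step r k / (node r k - z)).

Definition cauchy_type1 r m (kap : edge m -> R[i]) z : R[i] :=
  (winding r m 0)^-1 * \sum_(k : edge m) kap k * (step r k / (node r k - z) ^+ 2).

(** Stated for a family [Fam] so that [N] is uniform over it: the traces involve a different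
    function for every node of every polygon. *)
Lemma cauchy_approx r r' B (Fam : (R[i] -> R[i]) -> (R[i] -> R[i]) -> Prop) :
  0 < r' -> r' < r ->
  (forall e, 0 < e -> exists2 del : R, 0 < del & forall h h1, Fam h h1 -> unif_diff r e del h h1) ->
  (forall h h1 z, Fam h h1 -> unit_nbhd r' z -> cabs (h z) <= B) ->
  forall e, 0 < e -> exists N, forall m, (N <= m)%N -> forall h h1 z, Fam h h1 -> unit_nbhd r' z ->
    cabs (cauchy_type r (fun k : edge m => h (node r k)) z - h z) <= e.
Proof.
move=> r'0 r'r hU hB e e0; have r0 := lt_trans r'0 r'r.
pose L := contour_length r; have L0 : 0 < L by exact: contour_length_gt0.
pose w0 := winding_min r; have w00 : 0 < w0 by exact: winding_min_gt0.
have e1 : 0 < e * w0 / (4 * L) by apply: divr_gt0; apply: mulr_gt0.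
have [del d0 hd] := hU _ e1.
pose K := (1 + 4 * r) * L / (r - r') ^+ 3.
have d20 : 0 < del / 2 by rewrite divr_gt0.
have [N1 h1] := inv_succ_small (1 + 4 * r) d20.
have e20 : 0 < e * w0 / 2 by apply: divr_gt0 => //; apply: mulr_gt0.
have [N2 h2] := inv_succ_small (`|B| * K * (1 + r')) e20.
exists (maxn N1 N2) => m; rewrite geq_max => /andP[/h1 m1 /h2 m2] h hp z hF zr'.
have zr : unit_nbhd r z by apply: unit_nbhdW zr'; exact: ltW.
have nz (k : edge m) : node r k != z.
  rewrite -subr_eq0 -cabs_gt0 (lt_le_trans _ (node_dist k r0 zr')) //.
  by rewrite subr_gt0.
have mesh : (1 + 4 * r) / m.+1%:R < del by rewrite (le_lt_trans m1) // gtr_pMr // invf_lt1 // ltr1n.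
have C := cauchy_sum r0 (ltW e1) d0 mesh (hd _ _ hF) zr nz.
have W := winding_const m r'0 r'r (unit_nbhd0 (ltW r'0)) zr'.
have w0W : w0 <= cabs (winding r m 0) by exact: winding_ge.
have Wn0 : winding r m 0 != 0 by rewrite -cabs_gt0 (lt_le_trans w00).
rewrite -(ler_pM2l w00); apply: (@le_trans _ _ (cabs (winding r m 0) *
  cabs (cauchy_type r (fun k : edge m => h (node r k)) z - h z))).
  by rewrite ler_wpM2r // cabs_ge0.
rewrite -cabsM.
have -> : winding r m 0 * (cauchy_type r (fun k : edge m => h (node r k)) z - h z) =
   (\sum_(k : edge m) h (node r k) * (step r k / (node r k - z)) - h z * winding r m z)
   + h z * (winding r m z - winding r m 0).
  by rewrite /cauchy_type mulrBr mulrA mulfV // mul1r; ring.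
rewrite (le_trans (cabsD _ _)) // cabsM.
have hb : cabs (h z) <= `|B| by rewrite (le_trans (hB _ _ _ hF zr')) // ler_norm.
have K0 : 0 <= K.
  apply: divr_ge0; last by rewrite exprn_ge0 // subr_ge0 ltW.
  by apply: mulr_ge0 (ltW L0); rewrite addr_ge0 // mulr_ge0 // ltW.
have W' : cabs (winding r m z - winding r m 0) <= K / m.+1%:R * (1 + r').
  apply: (le_trans W); rewrite subr0 -/L -/K; apply: ler_wpM2l; first exact: divr_ge0.
  exact: unit_nbhd_cabs.
have p := ler_pM (cabs_ge0 _) (cabs_ge0 _) hb W'.
have E : 2 * (e * w0 / (4 * L)) * contour_length r = e * w0 / 2.
  by rewrite -/L; field; rewrite gt_eqF.
have E2 : `|B| * (K / m.+1%:R * (1 + r')) = `|B| * K * (1 + r') / m.+1%:R by ring.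
rewrite E in C; rewrite E2 in p; apply: (le_trans (lerD C (le_trans p m2))).
by rewrite -splitr mulrC.
Qed.

(** The nodes stay at distance [r - r'] from the smaller neighbourhood and the total length of the
    steps is bounded, so [B] depends neither on [m] nor on the density. *)
Lemma cauchy_type_C11 r r' K : 0 < r' -> r' < r -> 0 <= K ->
  exists B, forall m (kap : edge m -> R[i]), (forall k, cabs (kap k) <= K) ->
    C11 r' B (cauchy_type r kap) (cauchy_type1 r kap).
Proof.
move=> r'0 r'r K0; have r0 := lt_trans r'0 r'r.
pose L := contour_length r; have L0 : 0 < L by exact: contour_length_gt0.
pose w0 := winding_min r; have w00 : 0 < w0 by exact: winding_min_gt0.
pose d := r - r'; have d0 : 0 < d by rewrite subr_gt0.
have iL : 0 <= w0^-1 * (K * L).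
  by apply: mulr_ge0 (mulr_ge0 K0 (ltW L0)); rewrite invr_ge0 ltW.
have p1 : 0 <= d^-1 by rewrite invr_ge0 ltW.
pose S := d^-1 + d^-1 * d^-1 + d^-1 * (d^-1 * d^-1).
have S1 : d^-1 <= S by rewrite /S -addrA lerDl; nra.
have S2 : d^-1 * d^-1 <= S by have := mulr_ge0 p1 (mulr_ge0 p1 p1); rewrite /S; lra.
have S3 : d^-1 * (d^-1 * d^-1) <= S by have := mulr_ge0 p1 p1; rewrite /S; lra.
exists (w0^-1 * (K * L) * S) => m kap hk.
have w0W : w0 <= cabs (winding r m 0) by exact: winding_ge.
have iW : cabs (winding r m 0)^-1 <= w0^-1.
  by rewrite cabsV lef_pV2 ?posrE // (lt_le_trans w00).
have bound (F : edge m -> R[i]) (Q T : R) : 0 <= T -> Q <= S -> (forall k, cabs (F k) <= Q * T) ->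
    cabs ((winding r m 0)^-1 * \sum_(k : edge m) kap k * (step r k * F k)) <= w0^-1 * (K * L) * S * T.
  move=> T0 QS hF.
  have ST : Q * T <= S * T by rewrite ler_wpM2r.
  have S0 : 0 <= S by apply: le_trans S1.
  have -> : w0^-1 * (K * L) * S * T = w0^-1 * (K * (S * T) * L) by ring.
  rewrite cabsM; apply: ler_pM => //; try exact: cabs_ge0.
  apply: (le_trans (cabs_sum _ _ _)).
  apply: (@le_trans _ _ (\sum_(k : edge m) K * (S * T) * cabs (step r k))).
    apply: ler_sum => k _; rewrite !cabsM -mulrA ler_pM ?mulr_ge0 ?cabs_ge0 //.
    by rewrite mulrC ler_wpM2r ?cabs_ge0 // (le_trans (hF k)).
  rewrite -mulr_sumr; apply: ler_wpM2l; last exact: sum_step_le.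
  by apply: mulr_ge0 => //; exact: mulr_ge0.
have far z (k : edge m) : unit_nbhd r' z -> d <= cabs (node r k - z).
  by move=> zr; exact: node_dist zr.
have iv z (k : edge m) : unit_nbhd r' z -> cabs (node r k - z)^-1 <= d^-1.
  by move=> zr; have h := far z k zr; rewrite cabsV lef_pV2 ?posrE // (lt_le_trans d0).
have nz z (k : edge m) : unit_nbhd r' z -> node r k - z != 0.
  by move=> zr; have h := far z k zr; rewrite -cabs_gt0 (lt_le_trans d0).
split=> [z zr|z zr|z w zr wr|z w zr wr].
- rewrite -[leRHS]mulr1; apply: (bound (fun k => (node r k - z)^-1) d^-1) => // k.
  by rewrite mulr1 iv.
- rewrite -[leRHS]mulr1; apply: (bound (fun k => (node r k - z)^-2) (d^-1 * d^-1)) => // k.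
  by rewrite mulr1 expr2 invfM cabsM ler_pM ?cabs_ge0 ?iv.
- have -> : cauchy_type r kap w - cauchy_type r kap z = (winding r m 0)^-1 *
     \sum_(k : edge m) kap k * (step r k * ((w - z) * ((node r k - w)^-1 * (node r k - z)^-1))).
    rewrite /cauchy_type -mulrBr -sumrB; congr (_ * _); apply: eq_bigr => k _.
    by have := nz _ k wr; have := nz _ k zr => h1 h2; field; rewrite h1 h2.
  apply: bound S2 _ => [|k]; first exact: cabs_ge0.
  by rewrite !cabsM mulrC ler_wpM2r ?cabs_ge0 // ler_pM ?cabs_ge0 ?iv.
- have -> : cauchy_type r kap w - cauchy_type r kap z - cauchy_type1 r kap z * (w - z) =
     (winding r m 0)^-1 * \sum_(k : edge m) kap k * (step r k *
       ((w - z) * (w - z) * ((node r k - w)^-1 * ((node r k - z)^-1 * (node r k - z)^-1)))).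
    rewrite /cauchy_type /cauchy_type1 -mulrBr -mulrA -mulrBr -sumrB mulr_suml -sumrB.
    congr (_ * _); apply: eq_bigr => k _.
    by have := nz _ k wr; have := nz _ k zr => h1 h2; field; rewrite h1 h2.
  apply: bound S3 _ => [|k]; first by rewrite exprn_ge0 // cabs_ge0.
  rewrite !cabsM mulrC expr2 ler_wpM2r ?mulr_ge0 ?cabs_ge0 //.
  by rewrite !ler_pM ?mulr_ge0 ?cabs_ge0 ?iv.
Qed.

(** Cauchy sums of [h] converge pointwise with common [C11] bounds, so [h] inherits them. The same
    argument for the difference quotient at [z0] makes its singularity removable. *)
Lemma smoothing r r' B h h1 : 0 < r' -> r' < r ->
  (forall e, 0 < e -> exists2 del : R, 0 < del & unif_diff r e del h h1) ->
  (forall z, unit_nbhd r z -> cabs (h z) <= B) ->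
  exists h2 B2, C11 r' B2 h h2 /\
    forall z0, unit_nbhd r' z0 -> exists G G1 B3, [/\ C11 r' B3 G G1,
      forall z, unit_nbhd r' z -> h z - h z0 = G z * (z - z0) & G z0 = h2 z0].
Proof.
move=> r'0 r'r hU hB; have r0 := lt_trans r'0 r'r.
have B0 : 0 <= B by apply: le_trans (hB 0 (unit_nbhd0 (ltW r0))); exact: cabs_ge0.
have d0 : 0 < r - r' by rewrite subr_gt0.
have conv1 z : unit_nbhd r' z ->
    ccvg (fun m => cauchy_type r (fun k : edge m => h (node r k)) z) (h z).
  move=> zr e e0.
  have [|//|N hN] := @cauchy_approx r r' B (fun f f1 => f = h /\ f1 = h1) r'0 r'r _ _ e e0.
  - by move=> e1 /hU[del del0 hd]; exists del => // _ _ [-> ->].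
  - by move=> _ _ u [-> _] ur; apply: hB; apply: unit_nbhdW ur; exact: ltW.
  - by exists N => m /hN; apply.
have [B2 hB2] := cauchy_type_C11 r'0 r'r B0.
have [h2 hh2 cv2] := @C11_limit _ r' B2 (fun m => cauchy_type r (fun k : edge m => h (node r k)))
  (fun m => cauchy_type1 r (fun k : edge m => h (node r k))) h (ltW r'0)
  (fun m => hB2 m _ (fun k => hB _ (node_nbhd r0 k))) conv1.
exists h2, B2; split=> // z0 z0r.
have far z m (k : edge m) : unit_nbhd r' z -> r - r' <= cabs (node r k - z).
  by move=> zr; exact: node_dist zr.
have nz z m (k : edge m) : unit_nbhd r' z -> node r k - z != 0.
  by move=> zr; have hk := far z m k zr; rewrite -cabs_gt0 (lt_le_trans d0).
(* With this density the Cauchy sum is exactly the difference quotient of the Cauchy sum of [h], and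
   at [z0] its derivative sum, so convergence is already known. *)
pose kap m (k : edge m) := h (node r k) / (node r k - z0).
pose G z := if z == z0 then h2 z0 else (h z - h z0) / (z - z0).
have K0 : 0 <= B / (r - r') by rewrite divr_ge0 // ltW.
have kapK m (k : edge m) : cabs (kap m k) <= B / (r - r').
  rewrite cabsM cabsV ler_pM ?cabs_ge0 ?invr_ge0 ?cabs_ge0 ?hB //; first exact: node_nbhd.
  by rewrite lef_pV2 ?posrE ?far // (lt_le_trans d0) ?far.
have [B3 hB3] := cauchy_type_C11 r'0 r'r K0.
have convG z : unit_nbhd r' z -> ccvg (fun m => cauchy_type r (kap m) z) (G z).
  move=> zr; rewrite /G; case: eqVneq => [->|zz0].
    apply: eq_ccvg (cv2 z0 z0r) => m; congr (_ * _); apply: eq_bigr => k _.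
    by rewrite /kap; have := nz _ _ k z0r => hk; field; rewrite hk.
  apply: eq_ccvg (ccvgM (ccvgB (conv1 z zr) (conv1 z0 z0r)) (ccvg_cst (z - z0)^-1)) => m.
  rewrite /cauchy_type -mulrBr -sumrB -mulrA mulr_suml; congr (_ * _); apply: eq_bigr => k _.
  rewrite /kap; have := nz _ _ k z0r; have := nz _ _ k zr => hk hk0.
  by field; rewrite hk hk0 subr_eq0 zz0.
have [G1 hG1 _] := @C11_limit _ r' B3 (fun m => cauchy_type r (kap m))
  (fun m => cauchy_type1 r (kap m)) G (ltW r'0) (fun m => hB3 m _ (kapK m)) convG.
exists G, G1, B3; split=> //; last by rewrite /G eqxx.
move=> z zr; rewrite /G; case: eqVneq => [->|zz0]; first by rewrite !subrr mulr0.
by rewrite mulfVK // subr_eq0.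
Qed.
End Smoothing.

(** * Discretized transfer operator *)

Lemma sum_tuple_cons (V : nmodType) (T : finType) n (F : seq T -> V) :
  \sum_(w : n.+1.-tuple T) F w = \sum_x \sum_(w : n.-tuple T) F (x :: w).
Proof.
rewrite pair_bigA /= (reindex (fun q : T * n.-tuple T => [tuple of q.1 :: q.2])) /=.
  by apply: eq_bigr => -[x w] _.
exists (fun w : n.+1.-tuple T => (thead w, [tuple of behead w])) => [[x w]|w] _ /=.
  by congr pair; apply: val_inj.
by rewrite [RHS]tuple_eta; apply: val_inj.
Qed.

Section KernelPowers.
Context (F : comNzRingType) (T : finType).
Implicit Types L B : T -> T -> F.

Lemma kmulA L B Q x y : kmul L (kmul B Q) x y = kmul (kmul L B) Q x y.
Proof.
rewrite /kmul; under eq_bigr do rewrite mulr_sumr.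
rewrite exchange_big; apply: eq_bigr => z _; rewrite mulr_suml.
by apply: eq_bigr => u _; rewrite mulrA.
Qed.

Lemma iter_kmulS L B n x y :
  iter n.+1 (kmul L) B x y = kmul (iter n (kmul L) L) B x y.
Proof.
elim: n x y => [//|n IH] x y.
rewrite iterS {1}/kmul (eq_bigr (fun z => L x z * kmul (iter n (kmul L) L) B z y)).
  exact: kmulA.
by move=> z _; rewrite IH.
Qed.

(** Cyclicity of the trace moves the multiplication by [g] outside, leaving the diagonal of a power
    of [L]. *)
Lemma ktr_iter_scaled L (g : T -> F) n :
  ktr (iter n (kmul L) (fun x y => g x * L x y)) =
    \sum_x g x * iter n (kmul L) L x x.
Proof.
case: n => [//|n].
transitivity (ktr (kmul (iter n (kmul L) L) (fun x y => g x * L x y))).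
  by apply: eq_bigr => x _; exact: iter_kmulS.
rewrite ktr_kmulC; apply: eq_bigr => x _; rewrite iterS /kmul mulr_sumr.
by apply: eq_bigr => y _; rewrite mulrA.
Qed.

Definition kapp L (v : T -> F) : T -> F := fun x => \sum_y L x y * v y.

Lemma iter_kapp L B n x y : iter n (kmul L) B x y = iter n (kapp L) (B^~ y) x.
Proof.
elim: n x => [//|n IH] x; rewrite !iterS; apply: eq_bigr => z _.
by rewrite IH.
Qed.

Lemma iter_kappZ L v a n x : iter n (kapp L) (fun x => a * v x) x = a * iter n (kapp L) v x.
Proof.
elim: n x => [//|n IH] x; rewrite !iterS /kapp mulr_sumr; apply: eq_bigr => z _.
by rewrite IH mulrCA.
Qed.
End KernelPowers.

(** * Words and powers of the transfer operator *)

Section Words.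
Context (R : realType) (N : nat) (p : 'I_N -> R) (fc fc1 : 'I_N -> R[i] -> R[i]).
Implicit Types (z w : R[i]) (h g : R[i] -> R[i]).

Fixpoint cword (s : seq 'I_N) z : R[i] := if s is i :: s' then fc i (cword s' z) else z.
Fixpoint dcword (s : seq 'I_N) z : R[i] :=
  if s is i :: s' then fc1 i (cword s' z) * dcword s' z else 1.

Lemma cword_cat s s' z : cword (s ++ s') z = cword s (cword s' z).
Proof. by elim: s => //= i s ->. Qed.

Lemma dcword_cat s s' z : dcword (s ++ s') z = dcword s (cword s' z) * dcword s' z.
Proof. by elim: s => [|i s IH] /=; rewrite ?mul1r // IH cword_cat mulrA. Qed.

Definition transfer h z : R[i] := \sum_k (p k)%:C%C * h (fc k z).

Lemma iter_transfer n h z : iter n transfer h z =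
  \sum_(s : n.-tuple 'I_N) (word_weight p s)%:C%C * h (cword s z).
Proof.
elim: n h z => [|n IH] h z.
  rewrite (big_pred1 [tuple]) /=; last by move=> t; apply/esym/eqP; exact: tuple0.
  by rewrite /word_weight big_nil rmorph1 mul1r.
rewrite iterSr IH (sum_tuple_cons n (fun s => (word_weight p s)%:C%C * h (cword s z))).
rewrite exchange_big /=; apply: eq_bigr => s _; rewrite /transfer mulr_sumr.
apply: eq_bigr => k _; rewrite /word_weight big_cons rmorphM /=.
by rewrite mulrCA mulrA.
Qed.
End Words.

(** * Convergence of the traces *)

Section Transfer.
Context (R : realType) (N : nat) (p : 'I_N -> R) (fc fc1 : 'I_N -> R[i] -> R[i]) (r c Bf : R).
Context (p0 : forall i, 0 <= p i) (p1 : \sum_i p i = 1).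
Context (r0 : 0 < r) (c0 : 0 < c) (c1 : c < 1).
Context (f_real : forall i (x : R), 0 <= x <= 1 -> exists2 y : R, 0 <= y <= 1 & fc i x%:C%C = y%:C%C).
Context (f_lip : forall i z w, unit_nbhd r z -> unit_nbhd r w ->
  cabs (fc i w - fc i z) <= c * cabs (w - z)).
Context (f_C11 : forall i, C11 r Bf (fc i) (fc1 i)).
Implicit Types (z w : R[i]) (h g : R[i] -> R[i]).

Local Notation cword := (cword fc).
Local Notation dcword := (dcword fc fc1).
Local Notation transfer := (transfer p fc).

(** A nearby point of [0, 1] is sent into [0, 1], so contraction of distances shrinks the
    neighbourhood itself. *)
Lemma f_nbhd rho i z : rho <= r -> unit_nbhd rho z -> unit_nbhd (c * rho) (fc i z).
Proof.
move=> rr [x x01 hx]; have [y y01 fy] := f_real i x01; exists y => //.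
have rho0 : 0 <= rho by apply: le_trans hx; exact: cabs_ge0.
rewrite -fy (le_trans (f_lip _ (unit_nbhd_real (ltW r0) x01) _)) //; last first.
  by rewrite ler_pM2l.
by exists x => //; exact: le_trans rr.
Qed.

Lemma f_nbhd_c i z : unit_nbhd r z -> unit_nbhd (c * r) (fc i z).
Proof. exact: f_nbhd. Qed.

Lemma cr_lt : c * r < r. Proof. by rewrite gtr_pMl. Qed.
Lemma cr_gt0 : 0 < c * r. Proof. by rewrite mulr_gt0. Qed.

Lemma f_nbhd_r i z : unit_nbhd r z -> unit_nbhd r (fc i z).
Proof. by move=> /(f_nbhd_c i); apply: unit_nbhdW; rewrite ltW // cr_lt. Qed.

Lemma cword_nbhd s z : unit_nbhd r z -> unit_nbhd r (cword s z).
Proof. by move=> zr; elim: s => //= i s; exact: f_nbhd_r. Qed.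

Lemma cword_lip s z w : unit_nbhd r z -> unit_nbhd r w ->
  cabs (cword s w - cword s z) <= c ^+ size s * cabs (w - z).
Proof.
move=> zr wr; elim: s => [|i s IH] /=; first by rewrite expr0 mul1r.
apply: (le_trans (f_lip _ (cword_nbhd s zr) (cword_nbhd s wr))).
by rewrite exprS -mulrA ler_pM2l.
Qed.

Lemma cword_C11 s : exists B, C11 r B (cword s) (dcword s).
Proof.
elim: s => [|i s [B hB]] /=; first by exists (1 + r); apply: C11_id; exact: ltW.
eexists; apply: (C11_comp (ltW r0) (ltW r0) (f_C11 i) hB).
by move=> z; exact: cword_nbhd.
Qed.

Lemma sum_weights_le (F : 'I_N -> R[i]) (B : R) : (forall k, cabs (F k) <= B) ->
  cabs (\sum_k (p k)%:C%C * F k) <= B.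
Proof.
move=> hF; apply: (le_trans (cabs_sum _ _ _)).
apply: (@le_trans _ _ (\sum_k p k * B)); last by rewrite -mulr_suml p1 mul1r.
by apply: ler_sum => k _; rewrite cabsM cabs_real ger0_norm // ler_wpM2l.
Qed.

Lemma C11_average B (h h1 : 'I_N -> R[i] -> R[i]) : (forall k, C11 r B (h k) (h1 k)) ->
  C11 r B (fun z => \sum_k (p k)%:C%C * h k z) (fun z => \sum_k (p k)%:C%C * h1 k z).
Proof.
move=> hC; split=> [z zr|z zr|z w zr wr|z w zr wr].
- by apply: sum_weights_le => k; have [H _ _ _] := hC k; exact: H.
- by apply: sum_weights_le => k; have [_ H _ _] := hC k; exact: H.
- rewrite -sumrB; under eq_bigr do rewrite -mulrBr.
  by apply: sum_weights_le => k; have [_ _ H _] := hC k; exact: H.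
- rewrite mulr_suml -!sumrB.
  rewrite (eq_bigr (fun k => (p k)%:C%C * (h k w - h k z - h1 k z * (w - z)))).
    by apply: sum_weights_le => k; have [_ _ _ H] := hC k; exact: H.
  by move=> k _; ring.
Qed.

Lemma transfer_C11 rho B : c * r <= rho -> exists B', forall h h1,
  C11 rho B h h1 -> exists h2, C11 r B' (transfer h) h2.
Proof.
move=> crho; have rho0 : 0 <= rho by apply: le_trans crho; exact: ltW cr_gt0.
exists (B + B * Bf + B * Bf ^+ 2) => h h1 hh; eexists; apply: C11_average => k.
apply: (C11_comp rho0 (ltW r0) hh (f_C11 k)) => z /(f_nbhd_c k).
exact: unit_nbhdW.
Qed.

Lemma iter_transfer_C11 n B : exists B', forall h h1,
  C11 r B h h1 -> exists h2, C11 r B' (iter n transfer h) h2.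
Proof.
elim: n => [|n [B' hB']]; first by exists B => h h1 hh; exists h1.
have [B2 hB2] := transfer_C11 B' (ltW cr_lt).
by exists B2 => h h1 /hB'[h2 /hB2].
Qed.

Definition resolvent z : R[i] -> R[i] := fun u => (z - u)^-1.

(** The resolvent has its pole on the contour, but one application of [transfer] evaluates it only
    at distance at least [r - c * r] from the pole. This makes it regular on the whole
    neighbourhood, uniformly in the node. *)
Lemma transfer_resolvent_C11 : exists B, forall m (k : edge m), exists h2,
  C11 r B (transfer (resolvent (node r k))) h2.
Proof.
have d0 : 0 < r - c * r by rewrite subr_gt0 cr_lt.
have [B hB] := @transfer_C11 (c * r) ((r - c * r)^-1 + (1 + r + (1 + c * r)) / (r - c * r) ^+ 2 +
   (1 + r + (1 + c * r)) ^+ 2 / (r - c * r) ^+ 3) (lexx _).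
exists B => m k; apply: hB.
apply: (C11V (h := fun u => node r k - u) (h1 := fun=> 0 - 1) (ltW cr_gt0) d0); last first.
  by move=> z; exact: node_dist.
have H1 := C11_cst (c * r) (node r k).
split=> [z zr|z _|z w _ _|z w _ _].
- rewrite (le_trans (cabsD _ _)) // cabsN lerD ?(unit_nbhd_cabs zr) //.
  exact: unit_nbhd_cabs (node_nbhd r0 k).
- by rewrite sub0r cabsN cabs1 -addrA lerDl; have := cr_gt0; lra.
- have -> : node r k - w - (node r k - z) = z - w by ring.
  by rewrite cabsB ler_peMl ?cabs_ge0 //; have := cr_gt0; lra.
- have -> : node r k - w - (node r k - z) - (0 - 1) * (w - z) = 0 by ring.
  by rewrite cabs0 mulr_ge0 ?exprn_ge0 ?cabs_ge0 //; have := cr_gt0; lra.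
Qed.

Lemma cauchy_type_le m (kap : edge m -> R[i]) K z : 0 <= K -> (forall k, cabs (kap k) <= K) ->
  unit_nbhd (c * r) z ->
  cabs (cauchy_type r kap z) <= K * (contour_length r / winding_min r / (r - c * r)).
Proof.
move=> K0 hk zr; have d0 : 0 < r - c * r by rewrite subr_gt0 cr_lt.
have w00 := winding_min_gt0 r0; have w0W : winding_min r <= cabs (winding r m 0) by exact: winding_ge.
have -> : K * (contour_length r / winding_min r / (r - c * r)) =
  (winding_min r)^-1 * (K / (r - c * r) * contour_length r) by ring.
rewrite /cauchy_type cabsM; apply: ler_pM; try exact: cabs_ge0.
  by rewrite cabsV lef_pV2 ?posrE // (lt_le_trans w00).
apply: (le_trans (cabs_sum _ _ _)).
apply: (@le_trans _ _ (\sum_(k : edge m) K / (r - c * r) * cabs (step r k))); last first.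
  rewrite -mulr_sumr; apply: ler_wpM2l; last exact: sum_step_le.
  by rewrite divr_ge0 // ltW.
apply: ler_sum => k _; rewrite !cabsM cabsV mulrCA mulrC.
rewrite ler_wpM2r ?cabs_ge0 // ler_pM ?cabs_ge0 ?invr_ge0 ?cabs_ge0 //.
have h := node_dist k r0 zr.
by rewrite lef_pV2 ?posrE // (lt_le_trans d0).
Qed.

(* Nystrom matrix of [transfer]: apply Cauchy's formula to [h (fc k z)] and
   sample at the nodes. *)
Definition Lker m (i j : edge m) : R[i] :=
  (winding r m 0)^-1 * \sum_k (p k)%:C%C * (step r j / (node r j - fc k (node r i))).

Lemma kapp_Lker m (v : edge m -> R[i]) i :
  kapp (@Lker m) v i = \sum_k (p k)%:C%C * cauchy_type r v (fc k (node r i)).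
Proof.
rewrite /kapp /Lker /cauchy_type; under eq_bigr do rewrite mulr_sumr mulr_suml.
rewrite exchange_big; apply: eq_bigr => k _ /=; rewrite !mulr_sumr.
by apply: eq_bigr => j _; ring.
Qed.

(** The new error is a Cauchy error for the smooth iterate plus the previous error times the
    operator bound [Kop], which is independent of [m]. *)
Lemma iter_kapp_approx n B (e : R) : 0 < e -> exists M, forall m, (M <= m)%N ->
  forall h h1 (i : edge m), C11 r B h h1 ->
  cabs (iter n (kapp (@Lker m)) (fun k => h (node r k)) i - iter n transfer h (node r i)) <= e.
Proof.
elim: n e => [|n IH] e e0; first by exists 0%N => m _ h h1 i _; rewrite subrr cabs0 ltW.
have [B' hB'] := iter_transfer_C11 n B.
pose Kop := contour_length r / winding_min r / (r - c * r).
have Kop0 : 0 < Kop.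
  apply: divr_gt0; last by rewrite subr_gt0 cr_lt.
  by apply: divr_gt0; [exact: contour_length_gt0 | exact: winding_min_gt0].
have e1 : 0 < e / 2 / Kop by do 2 apply: divr_gt0 => //.
have e2 : 0 < e / 2 by rewrite divr_gt0.
have [M1 hM1] := IH _ e1.
have [||M2 hM2] := @cauchy_approx R r (c * r) B' (fun h h1 => C11 r B' h h1) cr_gt0 cr_lt _ _ _ e2.
- move=> e' e'0; have [B0|B0] := leP 0 B'; last first.
    by exists 1 => // h h1 /(C11_ge0 (ltW r0)); rewrite leNgt B0.
  exists (e' / (B' + 1)); first by rewrite divr_gt0 // ltr_wpDl.
  by move=> h h1 hh; exact: C11_unif_diff (ltW r0) e'0 hh.
- move=> h h1 z [H _ _ _] zr; apply: H; apply: unit_nbhdW zr; exact: ltW cr_lt.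
exists (maxn M1 M2) => m; rewrite geq_max => /andP[/hM1 m1 /hM2 m2] h h1 i hh.
have [h2 hh2] := hB' _ _ hh.
rewrite !iterS kapp_Lker /transfer -sumrB.
set v := iter n (kapp (@Lker m)) (fun k => h (node r k)).
set u := iter n transfer h.
under eq_bigr => k _ do rewrite -mulrBr.
apply: sum_weights_le => k; set y := fc k (node r i).
have yr : unit_nbhd (c * r) y by apply: f_nbhd_c; exact: node_nbhd.
have -> : cauchy_type r v y - u y = cauchy_type r (fun k => v k - u (node r k)) y +
    (cauchy_type r (fun k : edge m => u (node r k)) y - u y).
  rewrite addrA; congr (_ - _); rewrite /cauchy_type -mulrDr -big_split /=.
  by congr (_ * _); apply: eq_bigr => j _; ring.
rewrite (le_trans (cabsD _ _)) // [e]splitr lerD //; last exact: m2 hh2 yr.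
have := @cauchy_type_le m (fun k => v k - u (node r k)) (e / 2 / Kop) y (ltW e1).
by rewrite -/Kop mulfVK ?gt_eqF //; apply=> // j; exact: m1 hh.
Qed.

Section Trace.
Context (zw : seq 'I_N -> R) (zw01 : forall s, 0 <= zw s <= 1).
Context (zw_fix : forall s, (0 < size s)%N -> cword s (zw s)%:C%C = (zw s)%:C%C).
Context (quot : forall s, exists G G1 B, [/\ C11 r B G G1,
  forall z, unit_nbhd r z -> cword s z - cword s (zw s)%:C%C = G z * (z - (zw s)%:C%C) &
  G (zw s)%:C%C = dcword s (zw s)%:C%C]).
Context (g g1 : R[i] -> R[i]) (Bg : R) (g_C11 : C11 r Bg g g1).

Definition Bker m (i j : edge m) : R[i] := g (node r i) * Lker i j.

(** At the base point the Lipschitz bound of the word says nothing; the estimate is carried there by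
    continuity along real displacements [t]. *)
Lemma quotient_le s G G1 B : C11 r B G G1 ->
  (forall z, unit_nbhd r z -> cword s z - cword s (zw s)%:C%C = G z * (z - (zw s)%:C%C)) ->
  forall z, unit_nbhd r z -> cabs (G z) <= c ^+ size s.
Proof.
move=> hG hq; have zr : unit_nbhd r (zw s)%:C%C by apply: unit_nbhd_real; rewrite // ltW.
have off z : unit_nbhd r z -> z != (zw s)%:C%C -> cabs (G z) <= c ^+ size s.
  move=> zr' nz; have := cword_lip s zr zr'; rewrite hq // cabsM.
  by rewrite ler_pM2r // cabs_gt0 subr_eq0.
move=> z zr'; have [->|] := eqVneq z (zw s)%:C%C; last exact: off.
apply/ler_addgt0Pr => e e0; have B0 := C11_ge0 (ltW r0) hG.
pose t := Num.min r (e / (B + 1)).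
have B1 : 0 < B + 1 by rewrite ltr_wpDl.
have t0 : 0 < t by rewrite lt_min r0 divr_gt0.
have te : t * (B + 1) <= e by rewrite -ler_pdivlMr // ge_min lexx orbT.
pose y := (zw s)%:C%C + t%:C%C.
have dy : y - (zw s)%:C%C = t%:C%C by rewrite /y addrAC subrr add0r.
have yr : unit_nbhd r y by exists (zw s); [exact: zw01 | rewrite dy cabs_real gtr0_norm // ge_min lexx].
have yz : y != (zw s)%:C%C by rewrite -subr_eq0 dy -cabs_gt0 cabs_real gtr0_norm.
have [_ _ H _] := hG; have := H _ _ yr zr; rewrite [cabs (_ - y)]cabsB dy cabs_real gtr0_norm //.
have := off y yr yz; have := cabs_dist (G (zw s)%:C%C) (G y); nra.
Qed.

(* [z - cword s z = (z - zw s) (1 - G z)], so Cauchy's formula applies to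
   [g / (1 - G)] at [zw s]. *)
Lemma word_trace s : (0 < size s)%N ->
  ccvg (fun m => (winding r m 0)^-1 * \sum_(k : edge m) g (node r k) *
     (step r k / (node r k - cword s (node r k))))
    (g (zw s)%:C%C / (1 - dcword s (zw s)%:C%C)).
Proof.
move=> s0; have [G [G1 [B [hG hq <-]]]] := quot s; set z0 := (zw s)%:C%C.
have z0r rho : 0 <= rho -> unit_nbhd rho z0 by move=> ?; exact: unit_nbhd_real.
have Gle z : unit_nbhd r z -> 1 - c <= cabs (1 - G z).
  move=> zr; have := cabs_dist 1 (G z); rewrite cabs1.
  have := quotient_le hG hq zr.
  have : c ^+ size s <= c by rewrite -[leRHS]expr1 ler_wiXn2l // ltW.
  lra.
have Gn0 z : unit_nbhd r z -> 1 - G z != 0.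
  by move=> /Gle; rewrite -cabs_gt0; apply: lt_le_trans; rewrite subr_gt0.
have h1G : C11 r (cabs (1 : R[i]) + 3 * cabs (-1 : R[i]) * B) (fun z => 1 + -1 * G z) (fun z => 0 + (0 * G z + -1 * G1 z)).
  by apply: C11D (C11_cst _ _) (C11M (ltW r0) (C11_cst _ _) hG).
have d0 : 0 < 1 - c by rewrite subr_gt0.
have Gle' z : unit_nbhd r z -> 1 - c <= cabs (1 + -1 * G z) by rewrite mulN1r; exact: Gle.
have hV := C11V (ltW r0) d0 h1G Gle'.
have hh := C11M (ltW r0) g_C11 hV.
set B' := (3 * Bg * _) in hh; set h := (fun z => _) in hh; set h1 := (fun z => _) in hh.
have hE : g z0 / (1 - G z0) = h z0 by rewrite /h mulN1r.
rewrite hE => e e0.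
have [||M hM] := @cauchy_approx R r (c * r) B' (fun f f1 => f = h /\ f1 = h1) cr_gt0 cr_lt _ _ _ e0.
- move=> e' e'0; exists (e' / (B' + 1)); first by rewrite divr_gt0 // ltr_wpDl // (C11_ge0 (ltW r0) hh).
  by move=> f f1 [-> ->]; exact: C11_unif_diff (ltW r0) e'0 hh.
- move=> f f1 z [-> _] zr; have [H _ _ _] := hh; apply: H; apply: unit_nbhdW zr; exact: ltW cr_lt.
exists M => m /hM /(_ h h1 z0 (conj erefl erefl) (z0r _ (ltW cr_gt0))).
rewrite [X in cabs (X - _) <= _](_ : _ = (winding r m 0)^-1 * \sum_(k : edge m) g (node r k) *
     (step r k / (node r k - cword s (node r k)))) //.
congr (_ * _); apply: eq_bigr => k _.
have kr := node_nbhd r0 k; rewrite /h mulN1r -mulrA; congr (_ * _).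
have -> : node r k - cword s (node r k) = (node r k - z0) * (1 - G (node r k)).
  have := hq _ kr; rewrite zw_fix // -/z0 => /eqP; rewrite subr_eq => /eqP ->; ring.
by rewrite invfM mulrCA; congr (_ * _); exact: mulrC.
Qed.

(** By [Lcol] the columns of the matrix are samples of [transfer] applied to a resolvent, so its
    powers may be replaced by true iterates. The resulting sum [main] splits over words, each
    handled by [word_trace]. *)
Lemma trace_cvg n : ccvg (fun m => ktr (iter n (kmul (@Lker m)) (@Bker m)))
  (\sum_(s : n.+1.-tuple 'I_N) (word_weight p s)%:C%C *
     (g (zw s)%:C%C / (1 - dcword s (zw s)%:C%C))).
Proof.
have Lcol m (i j : edge m) : Lker i j =
    (winding r m 0)^-1 * step r j * transfer (resolvent (node r j)) (node r i).
  rewrite /Lker /transfer -mulrA; congr (_ * _); rewrite mulr_sumr.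
  by apply: eq_bigr => k _; rewrite mulrCA.
pose main m := (winding r m 0)^-1 * \sum_(k : edge m) g (node r k) *
   (step r k * iter n.+1 transfer (resolvent (node r k)) (node r k)).
have main_cvg : ccvg main (\sum_(s : n.+1.-tuple 'I_N) (word_weight p s)%:C%C *
     (g (zw s)%:C%C / (1 - dcword s (zw s)%:C%C))).
  have sz (s : n.+1.-tuple 'I_N) : (0 < size s)%N by rewrite size_tuple.
  have := ccvg_sum (index_enum _) (fun s : n.+1.-tuple 'I_N =>
    ccvgM (ccvg_cst (word_weight p s)%:C%C) (word_trace (sz s))).
  apply: eq_ccvg => m; rewrite /main.
  rewrite [X in _ = _ * X](eq_bigr (fun k => \sum_(s : n.+1.-tuple 'I_N)
    (word_weight p s)%:C%C * (g (node r k) * (step r k / (node r k - cword s (node r k)))))).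
    rewrite exchange_big mulr_sumr /=; apply: eq_bigr => s _.
    by rewrite -mulr_sumr mulrCA.
  move=> k _; rewrite iter_transfer !mulr_sumr; apply: eq_bigr => s _.
  by rewrite /resolvent; ring.
suff diff : ccvg (fun m => ktr (iter n (kmul (@Lker m)) (@Bker m)) - main m) 0.
  by rewrite -[X in ccvg _ X]add0r; apply: eq_ccvg (ccvgD diff main_cvg) => m; rewrite subrK.
move=> e e0; have [B hB] := transfer_resolvent_C11.
have Bg0 := C11_ge0 (ltW r0) g_C11.
pose Q := (winding_min r)^-1 * ((Bg + 1) * contour_length r).
have Q0 : 0 < Q.
  apply: mulr_gt0; first by rewrite invr_gt0; exact: winding_min_gt0.
  by apply: mulr_gt0 (contour_length_gt0 r0); rewrite ltr_wpDl.
have [M hM] := @iter_kapp_approx n B _ (divr_gt0 e0 Q0).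
exists M => m mM; rewrite subr0.
have -> : ktr (iter n (kmul (@Lker m)) (@Bker m)) - main m = (winding r m 0)^-1 *
  \sum_(k : edge m) g (node r k) * (step r k *
    (iter n (kapp (@Lker m)) (fun i => transfer (resolvent (node r k)) (node r i)) k
     - iter n transfer (transfer (resolvent (node r k))) (node r k))).
  rewrite ktr_iter_scaled /main -[in LHS]mulrN -sumrN.
  rewrite [X in _ + X]mulr_sumr -big_split mulr_sumr /=; apply: eq_bigr => k _.
  rewrite iter_kapp -iterSr /=.
  have -> : iter n (kapp (@Lker m)) ((@Lker m)^~ k) k = (winding r m 0)^-1 * step r k *
      iter n (kapp (@Lker m)) (fun i => transfer (resolvent (node r k)) (node r i)) k.
    rewrite -iter_kappZ; congr (iter n _ _ _); apply/funext => i; exact: Lcol.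
  by ring.
have w00 := winding_min_gt0 r0; have w0W : winding_min r <= cabs (winding r m 0) by exact: winding_ge.
have -> : e = (winding_min r)^-1 * ((Bg + 1) * (e / Q) * contour_length r).
  have -> : (winding_min r)^-1 * ((Bg + 1) * (e / Q) * contour_length r) = e / Q * Q.
    by move: (e / Q) => q; rewrite /Q; ring.
  by rewrite mulfVK // gt_eqF.
rewrite cabsM; apply: ler_pM; try exact: cabs_ge0.
  by rewrite cabsV lef_pV2 ?posrE // (lt_le_trans w00).
apply: (le_trans (cabs_sum _ _ _)).
apply: (@le_trans _ _ (\sum_(k : edge m) (Bg + 1) * (e / Q) * cabs (step r k))); last first.
  rewrite -mulr_sumr; apply: ler_wpM2l; last exact: sum_step_le.
  by apply: mulr_ge0; [rewrite addr_ge0 | apply: divr_ge0; exact: ltW].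
apply: ler_sum => k _; rewrite !cabsM mulrCA [leRHS]mulrC.
apply: ler_wpM2l; first exact: cabs_ge0.
apply: ler_pM; try exact: cabs_ge0.
  have [H _ _ _] := g_C11; apply: le_trans (H _ (node_nbhd r0 k)) _.
  by rewrite lerDl.
have [h2 hh2] := hB m k; exact: hM hh2.
Qed.
End Trace.
End Transfer.

(** * Gaussian decay *)

Section GaussianDecay.
Context (R : realType).

Lemma sum_divn_ge M n : (n%:R * (n%:R - 1) / (2 * M.+1%:R) - n%:R : R) <=
  (\sum_(b < n) (b %/ M.+1)%N)%:R.
Proof.
have M0 : (0 : R) < M.+1%:R by rewrite ltr0n.
elim: n => [|n IH]; first by rewrite big_ord0 mul0r mul0r subrr.
rewrite big_ord_recr /= natrD -natr1.
have h : (n%:R / M.+1%:R - 1 : R) <= (n %/ M.+1)%:R.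
  rewrite lerBlDr ler_pdivrMr // natr1 -natrM ler_nat.
  by rewrite ltnW // ltn_ceil.
have -> : (n%:R + 1) * (n%:R + 1 - 1) / (2 * M.+1%:R) - (n%:R + 1) =
  (n%:R * (n%:R - 1) / (2 * M.+1%:R) - n%:R) + (n%:R / M.+1%:R - 1) :> R.
  by field; rewrite nat1r pnatr_eq0.
exact: lerD.
Qed.

(** Summing the exponents of [q] gives a quadratic gain in [n], which beats the growth of
    [(K * n%:R) ^+ n]. *)
Lemma gaussian_decay (K q : R) M : 0 < K -> 0 < q < 1 ->
  exists A lam : R, [/\ 0 < A, 0 < lam & forall n,
    n%:R * \prod_(b < n) (K * n%:R * q ^+ (b %/ M.+1)) <= A * expR (- lam * n%:R ^+ 2)].
Proof.
move=> K0 /andP[q0 q1]; pose eta : R := - ln q.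
have [et eta0] : {et : R | q = expR (- et) & 0 < et}.
  by exists eta; rewrite /eta ?opprK ?lnK ?posrE // oppr_gt0 ln_lt0 // q0.
move=> eta1.
have M0 : (0 : R) < M.+1%:R by rewrite ltr0n.
have [lam0 [lamE l00]] : exists l : R, l * (2 * M.+1%:R) = et /\ 0 < l.
  have M2 : 0 < 2 * M.+1%:R :> R by rewrite mulr_gt0.
  by exists (et / (2 * M.+1%:R)); split; [rewrite mulfVK // gt_eqF | rewrite divr_gt0].
(* Half of the quadratic gain [lam0] is spent on [K * n%:R <= expR (kap + eps * n%:R)]. Completing
   the square against the linear coefficient [beta] spends another quarter, which leaves
   [lam0 / 4]. *)
pose eps := lam0 / 2; have eps0 : 0 < eps by rewrite divr_gt0.
pose kap := K / eps; have kap0 : 0 < kap by rewrite divr_gt0.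
pose beta := 1 + kap + lam0 + et.
have beta0 : 0 < beta by rewrite /beta; lra.
exists (expR (beta ^+ 2 / lam0)), (lam0 / 4); split; [exact: expR_gt0|by rewrite divr_gt0|].
move=> n; have n0 : (0 : R) <= n%:R by [].
have le_exp (x : R) : x <= expR x by rewrite (le_trans _ (expR_ge1Dx x)) // lerDr.
have Kn : K * n%:R <= expR (kap + eps * n%:R).
  rewrite expRD.
  have -> : K * n%:R = kap * (eps * n%:R).
    by rewrite mulrA /kap mulfVK // gt_eqF.
  by apply: ler_pM (ltW kap0) _ (le_exp _) (le_exp _); exact: mulr_ge0 (ltW eps0) n0.
rewrite big_split /= prodr_const card_ord prodrXr eta0 -expRM_natl -expRD.
apply: (@le_trans _ _ (expR n%:R * (expR (kap + eps * n%:R) ^+ n *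
    expR (- et * (n%:R * (n%:R - 1) / (2 * M.+1%:R) - n%:R))))).
  apply: ler_pM => //; rewrite ?mulr_ge0 ?exprn_ge0 ?expR_ge0 ?mulr_ge0 ?(ltW K0) //.
  apply: ler_pM; rewrite ?expR_ge0 ?exprn_ge0 ?mulr_ge0 ?(ltW K0) //.
    by rewrite lerXn2r ?nnegrE ?expR_ge0 ?mulr_ge0 ?(ltW K0).
  by rewrite ler_expR mulrC ler_wnM2l ?sum_divn_ge // oppr_le0 ltW.
rewrite -expRM_natl -!expRD ler_expR.
have -> : - et * (n%:R * (n%:R - 1) / (2 * M.+1%:R) - n%:R) =
    - lam0 * (n%:R * (n%:R - 1)) + et * n%:R.
  by rewrite -lamE; field; rewrite nat1r pnatr_eq0.
move: (n%:R) n0 => x x0 {Kn}.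
have key (l b y : R) : 0 < l -> b * y <= l / 4 * y ^+ 2 + b ^+ 2 / l.
  move=> l0'; rewrite -subr_ge0.
  have -> : l / 4 * y ^+ 2 + b ^+ 2 / l - b * y = (l * y / 2 - b) ^+ 2 / l.
    by field; rewrite gt_eqF.
  by rewrite divr_ge0 ?sqr_ge0 // ltW.
have := key lam0 beta x l00; move: (beta ^+ 2 / lam0) => Y; rewrite /beta /eps; lra.
Qed.
End GaussianDecay.

Lemma grid_approx (R : realType) (k : nat) (x : R) : 0 <= x <= 1 ->
  exists2 l, (l <= k.+1)%N & `|x - l%:R / k.+1%:R| <= k.+1%:R^-1.
Proof.
move=> /andP[x0 x1]; have k0 : (0 : R) < k.+1%:R by rewrite ltr0n.
have /andP[h1 h2] := Num.Theory.truncn_itv (mulr_ge0 x0 (ltW k0)).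
set l := Num.Def.truncn _ in h1 h2; exists l.
  by rewrite -(ler_nat R) (le_trans h1) // ler_piMl.
have -> : x - l%:R / k.+1%:R = (x * k.+1%:R - l%:R) / k.+1%:R.
  by rewrite mulrBl mulfK // gt_eqF.
rewrite normrM ger0_norm ?subr_ge0 // ger0_norm ?invr_ge0 //.
by rewrite ler_piMl ?invr_ge0 // lerBlDl natr1 ltW.
Qed.

(** * Minors of the discretized operator *)

Section FredholmBound.
Context (R : realType) (N : nat) (p : 'I_N -> R) (fc : 'I_N -> R[i] -> R[i]) (r c : R).
Context (p0 : forall i, 0 <= p i) (p1 : \sum_i p i = 1).
Context (r0 : 0 < r) (c0 : 0 < c) (c1 : c < 1).
Context (f_real : forall i (x : R), 0 <= x <= 1 -> exists2 y : R, 0 <= y <= 1 & fc i x%:C%C = y%:C%C).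
Context (f_lip : forall i z w, unit_nbhd r z -> unit_nbhd r w ->
  cabs (fc i w - fc i z) <= c * cabs (w - z)).

Local Notation Lker := (@Lker R N p fc r).

Lemma det_scale_cols (n : nat) (d : 'I_n -> R[i]) (A : 'M[R[i]]_n) :
  \det (\matrix_(a, b) (d b * A a b)) = (\prod_b d b) * \det A.
Proof.
have -> : \matrix_(a, b) (d b * A a b) = A *m diag_mx (\row_b d b).
  apply/matrixP => a b; rewrite mul_mx_diag !mxE mulrC //.
rewrite det_mulmx det_diag mulrC; congr (_ * _).
by apply: eq_bigr => b _; rewrite mxE.
Qed.

(** The weights [sc] factor out of the columns. Summation over all tuples then factors column by
    column and costs only [S ^+ n.+1], whatever the number of nodes. *)
Lemma row_minor_bound (Bg : R) : 0 <= Bg -> exists (K q : R) M, [/\ 0 < K, 0 < q < 1 &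
  forall m n (g : R[i] -> R[i]), (forall k : edge m, cabs (g (node r k)) <= Bg) ->
    cabs (row_minor_sum n (@Lker m) (fun i j => g (node r i) * @Lker m i j)) <=
    n.+1`!%:R * \prod_(b < n.+1) (K * n.+1%:R * q ^+ (b %/ M.+1))].
Proof.
move=> Bg0; have cr := cr_lt r0 c1; have d0 : 0 < r - c * r by rewrite subr_gt0.
have w00 := winding_min_gt0 r0; have L0 := contour_length_gt0 r0.
(* The mesh is at most [(1 - c) * r / 2]. An image lies within [c * r] of [0, 1], hence within
   [q * r] of a grid point for [q = (1 + c) / 2], while the nodes are at least [r] away. There are
   [k.+2] grid points, whence [M = k.+1]. *)
have [k hk] := @inv_succ_small R 1 ((1 - c) * r / 2) (divr_gt0 (mulr_gt0 (etrans (subr_gt0 _ _) c1) r0) (ltr0Sn R 1)).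
have {}hk := hk k (leqnn k); rewrite mul1r in hk.
pose q := (1 + c) / 2; pose S := (winding_min r)^-1 * contour_length r.
have S0 : 0 < S by apply: mulr_gt0 L0; rewrite invr_gt0.
have Bg1 : 0 < Bg + 1 by rewrite ltr_wpDl.
have c0' := c0; have c1' := c1; have r0' := r0.
have q0 : 0 < q by rewrite /q; lra.
have q1 : q < 1 by rewrite /q; lra.
exists (S * ((Bg + 1) / (r - c * r))), q, k.+1; split.
- by apply: mulr_gt0 S0 (divr_gt0 Bg1 d0).
- by rewrite q0 q1.
move=> m n g hg.
have w0W : winding_min r <= cabs (winding r m 0) by exact: winding_ge.
pose sc (e : edge m) := (winding r m 0)^-1 * step r e.
have sumsc : \sum_(e : edge m) cabs (sc e) <= S.
  rewrite /sc; under eq_bigr do rewrite cabsM.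
  rewrite -mulr_sumr; apply: ler_pM; rewrite ?cabs_ge0 ?sumr_ge0 //.
  - by move=> *; exact: cabs_ge0.
  - by rewrite cabsV lef_pV2 ?posrE // (lt_le_trans w00).
  - exact: sum_step_le.
pose P := n.+1`!%:R * \prod_(b < n.+1) ((Bg + 1) * n.+1%:R / (r - c * r) * q ^+ (b %/ k.+2)).
have detP (j : {ffun 'I_n.+1 -> edge m}) :
    cabs (\det (kminor_row (@Lker m) (fun i j => g (node r i) * @Lker m i j) ord0 j)) <=
    (\prod_b cabs (sc (j b))) * P.
  pose cc (a : 'I_n.+1) (i : 'I_N) : R[i] := (if a == ord0 then g (node r (j a)) else 1) * (p i)%:C%C.
  have -> : kminor_row (@Lker m) (fun i j => g (node r i) * @Lker m i j) ord0 j =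
     \matrix_(a, b) (sc (j b) * (\matrix_(a, b) \sum_i cc a i / (node r (j b) - fc i (node r (j a)))) a b).
    apply/matrixP => a b; rewrite !mxE /cc /sc /Lker.
    case: (a == ord0); rewrite -mulrA; last first.
      congr (_ * _); rewrite mulr_sumr; apply: eq_bigr => i _; ring.
    rewrite mulrCA; congr (_ * _); rewrite !mulr_sumr; apply: eq_bigr => i _; ring.
  rewrite det_scale_cols cabsM cabs_prod ler_wpM2l ?prodr_ge0 //.
    by move=> *; exact: cabs_ge0.
  apply: (@det_resolvent_bound R n.+1 _ cc (fun a i => fc i (node r (j a))) (fun b => node r (j b))
    k.+1 (fun l => (l%:R / k.+1%:R)%:C%C)) => //.
  - exact: ltW.
  - move=> a; rewrite /cc; under eq_bigr do rewrite cabsM cabs_real ger0_norm //.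
    rewrite -mulr_sumr p1 mulr1; case: ifP => _.
      by rewrite (le_trans (hg _)) // lerDl.
    by rewrite cabs1 lerDr.
  - move=> a i; have [x x01 hx] := f_nbhd_c r0 c0 f_real f_lip i (node_nbhd r0 (j a)).
    have [l lk hl] := grid_approx k x01; exists l => // b.
    apply: (@le_trans _ _ (q * r)); last first.
      rewrite ler_wpM2l ?node_far ?(ltW q0) //.
      by rewrite divr_ge0 //= ler_pdivrMr // mul1r ler_nat.
    apply: (le_trans (cabs_subD _ _ x%:C%C)); rewrite -rmorphB /= cabs_real.
    move: hl hk hx; rewrite /q; move: (k.+1%:R^-1) (cabs _) `|_| => u v1 v2; lra.
  - move=> a i b; apply: node_dist => //; exact: f_nbhd_c (node_nbhd r0 (j a)).
  - move=> b l lk; rewrite -subr_eq0 -cabs_gt0 (lt_le_trans r0) // node_far //.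
    by rewrite divr_ge0 //= ler_pdivrMr // mul1r ler_nat.
have q0' := ltW q0.
have P0 : 0 <= P.
  rewrite mulr_ge0 // prodr_ge0 // => b _; rewrite mulr_ge0 ?exprn_ge0 //.
  by rewrite divr_ge0 ?mulr_ge0 // ltW.
apply: (le_trans (cabs_sum _ _ _)); apply: (le_trans (ler_sum _ (fun j _ => detP j))).
rewrite -mulr_suml -(bigA_distr_bigA (fun (b : 'I_n.+1) (e : edge m) => cabs (sc e))) /=.
apply: (@le_trans _ _ (S ^+ n.+1 * P)).
  rewrite ler_wpM2r // prodr_const card_ord lerXn2r ?nnegrE ?(ltW S0) //.
  by apply: sumr_ge0 => *; exact: cabs_ge0.
rewrite /P mulrCA ler_wpM2l //.
have -> : S ^+ n.+1 = \prod_(b < n.+1) S by rewrite prodr_const card_ord.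
rewrite -big_split /= le_eqVlt; apply/orP; left; apply/eqP; apply: eq_bigr => b _.
by rewrite !mulrA; congr (_ * _); ring.
Qed.

Lemma fredholm_gaussian (Bg : R) : 0 <= Bg -> exists A lam : R, [/\ 0 < A, 0 < lam &
  forall m n (g : R[i] -> R[i]), (forall k : edge m, cabs (g (node r k)) <= Bg) ->
    cabs (fredholm_deriv (@Lker m) (fun i j => g (node r i) * @Lker m i j) n) <=
    A * expR (- lam * n.+1%:R ^+ 2)].
Proof.
move=> Bg0; have [K [q [M [K0 q01 hK]]]] := row_minor_bound Bg0.
have [A [lam [A0 l0 hA]]] := gaussian_decay M K0 q01.
exists A, lam; split=> // m n g hg; apply: le_trans (hA n.+1).
rewrite /fredholm_deriv cabsM cabs_sign mul1r cabsM cabsV cabs_natr.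
rewrite ler_pdivrMr ?ltr0n ?fact_gt0 //.
apply: (le_trans (hK m n g hg)); rewrite factS natrM.
by rewrite le_eqVlt; apply/orP; left; apply/eqP; ring.
Qed.
End FredholmBound.

(** * Passage to the limit in the Fredholm coefficients *)

Section FredholmLimit.
Context (R : realType) (N : nat) (p : 'I_N -> R) (fc fc1 : 'I_N -> R[i] -> R[i]) (r c Bf : R).
Context (p0 : forall i, 0 <= p i) (p1 : \sum_i p i = 1).
Context (r0 : 0 < r) (c0 : 0 < c) (c1 : c < 1).
Context (f_real : forall i (x : R), 0 <= x <= 1 -> exists2 y : R, 0 <= y <= 1 & fc i x%:C%C = y%:C%C).
Context (f_lip : forall i z w, unit_nbhd r z -> unit_nbhd r w ->
  cabs (fc i w - fc i z) <= c * cabs (w - z)).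
Context (f_C11 : forall i, C11 r Bf (fc i) (fc1 i)).
Context (zw : seq 'I_N -> R) (zw01 : forall s, 0 <= zw s <= 1).
Context (zw_fix : forall s, (0 < size s)%N -> cword fc s (zw s)%:C%C = (zw s)%:C%C).
Context (quot : forall s, exists G G1 B, [/\ C11 r B G G1,
  forall z, unit_nbhd r z -> cword fc s z - cword fc s (zw s)%:C%C = G z * (z - (zw s)%:C%C) &
  G (zw s)%:C%C = dcword fc fc1 s (zw s)%:C%C]).

Local Notation Lker := (@Lker R N p fc r).

Definition word_sum (g : R[i] -> R[i]) n : R[i] :=
  \sum_(s : n.-tuple 'I_N) (word_weight p s)%:C%C *
     (g (zw s)%:C%C / (1 - dcword fc fc1 s (zw s)%:C%C)).

Lemma fredholm_deriv_cvg (y a : nat -> R) (g g1 : R[i] -> R[i]) (Bg : R) n :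
  (forall m, (m <= n)%N -> ccvg (fun k => fredholm_coef (@Lker k) m) (a m)%:C%C) ->
  C11 r Bg g g1 -> (forall n, (y n.+1)%:C%C = word_sum g n.+1) ->
  ccvg (fun m => fredholm_deriv (@Lker m) (fun i j => g (node r i) * @Lker m i j) n)
    (- \sum_(i < n.+1) y i.+1 * a (n - i)%N)%:C%C.
Proof.
move=> ha hg hy; rewrite rmorphN rmorph_sum /=.
apply: (@eq_ccvg _ (fun m => - \sum_(i < n.+1) ktr (iter i (kmul (@Lker m))
    (fun i j => g (node r i) * @Lker m i j)) * fredholm_coef (@Lker m) (n - i)%N)).
  by move=> m; rewrite fredholm_derivE.
apply: ccvgN.
apply: (@ccvg_sum R _ _ (fun (i : 'I_n.+1) m => ktr (iter i (kmul (@Lker m))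
    (fun i j => g (node r i) * @Lker m i j)) * fredholm_coef (@Lker m) (n - i)%N)) => i.
rewrite rmorphM /=; apply: ccvgM; last by apply: ha; exact: leq_subr.
rewrite hy; exact: (trace_cvg p0 p1 r0 c0 c1 f_real f_lip f_C11 zw01 zw_fix quot hg).
Qed.

(** Both sides obey the same recurrence in the traces, so strong induction reduces the claim to
    [trace_cvg]. *)
Lemma fredholm_coef_cvg (t a : nat -> R) :
  (forall n, (t n.+1)%:C%C = word_sum (fun=> 1) n.+1) -> is_exp_series t a ->
  forall n, ccvg (fun m => fredholm_coef (@Lker m) n) (a n)%:C%C.
Proof.
move=> ht [a0 aS]; elim/ltn_ind => -[_|n IH].
  by rewrite a0 rmorph1; apply: eq_ccvg (ccvg_cst 1) => m; rewrite fredholm_coef0.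
have n0 : n.+1%:R != 0 :> R[i] by rewrite pnatr_eq0.
have L1 m : (fun i j => (fun=> 1) (node r i) * @Lker m i j) = @Lker m.
  by apply/funext => i; apply/funext => j; rewrite mul1r.
have h := fredholm_deriv_cvg (n := n) IH (C11_cst r 1) ht; rewrite -aS in h.
have -> : (a n.+1)%:C%C = n.+1%:R^-1 * (n.+1%:R * a n.+1)%:C%C.
  by rewrite rmorphM /= rmorph_nat mulKf.
apply: eq_ccvg (ccvgM (ccvg_cst _) h) => m.
by rewrite L1 -fredholm_coefS mulKf.
Qed.

Lemma exp_series_gaussian (t y a al : nat -> R) (g g1 : R[i] -> R[i]) (Bg : R) :
  (forall n, (t n.+1)%:C%C = word_sum (fun=> 1) n.+1) -> is_exp_series t a ->
  C11 r Bg g g1 -> (forall n, (y n.+1)%:C%C = word_sum g n.+1) ->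
  al 0%N = 0 -> (forall n, al n.+1 = - \sum_(i < n.+1) y i.+1 * a (n - i)%N) ->
  exists A lam : R, [/\ 0 < lam,
     forall n, `|a n| <= A * expR (- lam * n%:R ^+ 2) &
     forall n, `|al n| <= A * expR (- lam * n%:R ^+ 2)].
Proof.
move=> ht expa hg hy al0 alS.
(* The bound [Bg + 1] covers both [g] and the constant 1, so one pair of constants serves [al] and
   [a]. *)
have Bg0 := C11_ge0 (ltW r0) hg; have B0 : 0 <= Bg + 1 by rewrite addr_ge0.
have [A [lam [A0 l0 hA]]] := fredholm_gaussian p0 p1 r0 c0 c1 f_real f_lip B0.
have acvg := fredholm_coef_cvg ht expa.
have L1 m : (fun i j => (fun=> 1) (node r i) * @Lker m i j) = @Lker m.
  by apply/funext => i; apply/funext => j; rewrite mul1r.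
have A1 n : A * expR (- lam * n%:R ^+ 2) <= (A + 1) * expR (- lam * n%:R ^+ 2).
  by rewrite ler_wpM2r ?expR_ge0 // lerDl.
exists (A + 1), lam; split=> // -[|n].
- by rewrite expa.1 normr1 expr0n /= mulr0 expR0 mulr1 lerDr ltW.
- apply: le_trans (A1 _); rewrite -cabs_real; apply: ccvg_le (acvg n.+1) _ => m.
  have n0 : (0 : R) < n.+1%:R by rewrite ltr0n.
  apply: (@le_trans _ _ (n.+1%:R * cabs (fredholm_coef (@Lker m) n.+1))).
    by rewrite ler_peMl ?cabs_ge0 // ler1n.
  have -> : n.+1%:R * cabs (fredholm_coef (@Lker m) n.+1) = cabs (fredholm_deriv (@Lker m) (@Lker m) n).
    by rewrite -fredholm_coefS [RHS]cabsM cabs_natr.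
  have h := hA m n (fun=> 1); rewrite /= L1 in h.
  by apply: h => k; rewrite cabs1 lerDr.
- by rewrite al0 normr0 mulr_ge0 ?expR_ge0 // addr_ge0 // ltW.
- apply: le_trans (A1 _); rewrite -cabs_real alS.
  apply: ccvg_le (fredholm_deriv_cvg (fun m _ => acvg m) hg hy) _ => m.
  apply: hA => k; have [H _ _ _] := hg; apply: le_trans (H _ (node_nbhd r0 k)) _.
  by rewrite lerDl.
Qed.
End FredholmLimit.

(** * Real words *)

Section RealWords.
Local Open Scope classical_set_scope.
Context (R : realType) (N : nat) (phi : ifs_maps R N) (p : 'I_N -> R).
Context (fc fc1 : 'I_N -> R[i] -> R[i]) (r c Bf : R).
Context (r0 : 0 < r) (c0 : 0 < c) (c1 : c < 1).
Context (fphi : forall i (x : R), 0 <= x <= 1 -> fc i x%:C%C = (phi i x)%:C%C).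
Context (f_lip : forall i z w, unit_nbhd r z -> unit_nbhd r w ->
  cabs (fc i w - fc i z) <= c * cabs (w - z)).

Lemma I01E (x : R) : I01 x = (0 <= x <= 1) :> Prop.
Proof. by rewrite /I01 /= in_itv. Qed.

Lemma phi_I01 i (x : R) : 0 <= x <= 1 -> 0 <= phi i x <= 1.
Proof. by rewrite -!I01E => hx; exact: funS. Qed.

Lemma f_real_of_phi i (x : R) : 0 <= x <= 1 -> exists2 y : R, 0 <= y <= 1 & fc i x%:C%C = y%:C%C.
Proof. by move=> x01; exists (phi i x); [exact: phi_I01 | exact: fphi]. Qed.

Lemma word_map_I01 s (x : R) : 0 <= x <= 1 -> 0 <= word_map phi s x <= 1.
Proof. by move=> x01; elim: s => //= i s; exact: phi_I01. Qed.

Lemma word_map_cat s s' (x : R) : word_map phi (s ++ s') x = word_map phi s (word_map phi s' x).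
Proof. by elim: s => //= i s ->. Qed.

Lemma cword_word_map s (x : R) : 0 <= x <= 1 -> cword fc s x%:C%C = (word_map phi s x)%:C%C.
Proof.
move=> x01; elim: s => //= i s ->; exact: fphi (word_map_I01 s x01).
Qed.

Lemma word_map_lip s (x y : R) : 0 <= x <= 1 -> 0 <= y <= 1 ->
  `|word_map phi s y - word_map phi s x| <= c ^+ size s * `|y - x|.
Proof.
move=> x01 y01; have := cword_lip r0 c0 c1 f_real_of_phi f_lip s
  (unit_nbhd_real (ltW r0) x01) (unit_nbhd_real (ltW r0) y01).
by rewrite !cword_word_map // -!rmorphB /= !cabs_real.
Qed.

Lemma lip_within_continuous (g : R -> R) (K : R) :
  (forall x y, 0 <= x <= 1 -> 0 <= y <= 1 -> `|g y - g x| <= K * `|y - x|) ->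
  {within I01, continuous g}.
Proof.
move=> gK; apply/subspace_continuousP => x; rewrite I01E => x01.
apply/cvgrPdist_lt => e e0; rewrite near_withinE.
have K0 : 0 < `|K| + 1 by rewrite ltr_wpDl.
exists (e / (`|K| + 1)) => /=; first by rewrite divr_gt0.
move=> y; rewrite /ball /= ltr_pdivlMr // => xy; rewrite I01E => y01.
apply: le_lt_trans (gK y x y01 x01) _; apply: le_lt_trans xy.
by rewrite mulrC ler_wpM2l // (le_trans (ler_norm K)) // lerDl.
Qed.

(** The intermediate value theorem also covers the empty word, where the contraction factor is 1. *)
Lemma word_map_fixpoint s : exists2 z : R, 0 <= z <= 1 & word_map phi s z = z.
Proof.
have cont : {within `[0 : R, 1], continuous (fun x => word_map phi s x - x)}.
  apply: (@lip_within_continuous _ (c ^+ size s + 1)) => x y x01 y01.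
  have -> : word_map phi s y - y - (word_map phi s x - x) =
     (word_map phi s y - word_map phi s x) - (y - x) by ring.
  by rewrite (le_trans (ler_normB _ _)) // mulrDl mul1r lerD2r word_map_lip.
have [|z] := @IVT R _ 0 1 0 ler01 cont.
  have /andP[h1 _] : 0 <= word_map phi s 0 <= 1 by rewrite word_map_I01 // lexx ler01.
  have /andP[_ h2] : 0 <= word_map phi s 1 <= 1 by rewrite word_map_I01 // lexx ler01.
  by rewrite ge_min le_max subr0 h1 subr_le0 h2 orbT.
by rewrite in_itv /= => z01 /eqP; rewrite subr_eq0 => /eqP; exists z.
Qed.

Lemma word_fixpointP s : 0 <= word_fixpoint phi s <= 1 /\
  word_map phi s (word_fixpoint phi s) = word_fixpoint phi s.
Proof.
have [z z01 zE] := word_map_fixpoint s; rewrite -I01E.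
by apply: (@xgetPex _ 0 [set z | I01 z /\ word_map phi s z = z]); exists z; rewrite /= I01E.
Qed.

Lemma word_fixpoint01 s : 0 <= word_fixpoint phi s <= 1.
Proof. by have [] := word_fixpointP s. Qed.

Lemma word_fixpoint_cword s : cword fc s (word_fixpoint phi s)%:C%C = (word_fixpoint phi s)%:C%C.
Proof. by have [h1 h2] := word_fixpointP s; rewrite cword_word_map // h2. Qed.

Lemma pow_lt1 s : (0 < size s)%N -> c ^+ size (s : seq 'I_N) < 1.
Proof. by move=> s0; rewrite exprn_ilt1 ?ltW // -lt0n. Qed.

Lemma word_fixpoint_unique s (z : R) : (0 < size s)%N -> 0 <= z <= 1 -> word_map phi s z = z ->
  word_fixpoint phi s = z.
Proof.
move=> s0 z01 zE; have [h1 h2] := word_fixpointP s.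
have := word_map_lip s z01 h1; rewrite zE h2 => h.
apply/eqP; rewrite -subr_eq0 -normr_le0 leNgt; apply/negP => pos.
by move: h; rewrite leNgt gtr_pMl // pow_lt1.
Qed.

Lemma word_fixpoint_rot1 i s : word_fixpoint phi (rcons s i) = word_map phi s (word_fixpoint phi (i :: s)).
Proof.
have [h1 h2] := word_fixpointP (i :: s).
apply: word_fixpoint_unique; first by rewrite size_rcons.
  exact: word_map_I01.
by rewrite -cats1 word_map_cat /= -[X in _ = word_map phi s X]h2.
Qed.

(** Both sides are products of derivatives along the same periodic orbit, started at successive
    points. *)
Lemma dcword_rot1 i s : dcword fc fc1 (rcons s i) (word_fixpoint phi (rcons s i))%:C%C =
  dcword fc fc1 (i :: s) (word_fixpoint phi (i :: s))%:C%C.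
Proof.
have [h1 h2] := word_fixpointP (i :: s).
rewrite word_fixpoint_rot1 -cats1 dcword_cat /= mulr1 -cword_word_map //.
have E := word_fixpoint_cword (i :: s); rewrite /= in E.
by rewrite E mulrC.
Qed.

Lemma dcword_rot k s : dcword fc fc1 (rot k s) (word_fixpoint phi (rot k s))%:C%C =
  dcword fc fc1 s (word_fixpoint phi s)%:C%C.
Proof.
elim: k => [|k IH]; first by rewrite rot0.
have [ks|ks] := ltnP k (size s); last by rewrite rot_oversize // leqW.
rewrite rotS // -{}IH; case: (rot k s) => [//|i v].
by rewrite rot1_cons dcword_rot1.
Qed.

Section Derivative.
Context (B : R) (s : seq 'I_N) (hs : C11 r B (cword fc s) (dcword fc fc1 s)).

Let z := word_fixpoint phi s.

Lemma real_quotient (y : R) : 0 <= y <= 1 -> y != z ->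
  cabs ((((word_map phi s y - word_map phi s z) / (y - z))%:C%C) - dcword fc fc1 s z%:C%C) <= B * `|y - z|.
Proof.
move=> y01 yz; have [z01 _] := word_fixpointP s.
have [_ _ _ H] := hs.
have := H _ _ (unit_nbhd_real (ltW r0) z01) (unit_nbhd_real (ltW r0) y01).
have yz0 : (y - z)%:C%C != 0 :> R[i] by rewrite -cabs_eq0 cabs_real normr_eq0 subr_eq0.
rewrite !cword_word_map // -!rmorphB /= => h.
have pos : 0 < `|y - z| by rewrite normr_gt0 subr_eq0.
rewrite -(ler_pM2r pos) -{1}cabs_real -cabsM mulrBl -rmorphM /= mulfVK ?subr_eq0 //.
by move: h; rewrite cabs_real expr2 mulrA.
Qed.

(** The point is taken on the side of the farther end of [0, 1]. It makes the filter in [derive01]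
    proper even when the fixed point is an end point. *)
Lemma near_fixpoint (d : R) : 0 < d -> exists y : R, [/\ 0 <= y <= 1, y != z & `|y - z| < d].
Proof.
move=> d0; have [/andP[z0 z1] _] := word_fixpointP s; rewrite -/z in z0 z1.
pose e := Num.min (d / 2) (1 / 2).
have e0 : 0 < e by rewrite lt_min !divr_gt0.
have ed : e <= d / 2 by rewrite ge_min lexx.
have e1 : e <= 1 / 2 by rewrite ge_min lexx orbT.
have [h|h] := leP z (1 / 2).
  exists (z + e); rewrite addrAC subrr add0r gtr0_norm //; split; last by lra.
    by apply/andP; split; lra.
  by rewrite -subr_eq0 addrAC subrr add0r gt_eqF.
exists (z - e); rewrite addrAC subrr add0r normrN gtr0_norm //; split; last by lra.
  by apply/andP; split; lra.
by rewrite -subr_eq0 addrAC subrr add0r oppr_eq0 gt_eqF.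
Qed.

(** It is a limit of difference quotients of a real function. *)
Lemma dcword_real : dcword fc fc1 s z%:C%C = (complex.Re (dcword fc fc1 s z%:C%C))%:C%C.
Proof.
have B0 := C11_ge0 (ltW r0) hs.
case E : (dcword fc fc1 s z%:C%C) => [a b] /=; congr (_ +i* _)%C.
apply/eqP; rewrite -normr_eq0 eq_le normr_ge0 andbT; apply/ler_addgt0Pr => e e0.
rewrite add0r; have B1 : 0 < B + 1 by rewrite ltr_wpDl.
have [y [y01 yz yd]] := near_fixpoint (divr_gt0 e0 B1).
have := le_trans (Im_le_cabs _) (real_quotient y01 yz).
rewrite E raddfB /= sub0r normrN => h; apply: (le_trans h).
move: yd; rewrite ltr_pdivlMr // => /ltW; apply: le_trans.
by rewrite mulrC ler_wpM2l // lerDl.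
Qed.

Lemma derive01_cword : (derive01 (word_map phi s) z)%:C%C = dcword fc fc1 s z%:C%C.
Proof.
have B0 := C11_ge0 (ltW r0) hs.
rewrite dcword_real; congr (_%:C%C); rewrite /derive01.
have PF : ProperFilter (within (@I01 R) z^').
  apply: Build_ProperFilter_ex => P [d d0 hP].
  have [y [y01 yz yd]] := near_fixpoint d0.
  by exists y; apply: hP; rewrite ?I01E //= /ball /= distrC.
apply: cvg_lim => //; apply/cvgrPdist_le => e e0.
have B1 : 0 < B + 1 by rewrite ltr_wpDl.
rewrite near_withinE /= near_withinE; exists (e / (B + 1)) => /=; first by rewrite divr_gt0.
move=> y; rewrite /ball /= distrC => yd yz; rewrite I01E => y01.
have := le_trans (Re_le_cabs _) (real_quotient y01 yz).
rewrite raddfB /= distrC => h; apply: (le_trans h).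
move: yd; rewrite ltr_pdivlMr // => /ltW; apply: le_trans.
by rewrite mulrC ler_wpM2l // lerDl.
Qed.
End Derivative.
End RealWords.

(** * Traces as weighted sums over words *)

Section WordSums.
Local Open Scope classical_set_scope.
Context (R : realType) (N : nat) (phi : ifs_maps R N) (p : 'I_N -> R).
Context (p0 : forall i, 0 <= p i) (p1 : \sum_i p i = 1).

Definition real_word_sum (g : R -> R) n : R :=
  \sum_(s : n.-tuple 'I_N) word_weight p s * (g (word_fixpoint phi s) / word_den phi s).

Lemma word_weight_ge0 s : 0 <= word_weight p s.
Proof. by rewrite /word_weight prodr_ge0. Qed.

Lemma sum_word_weight n : \sum_(s : n.-tuple 'I_N) word_weight p s = 1.
Proof.
elim: n => [|n IH].
  rewrite (big_pred1 [tuple]) /=; last by move=> t; apply/esym/eqP; exact: tuple0.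
  by rewrite /word_weight big_nil.
rewrite (sum_tuple_cons n (word_weight p)) -p1; apply: eq_bigr => i _.
rewrite -[RHS]mulr1 -IH mulr_sumr; apply: eq_bigr => s _.
by rewrite /word_weight big_cons.
Qed.

Lemma t_E n : t_ phi p n = real_word_sum (fun=> 1) n.
Proof. by apply: eq_bigr => s _; rewrite mul1r. Qed.

(** Weight and denominator are invariant under rotation, so reindexing makes the [n] orbit terms
    equal. *)
Lemma tau_E g n : (forall k (s : seq 'I_N), word_den phi (rot k s) = word_den phi s) ->
  tau_ phi p g n = n%:R * real_word_sum g n.
Proof.
move=> den_rot; rewrite /tau_.
transitivity (\sum_(k < n) real_word_sum g n); last first.
  by rewrite sumr_const card_ord mulr_natl.
under eq_bigr do rewrite mulr_suml mulr_sumr.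
rewrite exchange_big /=; apply: eq_bigr => k _.
rewrite /real_word_sum [RHS](reindex (fun s : n.-tuple 'I_N => [tuple of rot k s])) /=.
  apply: eq_bigr => s _; rewrite den_rot; congr (_ * _).
  by rewrite /word_weight; apply: perm_big; rewrite perm_sym perm_rot.
exists (fun s : n.-tuple 'I_N => [tuple of rotr k s]) => s _; apply: val_inj => /=.
  by rewrite rotK.
by rewrite rotrK.
Qed.

Section Bounds.
Context (c : R) (c0 : 0 < c) (c1 : c < 1).
Context (den : forall s : seq 'I_N, (0 < size s)%N -> `|1 - word_den phi s| <= c ^+ size s).

Lemma word_den_ge s : (0 < size (s : seq 'I_N))%N -> 1 - c <= word_den phi s.
Proof.
move=> s0; have := den s0; have : c ^+ size s <= c.
  by rewrite -[leRHS]expr1 ler_wiXn2l // ltW.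
by rewrite ler_norml => h /andP[h1 h2]; lra.
Qed.

Lemma inv_word_den s : (0 < size (s : seq 'I_N))%N -> `|(word_den phi s)^-1 - 1| <= c ^+ size s / (1 - c).
Proof.
move=> s0; have h := word_den_ge s0; have c1' : 0 < 1 - c by rewrite subr_gt0.
have d0 : 0 < word_den phi s by apply: lt_le_trans h.
have -> : (word_den phi s)^-1 - 1 = (1 - word_den phi s) / word_den phi s.
  by field; rewrite gt_eqF.
rewrite normrM ler_pM ?den // normfV gtr0_norm // lef_pV2 ?posrE //.
Qed.

Lemma real_word_sum_close (g : R -> R) (G mu0 K : R) n :
  0 <= G -> (forall x, 0 <= x <= 1 -> `|g x| <= G) ->
  (forall s, 0 <= word_fixpoint phi s <= 1) ->
  `|\sum_(s : n.+1.-tuple 'I_N) word_weight p s * g (word_fixpoint phi s) - mu0| <= K * c ^+ n.+1 ->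
  `|real_word_sum g n.+1 - mu0| <= (G / (1 - c) + K) * c ^+ n.+1.
Proof.
move=> G0 hG fix01 hS.
set S := \sum_(s : _) _ in hS.
have -> : real_word_sum g n.+1 - mu0 = (real_word_sum g n.+1 - S) + (S - mu0) by rewrite addrA subrK.
rewrite (le_trans (ler_normD _ _)) // mulrDl lerD //.
rewrite /real_word_sum /S -sumrB (le_trans (ler_norm_sum _ _ _)) //.
apply: (@le_trans _ _ (\sum_(s : n.+1.-tuple 'I_N) word_weight p s * (G / (1 - c) * c ^+ n.+1))); last first.
  by rewrite -mulr_suml sum_word_weight mul1r.
apply: ler_sum => s _; rewrite -mulrBr normrM ger0_norm ?word_weight_ge0 //.
rewrite ler_wpM2l ?word_weight_ge0 //.
have -> : g (word_fixpoint phi s) / word_den phi s - g (word_fixpoint phi s) =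
  g (word_fixpoint phi s) * ((word_den phi s)^-1 - 1) by rewrite mulrBr mulr1.
rewrite normrM; have sz : (0 < size s)%N by rewrite size_tuple.
have := inv_word_den sz; rewrite size_tuple => hd.
have -> : G / (1 - c) * c ^+ n.+1 = G * (c ^+ n.+1 / (1 - c)) by ring.
by rewrite ler_pM // hG.
Qed.
End Bounds.

Lemma real_word_sumE (fc fc1 : 'I_N -> R[i] -> R[i]) (g : R -> R) (gC : R[i] -> R[i]) n :
  (forall x, gC x%:C%C = (g x)%:C%C) ->
  (forall s : n.-tuple 'I_N, (derive01 (word_map phi s) (word_fixpoint phi s))%:C%C =
     dcword fc fc1 s (word_fixpoint phi s)%:C%C) ->
  (real_word_sum g n)%:C%C = word_sum p fc fc1 (word_fixpoint phi) gC n.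
Proof.
move=> hg hd; rewrite rmorph_sum; apply: eq_bigr => s _.
by rewrite /word_den !rmorphM /= fmorphV rmorphB rmorph1 /= hg hd.
Qed.
End WordSums.

(** * Integrals against the stationary measure *)

Section Stationary.
Local Open Scope classical_set_scope.
Context (R : realType) (N : nat) (phi : ifs_maps R N) (p : 'I_N -> R) (c : R).
Context (p0 : forall i, 0 <= p i) (p1 : \sum_i p i = 1).
Context (c0 : 0 < c) (c1 : c < 1).
Context (mu : probability (measurableTypeR R) R) (hmu : stationary phi p mu).
Context (wlip : forall s (x y : R), 0 <= x <= 1 -> 0 <= y <= 1 ->
  `|word_map phi s y - word_map phi s x| <= c ^+ size s * `|y - x|).

Definition lip01 (K : R) (g : R -> R) :=
  forall x y, 0 <= x <= 1 -> 0 <= y <= 1 -> `|g y - g x| <= K * `|y - x|.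

Lemma measurable_I01 : measurable (I01 : set (measurableTypeR R)).
Proof. exact: measurable_itv. Qed.

Lemma lip01_integrable K g : lip01 K g -> mu.-integrable I01 (EFin \o g).
Proof.
move=> gK; apply: measurable_bounded_integrable.
- exact: measurable_I01.
- by apply: (le_lt_trans (probability_le1 mu measurable_I01)); rewrite ltry.
- apply: subspace_continuous_measurable_fun; first exact: measurable_I01.
  exact: lip_within_continuous gK.
- exists (`|g 0| + `|K|); split; first exact: num_real.
  move=> M hM x; rewrite I01E => /andP[x0' x1']; apply: ltW; apply: le_lt_trans hM.
  have := gK 0 x; rewrite lexx ler01 x0' x1' => /(_ isT isT); rewrite subr0.
  have := ler_normD (g x - g 0) (g 0); rewrite subrK => h1 h2.
  apply: (le_trans h1); rewrite addrC lerD2l; apply: (le_trans h2).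
  rewrite (ger0_norm x0'); apply: (@le_trans _ _ (`|K| * x)).
    by rewrite ler_wpM2r // ler_norm.
  by rewrite ler_piMr.
Qed.

Lemma Rintegral_close K g (a e : R) : lip01 K g ->
  (forall x, 0 <= x <= 1 -> `|g x - a| <= e) -> `|\int[mu]_(x in I01) g x - a| <= e.
Proof.
move=> gK ga.
have cstK (b : R) : lip01 0 (fun=> b) by move=> x y _ _; rewrite subrr normr0 mul0r.
have intc (b : R) : \int[mu]_(x in I01) (fun=> b) x = b.
  transitivity (b * fine (mu I01)); first exact: (Rintegral_cst mu measurable_I01).
  by rewrite hmu.1 mulr1.
have lo : a - e <= \int[mu]_(x in I01) g x.
  rewrite -[leLHS]intc; apply: le_Rintegral measurable_I01 (lip01_integrable (cstK _)) (lip01_integrable gK) _.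
  by move=> x; rewrite I01E => /ga; rewrite ler_norml => /andP[h _]; lra.
have hi : \int[mu]_(x in I01) g x <= a + e.
  rewrite -[leRHS]intc; apply: le_Rintegral measurable_I01 (lip01_integrable gK) (lip01_integrable (cstK _)) _.
  by move=> x; rewrite I01E => /ga; rewrite ler_norml => /andP[_ h]; lra.
by rewrite ler_norml; apply/andP; split; lra.
Qed.

Lemma stationary_words K g n : lip01 K g ->
  \int[mu]_(x in I01) g x =
    \sum_(s : n.-tuple 'I_N) word_weight p s * \int[mu]_(x in I01) g (word_map phi s x).
Proof.
elim: n g K => [|n IH] g K gK.
  rewrite (big_pred1 [tuple]) /=; last by move=> t; apply/esym/eqP; exact: tuple0.
  by rewrite /word_weight big_nil mul1r.
rewrite (sum_tuple_cons n (fun s => word_weight p s * \int[mu]_(x in I01) g (word_map phi s x))).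
have [_ ->] := hmu; last exact: lip_within_continuous gK.
apply: eq_bigr => i _.
rewrite (IH (fun x => g (phi i x)) (`|K| * c)).
  rewrite mulr_sumr; apply: eq_bigr => s _.
  by rewrite /word_weight big_cons mulrA.
move=> x y x01 y01; have := wlip [:: i] x01 y01; rewrite /= expr1 => h.
apply: le_trans (gK _ _ (phi_I01 _ _ x01) (phi_I01 _ _ y01)) _.
rewrite -mulrA; apply: (@le_trans _ _ (`|K| * `|phi i y - phi i x|)).
  by rewrite ler_wpM2r // ler_norm.
by rewrite ler_wpM2l.
Qed.

(** Iterating stationarity writes the integral as a weighted sum over words; each word map sends
    [0, 1] to within [c ^+ n] of its fixed point. *)
Lemma stationary_close K g n (zw : seq 'I_N -> R) : lip01 K g -> 0 <= K ->
  (forall s, 0 <= zw s <= 1) -> (forall s, word_map phi s (zw s) = zw s) ->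
  `|\sum_(s : n.-tuple 'I_N) word_weight p s * g (zw s) - \int[mu]_(x in I01) g x| <= K * c ^+ n.
Proof.
move=> gK K0 z01 zE; rewrite (stationary_words n gK) -sumrB.
rewrite (le_trans (ler_norm_sum _ _ _)) //.
apply: (@le_trans _ _ (\sum_(s : n.-tuple 'I_N) word_weight p s * (K * c ^+ n))); last first.
  by rewrite -mulr_suml sum_word_weight // mul1r.
apply: ler_sum => s _; rewrite -mulrBr normrM ger0_norm ?word_weight_ge0 //.
rewrite ler_wpM2l ?word_weight_ge0 // distrC.
have w01 (x : R) : 0 <= x <= 1 -> 0 <= word_map phi s x <= 1 by exact: word_map_I01.
apply: (@Rintegral_close (K * c ^+ n)) => [x y x01 y01|x x01].
  apply: le_trans (gK _ _ (w01 _ x01) (w01 _ y01)) _.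
  by rewrite -mulrA ler_wpM2l //; have := wlip s x01 y01; rewrite size_tuple.
rewrite -[in g (zw s)](zE s).
apply: le_trans (gK _ _ (w01 _ (z01 s)) (w01 _ x01)) _; rewrite ler_wpM2l //.
apply: le_trans (wlip s (z01 s) x01) _; rewrite size_tuple ler_piMr ?exprn_ge0 ?(ltW c0) //.
have /andP[a0 a1] := z01 s; case/andP: x01 => b0 b1.
by rewrite ler_norml; apply/andP; split; lra.
Qed.

Lemma moment_I01 j : \int[mu]_x (x ^+ j) = \int[mu]_(x in I01) (x ^+ j).
Proof.
rewrite [RHS]Rintegral_mkcond /Rintegral; congr fine.
have mX : measurable_fun [set: measurableTypeR R] (fun x : R => x ^+ j).
  exact: exprn_measurable.
apply: ae_eq_integral => //.
- exact/measurable_EFinP.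
- apply/measurable_EFinP; apply/(measurable_restrictT _ measurable_I01).
  exact: measurable_funTS.
have c0' : mu (~` I01) = 0%E.
  transitivity (1 - mu I01)%E; first exact: (probability_setC mu measurable_I01).
  by rewrite hmu.1 subee.
exists (~` I01); split => //; first exact: measurableC measurable_I01.
move=> x /= h; apply: contra_not h => hx _.
by rewrite patchE mem_set.
Qed.

Lemma lip01_exp j : lip01 j%:R (fun x => x ^+ j).
Proof.
move=> x y /andP[x0 x1] /andP[y0 y1]; elim: j => [|j IH].
  by rewrite !expr0 subrr normr0 mul0r.
have -> : y ^+ j.+1 - x ^+ j.+1 = y * (y ^+ j - x ^+ j) + (y - x) * x ^+ j.
  by rewrite !exprS; ring.
rewrite (le_trans (ler_normD _ _)) // !normrM -natr1 mulrDl mul1r.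
apply: lerD; first by apply: le_trans IH; rewrite (ger0_norm y0) ler_piMl.
by rewrite ler_piMr // normrX (ger0_norm x0) exprn_ile1.
Qed.
End Stationary.

(** * Extraction of the analytic data *)

Section ComplexTopology.
Local Open Scope classical_set_scope.
Context (R : realType).

Lemma nbhs_cabs (z : R[i]^o) (A : set R[i]^o) :
  nbhs z A <-> exists2 d : R, 0 < d & forall w : R[i], cabs (w - z) < d -> A w.
Proof.
have gt0C (e : R[i]) : 0 < e -> e = (complex.Re e)%:C%C /\ 0 < complex.Re e.
  by case: e => a b; rewrite ltcE /= => /andP[/eqP -> ?].
split=> [/nbhs_ballP[e /gt0C[eE e0] h]|[d d0 h]].
  exists (complex.Re e) => // w hw; apply: h.
  by rewrite /ball /= cabsE eE ltcR cabsB.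
apply/nbhs_ballP; exists d%:C%C => /=; first by rewrite ltcR.
by move=> w; rewrite /ball /= cabsE ltcR cabsB; exact: h.
Qed.

Lemma derivable_cabs (f : R[i]^o -> R[i]^o) (z : R[i]^o) : derivable f z 1 ->
  forall e : R, 0 < e -> exists2 d : R, 0 < d & forall k : R[i], cabs k < d ->
    cabs (f (z + k) - f z - 'D_1 f z * k) <= e * cabs k.
Proof.
move=> df e e0; have /cvgrPdist_le/(_ e%:C%C) := df.
rewrite -/(derive f z 1) ltcR => /(_ e0); rewrite near_withinE => /nbhs_cabs[d d0 h].
exists d => // k kd; have [->|k0] := eqVneq k 0.
  by rewrite addr0 subrr mulr0 subrr cabs0 mulr0.
have := h k; rewrite subr0 => /(_ kd k0).
rewrite cabsE lecR /= => hk.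
have -> : f (z + k) - f z - 'D_1 f z * k = - ('D_1 f z - k^-1 * (f (z + k) - f z)) * k.
  by field.
rewrite cabsM cabsN ler_wpM2r ?cabs_ge0 //.
move: hk; congr (cabs (_ - _) <= _).
by rewrite /GRing.scale /= mulr1 [z + k]addrC.
Qed.

(* Lebesgue number lemma on a segment. *)
Lemma segment_uniform (a b : R) (P : R -> R -> Prop) :
  (forall x, a <= x <= b -> exists2 d, 0 < d & forall y e, `|y - x| < d -> 0 < e < d -> P e y) ->
  exists2 e : R, 0 < e & forall x, a <= x <= b -> P e x.
Proof.
move=> loc; have /compact_near_coveringP/(_ _ (0^'+ : set_system R) P) := @segment_compact R a b.
case.
  move=> x; rewrite /= in_itv /= => /loc[d d0 h].
  exists ([set y | `|y - x| < d], [set e | 0 < e < d]) => /=; last first.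
    by move=> [y e] /= [h1 h2]; exact: h.
  split; first by exists d => // y /=; rewrite /ball /= distrC.
  exists d => // e /=; rewrite /ball /= sub0r normrN => ed e0.
  by rewrite e0 (le_lt_trans (ler_norm _)).
move=> d /= d0 h; exists (d / 2); first by rewrite divr_gt0.
move=> x xab; apply: h => //=; rewrite ?in_itv //= ?divr_gt0 //.
by rewrite /ball /= sub0r normrN gtr0_norm ?divr_gt0 // gtr_pMr // invf_lt1 // ltr1n.
Qed.

Lemma is_derive_eps (f : R -> R) (x l : R) :
  (forall e, 0 < e -> exists2 d : R, 0 < d & forall k, `|k| < d -> `|f (x + k) - f x - l * k| <= e * `|k|) ->
  is_derive x 1 f l.
Proof.
move=> h.
have cv : (fun k => k^-1 *: ((f \o shift x) (k *: 1) - f x)) @ 0^' --> l.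
  apply/cvgrPdist_le => e e0; rewrite near_withinE; have [d d0 hd] := h e e0.
  exists d => // k; rewrite /ball /= sub0r normrN => kd k0.
  rewrite /GRing.scale /= mulr1 [k + x]addrC.
  have -> : l - k^-1 * (f (x + k) - f x) = - ((f (x + k) - f x - l * k) / k) by field.
  by rewrite normrN normrM normfV ler_pdivrMr ?normr_gt0 // hd.
by apply: DeriveDef; [apply/cvg_ex; exists l | exact: cvg_lim cv].
Qed.

(** Project onto the error [xi] itself: the real mean value theorem for the real part of
    [Num.conj xi] times the function gives a bound for [cabs xi ^+ 2], from which one factor is
    divided out. *)
Lemma mean_value_cabs (h h1 : R[i] -> R[i]) (z w a : R[i]) (e : R) : 0 <= e ->
  (forall t : R, 0 <= t <= 1 -> forall e1 : R, 0 < e1 -> exists2 d : R, 0 < d &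
    forall k : R[i], cabs k < d ->
      cabs (h (z + t%:C%C * (w - z) + k) - h (z + t%:C%C * (w - z)) - h1 (z + t%:C%C * (w - z)) * k) <= e1 * cabs k) ->
  (forall t : R, 0 <= t <= 1 -> cabs (h1 (z + t%:C%C * (w - z)) - a) <= e) ->
  cabs (h w - h z - a * (w - z)) <= e * cabs (w - z).
Proof.
move=> e0 hd hb; set xi := h w - h z - a * (w - z); set D := w - z.
pose u (t : R) := z + t%:C%C * D.
pose psi (t : R) : R := complex.Re (Num.conj xi * (h (u t) - a * (t%:C%C * D))).
pose dpsi (t : R) : R := complex.Re (Num.conj xi * ((h1 (u t) - a) * D)).
have cx : cabs (Num.conj xi) = cabs xi by rewrite /cabs norm_conjC.
have der (t : R) : 0 <= t <= 1 -> is_derive t 1 psi (dpsi t).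
  move=> t01; apply: is_derive_eps => e1 e10.
  pose B := cabs xi * cabs D + 1.
  have B0 : 0 < B by rewrite ltr_wpDl // mulr_ge0 ?cabs_ge0.
  have [d d0 hk] := hd t t01 (e1 / B) (divr_gt0 e10 B0).
  pose D1 := cabs D + 1; have D10 : 0 < D1 by rewrite ltr_wpDl ?cabs_ge0.
  exists (d / D1); first by rewrite divr_gt0.
  move=> k; rewrite ltr_pdivlMr // => kd.
  have -> : psi (t + k) - psi t - dpsi t * k = complex.Re (Num.conj xi *
     (h (u t + k%:C%C * D) - h (u t) - h1 (u t) * (k%:C%C * D))).
    rewrite /psi /dpsi.
    have -> : complex.Re (Num.conj xi * ((h1 (u t) - a) * D)) * k =
      complex.Re (Num.conj xi * ((h1 (u t) - a) * D) * k%:C%C).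
      by case: (Num.conj xi * _) => p q /=; rewrite mulr0 subr0.
    rewrite -!raddfB /=; congr complex.Re.
    have -> : u (t + k) = u t + k%:C%C * D by rewrite /u rmorphD /=; ring.
    by rewrite rmorphD /=; ring.
  apply: (le_trans (Re_le_cabs _)); rewrite cabsM cx.
  have kD : cabs (k%:C%C * D) = `|k| * cabs D by rewrite cabsM cabs_real.
  have /hk H : cabs (k%:C%C * D) < d.
    rewrite kD; apply: le_lt_trans kd; rewrite ler_wpM2l // lerDl //.
  apply: (@le_trans _ _ (cabs xi * (e1 / B * cabs (k%:C%C * D)))).
    by rewrite ler_wpM2l ?cabs_ge0.
  rewrite kD; have -> : cabs xi * (e1 / B * (`|k| * cabs D)) = e1 / B * (cabs xi * cabs D) * `|k| by ring.
  rewrite ler_wpM2r // -mulrA ler_piMr ?(ltW e10) // ler_pdivrMl // mulr1.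
  by rewrite /B lerDl.
have cont : {within `[0 : R, 1], continuous psi}.
  apply: derivable_within_continuous => t; rewrite in_itv /= => t01.
  have dt := der t t01; exact: ex_derive.
have [t t01 E] : exists2 t : R, t \in `]0, 1[%R & psi 1 - psi 0 = dpsi t * (1 - 0).
  apply: MVT => // t; rewrite in_itv /= => /andP[t0 t1].
  by apply: der; rewrite !ltW.
have xi2 : psi 1 - psi 0 = cabs xi ^+ 2.
  rewrite /psi -raddfB /= -mulrBr.
  have -> : h (u 1) - a * (1%:C%C * D) - (h (u 0) - a * (0%:C%C * D)) = xi.
    have -> : u 1 = w by rewrite /u rmorph1 mul1r /D addrC subrK.
    have -> : u 0 = z by rewrite /u rmorph0 mul0r addr0.
    by rewrite rmorph1 rmorph0 mul1r mul0r mulr0 subr0 addrAC.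
  rewrite mulrC -normCK cabsE -rmorphXn //.
have : cabs xi ^+ 2 <= cabs xi * (e * cabs D).
  rewrite -xi2 E subr0 mulr1; apply: le_trans (ler_norm _) _.
  apply: le_trans (Re_le_cabs _) _; rewrite !cabsM cx ler_wpM2l ?cabs_ge0 //.
  rewrite ler_wpM2r ?cabs_ge0 // hb //.
  by move: t01; rewrite in_itv /= => /andP[t0 t1]; rewrite !ltW.
have [->|xi0] := eqVneq xi 0; first by rewrite cabs0 mulr_ge0 ?cabs_ge0.
by rewrite expr2 ler_pM2l // cabs_gt0.
Qed.
End ComplexTopology.

(** * Uniform data from complex contraction *)

Section Contracting.
Local Open Scope classical_set_scope.
Context (R : realType) (N : nat) (phi : ifs_maps R N).

Lemma cabs_rect (x y x' y' : R) :
  cabs ((x' +i* y')%C - (x +i* y)%C) <= `|x' - x| + `|y' - y|.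
Proof. by rewrite (le_trans (cabs_le_ReIm _)) // !raddfB /=. Qed.

Lemma complex_contracting_data (i0 : 'I_N) : complex_contracting phi ->
  exists (f f1 : 'I_N -> R[i] -> R[i]) (r c : R), [/\ 0 < r, 0 < c < 1,
    forall i x, 0 <= x <= 1 -> f i x%:C%C = (phi i x)%:C%C,
    forall i z w, unit_nbhd r z -> unit_nbhd r w -> cabs (f i w - f i z) <= c * cabs (w - z) &
    forall i e, 0 < e -> exists2 del : R, 0 < del & unif_diff r e del (f i) (f1 i)].
Proof.
move=> [D [[_ _ _ oD] [D01 [f [fphi fder fC1 fsup]]]]].
have [rho rho0 hrho] : exists2 rho : R, 0 < rho & forall x : R, 0 <= x <= 1 ->
    forall w : R[i], cabs (w - x%:C%C) <= rho -> D w.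
  apply: segment_uniform => x x01.
  have /nbhs_cabs[d d0 hd] : nbhs (x%:C%C : R[i]^o) D.
    by apply: open_nbhs_nbhs; split=> //; apply: D01; rewrite /I01 /= in_itv.
  exists (d / 2); first by rewrite divr_gt0.
  move=> y e yd /andP[e0 ed] w we; apply: hd.
  apply: le_lt_trans (cabs_subD _ _ y%:C%C) _; rewrite -rmorphB /= cabs_real; lra.
(* Half of [rho], because the corners of the rectangle [[- r, 1 + r] x [- r, r]] are within [r + r]
   of [0, 1]. *)
pose r := rho / 2; have r0 : 0 < r by rewrite divr_gt0.
have rectD (x y : R) : - r <= x <= 1 + r -> - r <= y <= r -> D (x +i* y)%C.
  move=> /andP[x0 x1] /andP[y0 y1].
  have [t t01 ht] : exists2 t : R, 0 <= t <= 1 & `|x - t| <= r.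
    have [xn|xp] := ltP x 0; first by exists 0; rewrite ?lexx ?ler01 // ler_norml; apply/andP; split; lra.
    have [x1'|x1'] := leP x 1; first by exists x; rewrite ?xp ?x1' // subrr normr0 ltW.
    by exists 1; rewrite ?lexx ?ler01 // ler_norml; apply/andP; split; lra.
  apply: (hrho t t01); apply: le_trans (cabs_rect _ _ _ _) _.
  have : `|y - 0| <= r by rewrite subr0 ler_norml y0.
  by move: ht; rewrite /r; lra.
have nbhd_rect z : unit_nbhd r z -> - r <= complex.Re z <= 1 + r /\ - r <= complex.Im z <= r.
  move=> [t /andP[t0 t1] h].
  have := le_trans (Re_le_cabs _) h; have := le_trans (Im_le_cabs _) h.
  rewrite !raddfB /= subr0 !ler_norml => /andP[q1 q2] /andP[q3 q4].
  by split; apply/andP; split; lra.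
have nbhdD z : unit_nbhd r z -> D z.
  by move=> /nbhd_rect[h1 h2]; case: z h1 h2 => x y; exact: rectD.
have [c c01 hc] : exists2 c : R, 0 < c < 1 & forall i z, D z -> cabs ('D_1 (f i) z) <= c.
  (* A member of the set keeps its supremum from being minus infinity. *)
  have [i1 [z1 Dz1]] : exists (i : 'I_N) (z : R[i]^o), D z by exists i0, 0; apply: nbhdD; exact: unit_nbhd0 (ltW r0).
  move: fsup; set S := [set _ | _]; move=> fsup.
  have ub i z : D z -> ((cabs ('D_1 (f i) z))%:E <= ereal_sup S)%E.
    by move=> Dz; apply: ereal_sup_ubound; exists i, z.
  have : ereal_sup S \is a fin_num.
    rewrite fin_numE; apply/andP; split.
      by rewrite -ltNye (lt_le_trans _ (ub i1 z1 Dz1)) // ltNyr.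
    by rewrite -ltey (lt_trans fsup) // ltry.
  move=> Sfin; pose s := fine (ereal_sup S).
  have sE : ereal_sup S = s%:E by rewrite fineK.
  have s1 : s < 1 by rewrite -lte_fin -sE.
  have ubs i z : D z -> cabs ('D_1 (f i) z) <= s by move=> /(ub i); rewrite sE lee_fin.
  have s0 : 0 <= s by apply: le_trans (ubs i1 z1 Dz1); exact: cabs_ge0.
  (* The mean with 1 is positive even if all derivatives vanish. *)
  exists ((1 + s) / 2); first by apply/andP; split; lra.
  by move=> i z /(ubs i) h; lra.
have mv i z w (a : R[i]) (e : R) : 0 <= e -> unit_nbhd r z -> unit_nbhd r w ->
    (forall t : R, 0 <= t <= 1 -> cabs ('D_1 (f i) (z + t%:C%C * (w - z)) - a) <= e) ->
    cabs (f i w - f i z - a * (w - z)) <= e * cabs (w - z).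
  move=> e0 zr wr hb; apply: (@mean_value_cabs R (f i) ('D_1 (f i)) z w a e e0 _ hb) => t t01 e1 e10.
  apply: (@derivable_cabs R (f i) (z + t%:C%C * (w - z)) _ e1 e10); apply: fder; apply: nbhdD.
  exact: unit_nbhd_convex.
exists f, (fun i => 'D_1 (f i)), r, c; split=> //.
- move=> i z w zr wr; have := mv i z w 0 c; rewrite mul0r subr0; apply=> //.
    by case/andP: c01 => /ltW.
  by move=> t t01; rewrite subr0 hc //; apply: nbhdD; exact: unit_nbhd_convex.
move=> i e e0.
have [df [dfc dfE]] := fC1 i.
(* Uniform continuity of the derivative on the rectangle, by one Lebesgue number argument per
   coordinate; [Q] is the inner statement, made stable under small changes of [x]. *)
have [del del0 hdel] : exists2 del : R, 0 < del & forall x, - r <= x <= 1 + r ->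
   forall y, - r <= y <= r -> forall w : R[i], cabs (w - (x +i* y)%C) < del ->
     cabs (df w - df (x +i* y)%C) <= e.
  apply: (@segment_uniform R (- r) (1 + r) (fun d x => forall y, - r <= y <= r ->
    forall w : R[i], cabs (w - (x +i* y)%C) < d -> cabs (df w - df (x +i* y)%C) <= e)) => x hx.
  pose Q (d y : R) := forall x' d', `|x' - x| < d ->
     0 < d' < d -> forall w : R[i], cabs (w - (x' +i* y)%C) < d' -> cabs (df w - df (x' +i* y)%C) <= e.
  suff [d d0 hd] : exists2 d : R, 0 < d & forall y, - r <= y <= r -> Q d y.
    by exists d => // x' d' h1 h2 y hy w; exact: hd.
  apply: (@segment_uniform R (- r) r Q) => y hy.
  have Dxy := rectD x y hx hy.
  have /nbhs_cabs[d1 d10 hd1] : nbhs ((x +i* y)%C : R[i]^o) D by exact: open_nbhs_nbhs.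
  have e2 : 0 < e / 2 by rewrite divr_gt0.
  have /subspace_continuousP/(_ _ (subset_closure Dxy)) cv := dfc.
  have /cv : nbhs (df (x +i* y)%C) [set v | cabs (v - df (x +i* y)%C) < e / 2].
    by apply/nbhs_cabs; exists (e / 2).
  move=> /nbhs_cabs[d2 d20 hd2]; pose d := Num.min d1 d2 / 4.
  have m0 : 0 < Num.min d1 d2 by rewrite lt_min d10.
  have dd1 : 4 * d <= d1 by rewrite /d mulrC divfK // ge_min lexx.
  have dd2 : 4 * d <= d2 by rewrite /d mulrC divfK // ge_min lexx orbT.
  have near w : cabs (w - (x +i* y)%C) < 4 * d -> cabs (df w - df (x +i* y)%C) < e / 2.
    move=> wd; apply: hd2; first exact: lt_le_trans dd2.
    by apply: subset_closure; apply: hd1; exact: lt_le_trans dd1.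
  exists d; first by rewrite divr_gt0.
  move=> y' e' y'd /andP[e'0 e'd] x' d' x'd /andP[d'0 d'e] w wd.
  have h1 := cabs_rect x y x' y'.
  have h2 := cabs_subD w (x +i* y)%C (x' +i* y')%C.
  have n1 : cabs (df (x' +i* y')%C - df (x +i* y)%C) < e / 2.
    by apply: near; clear -h1 x'd y'd e'd d'e d'0; lra.
  have n2 : cabs (df w - df (x +i* y)%C) < e / 2.
    by apply: near; clear -h1 h2 wd x'd y'd e'd d'e d'0; lra.
  apply: le_trans (cabs_subD _ _ (df (x +i* y)%C)) _.
  by rewrite [X in _ + X]cabsB; clear -n1 n2; lra.
exists del => // z w zr wr wz; apply: mv => //; first exact: ltW.
move=> t t01; have ur := unit_nbhd_convex zr wr t01.
rewrite -!dfE; [|exact: nbhdD|exact: nbhdD].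
have [h1 h2] := nbhd_rect z zr; case: z h1 h2 {zr ur} wz => x y /= hx hy wz.
apply: hdel => //; rewrite addrAC subrr add0r cabsM cabs_real.
case/andP: t01 => t0 t1; rewrite ger0_norm //; apply: le_lt_trans wz.
by rewrite ler_piMl ?cabs_ge0.
Qed.
End Contracting.

(** * Convergence of the moments *)

Section Assembly.
Context (R : realType).

(** Compare both expansions at a real displacement tending to 0. This identifies the derivative
    produced by [smoothing] with the chain-rule product [dcword]. *)
Lemma C11_unique (r B B' : R) (h h1 h2 : R[i] -> R[i]) (x : R) : 0 < r -> 0 <= x <= 1 ->
  C11 r B h h1 -> C11 r B' h h2 -> h1 x%:C%C = h2 x%:C%C.
Proof.
move=> r0 x01 hC hC'; have B0 := C11_ge0 (ltW r0) hC; have B'0 := C11_ge0 (ltW r0) hC'.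
apply/eqP; rewrite -subr_eq0 -cabs_eq0 eq_le cabs_ge0 andbT.
apply/ler_addgt0Pr => e e0; rewrite add0r.
have BB : 0 < B + B' + 1 by lra.
pose t := Num.min r (e / (B + B' + 1)).
have t0 : 0 < t by rewrite lt_min r0 divr_gt0.
have te : t * (B + B' + 1) <= e by rewrite -ler_pdivlMr // ge_min lexx orbT.
pose w := x%:C%C + t%:C%C.
have dw : w - x%:C%C = t%:C%C by rewrite /w addrAC subrr add0r.
have wr : unit_nbhd r w by exists x => //; rewrite dw cabs_real gtr0_norm // ge_min lexx.
have xr := unit_nbhd_real (ltW r0) x01.
have [_ _ _ H] := hC; have [_ _ _ H'] := hC'.
have {}H := H _ _ xr wr; have {}H' := H' _ _ xr wr; rewrite dw cabs_real gtr0_norm // in H H'.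
have : cabs (h1 x%:C%C - h2 x%:C%C) * t <= (B + B') * t ^+ 2.
  rewrite -{1}(gtr0_norm t0) -cabs_real -cabsM.
  have -> : (h1 x%:C%C - h2 x%:C%C) * t%:C%C = - (h w - h x%:C%C - h1 x%:C%C * t%:C%C)
    + (h w - h x%:C%C - h2 x%:C%C * t%:C%C) by ring.
  by rewrite (le_trans (cabsD _ _)) // cabsN mulrDl lerD.
rewrite expr2 mulrA ler_pM2r // => /le_trans; apply; lra.
Qed.

Lemma C11_exp (r : R) j : 0 <= r -> exists B (g1 : R[i] -> R[i]), C11 r B (fun z => z ^+ j) g1.
Proof.
move=> r0; elim: j => [|j [B [g1 hg]]]; first by do 2 eexists; exact: C11_cst.
do 2 eexists; rewrite (_ : (fun z => _) = fun z : R[i] => id z * z ^+ j); first exact: C11M r0 (C11_id r0) hg.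
by apply: boolp.funext => z; rewrite exprS.
Qed.

Lemma sum_gaussian (e : nat -> nat -> R) m :
  (forall j, exists C lam : R, [/\ 0 < C, 0 < lam & forall k, e j k <= C * expR (- lam * k%:R ^+ 2)]) ->
  exists C lam : R, [/\ 0 < C, 0 < lam &
    forall k, \sum_(j < m) e j k <= C * expR (- lam * k%:R ^+ 2)].
Proof.
move=> he; elim: m => [|m [C [lam [C0 l0 IH]]]].
  by exists 1, 1; split=> // k; rewrite big_ord0 mul1r expR_ge0.
have [C' [lam' [C'0 l'0 h]]] := he m.
exists (C + C'), (Num.min lam lam'); split; [exact: addr_gt0|by rewrite lt_min l0|].
move=> k; rewrite big_ord_recr /= mulrDl lerD //.
  apply: le_trans (IH k) _; rewrite ler_pM2l // ler_expR ler_wpM2r ?exprn_ge0 //.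
  by rewrite lerN2 ge_min lexx.
apply: le_trans (h k) _; rewrite ler_pM2l // ler_expR ler_wpM2r ?exprn_ge0 //.
by rewrite lerN2 ge_min lexx orbT.
Qed.

Lemma euclidean_norm_le n (v : 'rV[R]_n) : euclidean_norm v <= \sum_j `|v ord0 j|.
Proof.
have s0 : 0 <= \sum_j `|v ord0 j| by apply: sumr_ge0.
rewrite /euclidean_norm -(ger0_norm s0) -sqrtr_sqr ler_sqrt ?sqr_ge0 //.
have : 0 <= \sum_j `|v ord0 j| /\ \sum_j v ord0 j ^+ 2 <= (\sum_j `|v ord0 j|) ^+ 2.
  apply: (big_ind2 (fun s q => 0 <= q /\ s <= q ^+ 2)) => [|x1 x2 y1 y2 [h1 h2] [h3 h4]|j _].
  - by rewrite lexx expr0n.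
  - by split; [exact: addr_ge0 | rewrite sqrrD; have := mulr_ge0 h1 h3; nra].
  - by rewrite real_normK ?num_real.
by case.
Qed.

Lemma moment_superexp (N : nat) (i0 : 'I_N) (phi : ifs_maps R N) (p : 'I_N -> R)
    (mu : probability (measurableTypeR R) R) :
  complex_contracting phi -> probability_vector p -> stationary phi p mu -> forall j,
  exists C lam : R, [/\ 0 < C, 0 < lam & forall k,
    `|mu_approx phi p (fun x => x ^+ j) k - \int[mu]_x (x ^+ j)| <= C * expR (- lam * k%:R ^+ 2)].
Proof.
move=> hcc [hp p1] hmu j.
have p0 i : 0 <= p i by have /andP[/ltW] := hp i.
have [f [f1 [r2 [c [r20 /andP[c0 c1] fphi flip2 fud]]]]] := complex_contracting_data i0 hcc.
(* [smoothing] is applied twice: to the maps, then to the compositions. *)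
pose r1 := r2 / 2; pose r := r1 / 2.
have r10 : 0 < r1 by rewrite divr_gt0.
have r0 : 0 < r by rewrite divr_gt0.
have r12 : r1 < r2 by rewrite gtr_pMr // invf_lt1 // ltr1n.
have r01 : r < r1 by rewrite gtr_pMr // invf_lt1 // ltr1n.
have r02 := lt_trans r01 r12.
have freal := f_real_of_phi fphi.
have flip1 i z w : unit_nbhd r1 z -> unit_nbhd r1 w -> cabs (f i w - f i z) <= c * cabs (w - z).
  by move=> zr wr; apply: flip2; apply: unit_nbhdW (ltW r12) _.
have flip i z w : unit_nbhd r z -> unit_nbhd r w -> cabs (f i w - f i z) <= c * cabs (w - z).
  by move=> zr wr; apply: flip2; apply: unit_nbhdW (ltW r02) _.
have /choice[F hF] : forall i, exists q : (R[i] -> R[i]) * R, C11 r1 q.2 (f i) q.1.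
  move=> i.
  have [z zr|f2 [B [hB _]]] := @smoothing R r2 r1 (1 + r2) (f i) (f1 i) r10 r12 (fud i) _.
    by apply: unit_nbhd_cabs; exact: (f_nbhd_r r20 c0 c1 freal flip2).
  by exists (f2, B).
pose fc1 i := (F i).1; pose Bf := \sum_i `|(F i).2|.
have fC1 i : C11 r1 Bf (f i) (fc1 i).
  apply: C11W (lexx _) _ (hF i); rewrite /Bf (bigD1 i) //=.
  by apply: le_trans (ler_norm _) _; rewrite lerDl sumr_ge0.
have fC i : C11 r Bf (f i) (fc1 i) by apply: C11W (ltW r01) (lexx _) (fC1 i).
pose zw := word_fixpoint phi.
have zw01 s : 0 <= zw s <= 1 by exact: (word_fixpoint01 r0 c0 c1 fphi flip).
have zwE s : word_map phi s (zw s) = zw s by have [] := word_fixpointP r0 c0 c1 fphi flip s.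
have zwfix s : (0 < size s)%N -> cword f s (zw s)%:C%C = (zw s)%:C%C.
  by move=> _; exact: (word_fixpoint_cword r0 c0 c1 fphi flip).
have wC s : exists B, C11 r B (cword f s) (dcword f fc1 s).
  exact: (cword_C11 r0 c0 c1 freal flip fC).
have quot s : exists G G1 B, [/\ C11 r B G G1,
    forall z, unit_nbhd r z -> cword f s z - cword f s (zw s)%:C%C = G z * (z - (zw s)%:C%C) &
    G (zw s)%:C%C = dcword f fc1 s (zw s)%:C%C].
  have [B1 hB1] := cword_C11 r10 c0 c1 freal flip1 fC1 s.
  have [||h2 [B2 [hB2 hG]]] := @smoothing R r1 r B1 (cword f s) (dcword f fc1 s) r0 r01.
  - move=> e e0; have B10 := C11_ge0 (ltW r10) hB1.
    exists (e / (B1 + 1)); first by rewrite divr_gt0 // ltr_wpDl.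
    exact: C11_unif_diff (ltW r10) e0 hB1.
  - by have [H _ _ _] := hB1.
  have [G [G1 [B3 [h3 h4 h5]]]] := hG _ (unit_nbhd_real (ltW r0) (zw01 s)).
  exists G, G1, B3; split=> //; rewrite h5.
  have [B hB] := wC s; exact: C11_unique r0 (zw01 s) hB2 hB.
have derE s : (derive01 (word_map phi s) (zw s))%:C%C = dcword f fc1 s (zw s)%:C%C.
  by have [B hB] := wC s; exact: (derive01_cword r0 c0 c1 fphi flip hB).
have den s : (0 < size s)%N -> `|1 - word_den phi s| <= c ^+ size s.
  move=> _; rewrite /word_den opprB addrCA subrr addr0 -cabs_real derE.
  have [G [G1 [B [hG hq <-]]]] := quot s.
  exact: (quotient_le r0 c0 c1 freal flip zw01 hG hq (unit_nbhd_real (ltW r0) (zw01 s))).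
have den_rot k s : word_den phi (rot k s) = word_den phi s.
  rewrite /word_den; congr (1 - _); apply: complexI.
  by rewrite !derE; exact: (dcword_rot fc1 r0 c0 c1 fphi flip).
have wlip s (x y : R) : 0 <= x <= 1 -> 0 <= y <= 1 ->
    `|word_map phi s y - word_map phi s x| <= c ^+ size s * `|y - x|.
  exact: (word_map_lip r0 c0 c1 fphi flip).
set g := fun x : R => x ^+ j.
have [Bg [g1 hg]] := C11_exp j (ltW r0).
pose y n := tau_ phi p g n / n%:R.
have yE n : y n.+1 = real_word_sum phi p g n.+1.
  by rewrite /y tau_E // mulrC mulKf // pnatr_eq0.
have ht n : (t_ phi p n.+1)%:C%C = word_sum p f fc1 zw (fun=> 1) n.+1.
  rewrite t_E; apply: real_word_sumE => [x|s]; [by rewrite rmorph1 | exact: derE].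
have hy n : (y n.+1)%:C%C = word_sum p f fc1 zw (fun z => z ^+ j) n.+1.
  rewrite yE; apply: real_word_sumE => [x|s]; [by rewrite rmorphXn | exact: derE].
have expa : is_exp_series (t_ phi p) (a_ phi p).
  by split=> // n; exact: (comp_expS (t_ phi p)).
have al0 : alpha_ phi p g 0 = 0 by exact: comp_deriv0.
have alS n : alpha_ phi p g n.+1 = - \sum_(i < n.+1) y i.+1 * a_ phi p (n - i)%N.
  exact: (comp_derivS (t_ phi p) (tau_ phi p g)).
have [A [lam [l0 hA hal]]] := exp_series_gaussian p0 p1 r0 c0 c1 freal flip fC zw01 zwfix quot
  ht expa hg hy al0 alS.
have c1' : 0 < 1 - c by rewrite subr_gt0.
(* The first term comes from the denominators of the words, [j%:R] from the Lipschitz constant of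
   the power on [0, 1]. *)
pose C := 1 / (1 - c) + j%:R.
have C0 : 0 <= C by rewrite addr_ge0 // divr_ge0 // ltW.
have g1le (x : R) : 0 <= x <= 1 -> `|g x| <= 1.
  by move=> /andP[x0 x1]; rewrite /g normrX ger0_norm // exprn_ile1.
have tb n : `|t_ phi p n.+1 - 1| <= C * c ^+ n.+1.
  rewrite t_E; apply: (@le_trans _ _ ((1 / (1 - c) + 0) * c ^+ n.+1)); last first.
    by rewrite ler_wpM2r ?exprn_ge0 ?(ltW c0) // lerD2l.
  apply: (real_word_sum_close p0 p1 c0 c1 den (g := fun=> 1)) => //; first by move=> *; rewrite normr1.
  under eq_bigr do rewrite mulr1.
  by rewrite sum_word_weight // subrr normr0 mul0r.
have yb n : `|y n.+1 - \int[mu]_x (x ^+ j)| <= C * c ^+ n.+1.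
  rewrite yE (moment_I01 hmu).
  apply: (real_word_sum_close p0 p1 c0 c1 den) => //.
  exact: (stationary_close p0 p1 c0 hmu wlip n.+1 (@lip01_exp R j) (ler0n _ _) zw01 zwE).
have [|C' [lam' [C'0 l'0 h]]] := quotient_superexp _ C0 l0 tb yb expa al0 alS hA hal.
  by rewrite c0 c1.
by exists C', lam'.
Qed.
End Assembly.

Theorem corollary6p1 (R : realType) (N : nat) (hN : (2 <= N)%N)
    (phi : ifs_maps R N) (p : 'I_N -> R)
    (mu : probability (measurableTypeR R) R)
    (hphi : is_ifs phi) (hcc : complex_contracting phi)
    (hp : probability_vector p) (hmu : stationary phi p mu) (m : nat) :
  exists C lambda : R, 0 < C /\ 0 < lambda /\
    forall k : nat, (1 <= k)%N ->
      euclidean_norm (moment_approx phi p m k - moments mu m)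
        < C * expR (- lambda * k%:R ^+ 2).
Proof.
have i0 : 'I_N by exact: (Ordinal (ltnW hN)).
have [C [lam [C0 l0 h]]] := sum_gaussian m.+1 (moment_superexp i0 hcc hp hmu).
(* Adding 1 makes the inequality strict. *)
exists (C + 1), lam; split; [exact: addr_gt0 | split=> // k _].
apply: (le_lt_trans (euclidean_norm_le _)).
apply: (@le_lt_trans _ _ (C * expR (- lam * k%:R ^+ 2))); last first.
  by rewrite ltr_pM2r ?expR_gt0 // ltrDl.
by apply: le_trans (h k); apply: ler_sum => j _; rewrite !mxE.
Qed.
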